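(* Let $(a_k)_{k\in\mathbb{N}}$ be a sequence with $a_k>0$ for all $k$, let $\mu=\mu_{ac}+\mu_{disc}$ with $\mu_{ac}=x^2\mathbf 1_{(0,1)}\,dx$ and $\mu_{disc}=\sum_{k=1}^\infty a_k\delta_k$, let $F=[0,1]\cup\mathbb{N}$ be the support of $\mu$, and let $\check{\mathcal{E}}$ be the trace of the Bessel Dirichlet form $\mathcal{E}$ (case $n=3$) with respect to $\mu$. 1. Assume that $\mu_{disc}(F)<\infty$. Then, whatever the metric considered on $F$, $\check{\mathcal{E}}$ is not conservative. 2. Assume that $\mu_{disc}(F)=\infty$ and that $F$ is endowed with the Euclidean metric. If $$\sup_{k\in\mathbb{N}}\frac{k^2}{a_k}<\infty\qquad\text{and}\qquad \liminf_{k\to\infty}\frac{\ln\big(\sum_{j=1}^ka_j\big)}{k\ln k}<\infty,$$ then $\check{\mathcal{E}}$ is conservative.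
   Context: $\mathbb{N}=\{1,2,\dots\}$ and $I=(0,\infty)$; $AC(I)$ denotes the (locally) absolutely continuous functions on $I$. Let $dm=2x^2\,dx$ on $I$. The Bessel Dirichlet form (case $n=3$) is the form in $L^2(I,m)$ with $$\mathcal{D}=\{u\in AC(I)\cap L^2(I,m):\ \int_0^\infty (u')^2x^2\,dx<\infty\},\qquad \mathcal{E}[u]=\int_0^\infty (u'(x))^2x^2\,dx .$$ For $\lambda>0$, $\mathcal{E}_\lambda[u]=\mathcal{E}[u]+\lambda\int_I u^2\,dm$. Trace with respect to $\mu$: let $D(J)=\{u\in\mathcal{D}:u|_F\in L^2(F,\mu)\}$ and $J:D(J)\to L^2(F,\mu)$, $Ju=u|_F$ (the point $0$ is $\mu$-null). For $\lambda>0$ let $P_\lambda$ be the orthogonal projection in $(\mathcal{D},\mathcal{E}_\lambda)$ onto the $\mathcal{E}_\lambda$-orthogonal complement of $\ker J=\{u\in\mathcal{D}:u|_{(0,1)}=0,\ u(k)=0\ \forall k\in\mathbb{N}\}$, and set $\check{\mathcal{E}}_\lambda[Ju]:=\mathcal{E}_\lambda[P_\lambda u]$ for $u\in D(J)$. Each $\check{\mathcal{E}}_\lambda$ is a closed form in $L^2(F,\mu)$ with domain $\operatorname{ran}J$, and the family is monotone increasing in $\lambda$. The trace form $\check{\mathcal{E}}$ is by definition the Mosco limit of $\check{\mathcal{E}}_\lambda$ as $\lambda\downarrow0$; it is a Dirichlet form in $L^2(F,\mu)$. A Dirichlet form is conservative (stochastically complete) if its semigroup $\check T_t$, extended to $L^\infty$,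 satisfies $\check T_t1=1$ for some (hence every) $t>0$. *)

(* Defs.v *)
From HB Require Import structures.
From mathcomp Require Import all_boot all_order all_algebra interval_inference.
From mathcomp Require Import all_classical all_reals all_analysis measurable_realfun.

Set Implicit Arguments.
Unset Strict Implicit.
Unset Printing Implicit Defensive.

Import Order.TTheory GRing.Theory Num.Theory.
Import numFieldNormedType.Exports.

Local Open Scope classical_set_scope.
Local Open Scope ring_scope.

(* Functions on I = (0, oo) or on F are represented by (Borel) functions on R.
   The measure m is concentrated on I and mu on F (mu_setCF), so L^2(I, m) and
   L^2(F, mu) are L^2(R, m) and L^2(R, mu).  Elements of L^2 are functions taken
   up to almost everywhere equality, not equivalence classes. *)

Section measures.
Context {R : realType}.

Definition sqdx (A : set R) : \bar R :=
  (\int[lebesgue_measure]_(x in A) (x ^+ 2)%:E)%E.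

Let sqdx0 : sqdx set0 = 0%E.
Proof. by rewrite /sqdx integral_set0. Qed.

Let sqdx_ge0 A : (0 <= sqdx A)%E.
Proof. by apply: integral_ge0 => x _; rewrite lee_fin sqr_ge0. Qed.

Let sqdx_sigma_additive : semi_sigma_additive sqdx.
Proof.
move=> /= A mA tA mbA; rewrite /sqdx ge0_integral_bigcup//.
- by apply: is_cvg_nneseries => n _ _; exact: sqdx_ge0.
- by apply/measurable_EFinP; exact: exprn_measurable.
- by move=> x _; rewrite lee_fin sqr_ge0.
Qed.

HB.instance Definition _ :=
  isMeasure.Build _ _ _ sqdx sqdx0 sqdx_ge0 sqdx_sigma_additive.

Definition I : set R := `]0, +oo[%classic.

Definition F : set R := `[0, 1]%classic `|` [set k%:R | k in [set k : nat | (0 < k)%N]].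

Lemma measurable_I : measurable I.
Proof. exact: measurable_itv. Qed.

Definition m : {measure set R -> \bar R} :=
  mscale 2%:nng (mrestr sqdx measurable_I).

Definition mu_ac : {measure set R -> \bar R} :=
  mrestr sqdx (measurable_itv `]0, 1[).

(* The sequence a is indexed from 1: the term a 0 is never used. *)
Definition mu_disc (a : nat -> {posnum R}) : {measure set R -> \bar R} :=
  mseries (fun k => mscale (a k)%:num%:nng (dirac (k%:R : R))) 1.

Definition mu (a : nat -> {posnum R}) : {measure set R -> \bar R} :=
  measure_add mu_ac (mu_disc a).

Lemma mu_setCF (a : nat -> {posnum R}) : mu a (~` F) = 0%E.
Proof.
transitivity (mu_ac (~` F) + mu_disc a (~` F))%E; first exact: measure_addE.
have -> : mu_ac (~` F) = 0%E.
  rewrite /mu_ac /= /mrestr (_ : _ `&` _ = set0) ?measure0//.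
  apply/seteqP; split => // x [] /= Fx; rewrite in_itv/= => /andP[x0 x1].
  by apply: Fx; left; rewrite /= in_itv/= !ltW.
rewrite add0e /mu_disc /= /mseries eseries0// => k k1 _.
transitivity ((a k)%:num%:E * \d_(k%:R : R) (~` F))%E; first by [].
by rewrite diracE memNset ?mule0//; apply; right; exists k.
Qed.

End measures.

(* Quadratic forms on L^2(mu), with value +oo outside their domain. *)
Section forms.
Context d {T : measurableType d} {R : realType}.
Variable mu : {measure set T -> \bar R}.
Implicit Types (f g h : T -> R) (E : (T -> R) -> \bar R).

Definition L2 f : Prop := f \in Lfun mu 2%:E.

Definition weak_cvg (f_ : nat -> T -> R) f := forall g, L2 g ->
  \int[mu]_x (f_ n x * g x) @[n --> \oo] --> \int[mu]_x (f x * g x).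

Definition strong_cvg (S : Type) (G : set_system S) (f_ : S -> T -> R) f :=
  ('N[mu]_2%:E [EFin \o (f_ s \- f)%R])%E @[s --> G] --> 0%E.

Definition mosco_cvg (E_ : nat -> (T -> R) -> \bar R) E :=
  (forall (f_ : nat -> T -> R) f, (forall n, L2 (f_ n)) -> L2 f -> weak_cvg f_ f ->
    (E f <= limn_einf (fun n => E_ n (f_ n)))%E) /\
  (forall f, L2 f -> exists f_ : nat -> T -> R, [/\ forall n, L2 (f_ n),
    strong_cvg \oo f_ f & (limn_esup (fun n => E_ n (f_ n)) <= E f)%E]).

Definition form_dom E f := L2 f /\ (E f < +oo)%E.

(* The bilinear form, for f and g in the domain of the quadratic form E. *)
Definition polar E f g : R := (fine (E (f \+ g)) - fine (E (f \- g))) / 4.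

(* g = L f, where L is the nonnegative self-adjoint operator associated with E,
   i.e. E(f, h) = (L f, h) for all h in the domain of E. *)
Definition form_op E f g := [/\ form_dom E f, L2 g &
  forall h, form_dom E h -> polar E f h = \int[mu]_x (g x * h x)].

(* Strongly continuous semigroup of symmetric contractions of L^2(mu). *)
Record L2_semigroup (P : R -> (T -> R) -> T -> R) : Prop := {
  sg_L2 : forall t f, 0 < t -> L2 f -> L2 (P t f) ;
  sg_ae : forall t f g, 0 < t -> L2 f -> L2 g ->
    f = g %[ae mu] -> P t f = P t g %[ae mu] ;
  sg_linear : forall t c f g, 0 < t -> L2 f -> L2 g ->
    P t (fun x => c * f x + g x) = (fun x => c * P t f x + P t g x) %[ae mu] ;
  sg_sym : forall t f g, 0 < t -> L2 f -> L2 g ->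
    \int[mu]_x (P t f x * g x) = \int[mu]_x (f x * P t g x) ;
  sg_contr : forall t f, 0 < t -> L2 f ->
    ('N[mu]_2%:E [EFin \o P t f] <= 'N[mu]_2%:E [EFin \o f])%E ;
  sg_add : forall s t f, 0 < s -> 0 < t -> L2 f ->
    P (s + t) f = P s (P t f) %[ae mu] ;
  sg_cont : forall f, L2 f -> strong_cvg 0^'+ (P^~ f) f }.

(* P is the semigroup (e^{- t L})_t of the form E: its generator is - L. *)
Definition semigroup_of E P := L2_semigroup P /\
  forall f g, L2 f -> L2 g ->
    form_op E f g <->
    strong_cvg 0^'+ (fun t x => t^-1 * (f x - P t f x)) g.

(* g is the value at 0 <= f in L^oo of the extension of the operator S from L^2
   to L^oo, obtained by monotone approximation. *)
Definition Linfty_ext (S : (T -> R) -> T -> R) f g :=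
  forall f_ : nat -> T -> R, (forall n, L2 (f_ n)) ->
    (forall n, {ae mu, forall x, 0 <= f_ n x <= f_ n.+1 x}) ->
    {ae mu, forall x, f_ n x @[n --> \oo] --> f x} ->
    {ae mu, forall x, S (f_ n) x @[n --> \oo] --> g x}.

(* Stochastic completeness of a form is that of its semigroup P; it depends only
   on the form and the measure, and not on any metric on the space. *)
Definition conservative P := exists2 t : R, 0 < t & Linfty_ext (P t) (cst 1) (cst 1).

End forms.

Section bessel_form.
Context {R : realType}.
Implicit Types (u v w f : R -> R) (lam : R).

Definition abs_cont_itv (a b : R) u := forall eps : R, 0 < eps ->
  exists2 del : R, 0 < del &
    forall (n : nat) (l r : 'I_n -> R),
      (forall i, a <= l i /\ l i <= r i /\ r i <= b) ->
      (forall i j, i != j -> r i <= l j \/ r j <= l i) ->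
      \sum_(i < n) (r i - l i) < del ->
      \sum_(i < n) `|u (r i) - u (l i)| < eps.

Definition loc_abs_cont u := forall a b : R, 0 < a -> a < b -> abs_cont_itv a b u.

(* For u in AC(I) the derivative u' exists Lebesgue-a.e.; the junk values of
   derive1 u at the remaining points do not affect the integrals. *)
Definition D u := [/\ loc_abs_cont u, L2 m u &
  (\int[lebesgue_measure]_(x in I) ((derive1 u x) ^+ 2 * x ^+ 2)%:E < +oo)%E].

Definition bessel u v : R :=
  \int[lebesgue_measure]_(x in I) (derive1 u x * derive1 v x * x ^+ 2).

Definition bessel_lam lam u v : R :=
  bessel u v + lam * \int[m]_x (u x * v x).

End bessel_form.

Section trace.
Context {R : realType}.
Implicit Types (a : nat -> {posnum R}) (u v w f : R -> R) (lam : R).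

Definition DJ a u := D u /\ L2 (mu a) u.

Definition kerJ u := [/\ D u, (forall x, 0 < x < 1 -> u x = 0) &
  forall k : nat, (0 < k)%N -> u k%:R = 0].

Definition kerJ_orth lam w :=
  D w /\ forall v, kerJ v -> bessel_lam lam w v = 0.

(* w = P_lam u *)
Definition is_proj lam u w :=
  kerJ_orth lam w /\
  forall v, kerJ_orth lam v -> bessel_lam lam (u \- w) v = 0.

(* The set below has at most one element, and is empty exactly when f is not in
   ran J; the form is extended by +oo outside its domain. *)
Definition trace_lam a lam f : \bar R :=
  xget +oo%E [set e | exists u w, [/\ DJ a u, u = f %[ae mu a],
    is_proj lam u w & e = (bessel_lam lam w w)%:E]].

End trace.

(* E is the Mosco limit of the forms trace_lam a lam as lam decreases to 0. *)
Definition is_trace (R : realType) (a : nat -> {posnum R})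
    (E : (R -> R) -> \bar R) :=
  forall lam : nat -> R, (forall n, 0 < lam n) -> lam n @[n --> \oo] --> 0 ->
    mosco_cvg (mu a) (fun n => trace_lam a (lam n)) E.

(* Main.v *)
From HB Require Import structures.
Require Import Defs.
From mathcomp Require Import all_boot all_order all_algebra interval_inference.
From mathcomp Require Import all_classical all_reals all_analysis.
From mathcomp Require Import measurable_realfun ring lra.
Set Implicit Arguments.
Unset Strict Implicit.
Unset Printing Implicit Defensive.
Import Order.TTheory GRing.Theory Num.Theory.
Import numFieldNormedType.Exports.
Local Open Scope classical_set_scope.
Local Open Scope ring_scope.

(** Let [L] be the nonnegative operator of the trace form. Everything that is
    used about the trace form comes from the Bessel space [D], in two steps.
    For a fixed [lam] the projection of an element of [D] is explicit: it keeps
    the function on ]0, 1] and interpolates between consecutive integers by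
    solutions of [(x^2 w')' = 2 lam x^2 w] ([exists_orth_proj]). So the energy of
    a trace is attained by an extension of it in [D] and is a lower bound for the
    energies of all its extensions ([trace_attained], [trace_le_bessel]). The
    Mosco limit then becomes a statement about sequences in [D]: a function of
    finite energy has a recovery sequence in [D] ([trace_recovery]), and the
    asymptotic energy of a convergent sequence in [D] bounds the energy of its
    limit ([trace_upper]). Applying Lipschitz maps to recovery sequences gives the
    Markov property ([trace_comp], [form_op_excess]).

    Non-conservativeness. If [mu] is finite, then 1 is square-integrable and a
    conservative semigroup fixes it, so [L 1 = 0] ([conservative_gen1]) and 1 has
    energy zero. It is then the limit in L^2(mu) of functions [w n] of Bessel
    energy tending to 0. But the Bessel process in dimension three is transient:
    [w 1 ^+ 2] is at most the energy of [w] ([D_at1_sqr_le]). Hence [w n 1] tends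
    to 0, while the atom of [mu] at 1 forces it to tend to 1.

    Conservativeness. The function [X_k] that is 1 up to [k], 0 from [k + 1] on and
    [k (k + 1) / x - k] in between ([cutoff]) is harmonic away from [k] and
    [k + 1], so its product with [w] in the Bessel form is
    [k (k + 1) (w k - w (k + 1))]. In the limit this gives
    [L X_k = k (k + 1) (1_{k} / a_k - 1_{k + 1} / a_{k + 1})] ([cutoff_form_op]).
    If [k ^ 2 / a_k <= C] for all [k], the average [chi_m] of [X_1, ..., X_m]
    satisfies [L chi_m <= 2 C / m], because at each point at most one of the
    averaged functions is positive. So [chi_m], which tends to 1, loses at most
    [2 C t / m] of its mass up to time [t] ([S_supersol]), and the semigroup fixes
    1 ([conservative_cutoff]).

    The Markov property of the semigroup is derived from that of the form. The
    domain of the generator is dense ([gen_dense]), and along trajectories starting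
    there the norm of [excess f = (f - 1)^+] decreases, because it is convex and
    the form pairs [f] nonnegatively with [excess f] ([nm_excess_decr]).

    All computations with the Bessel form are instances of the fundamental theorem
    of calculus for absolutely continuous functions ([AC_FTC]): such a function is
    the difference of two nondecreasing ones whose Stieltjes measures have
    densities, by the Radon-Nikodym theorem. *)

(** * Inner product and norm of L^2 *)

Section L2_theory.
Context d (T : measurableType d) (R : realType).
Variable mu : {measure set T -> \bar R}.
Implicit Types (f g h : T -> R).
Local Notation L2 := (L2 mu).

Definition L2dot f g : R := \int[mu]_x (f x * g x).
Definition L2norm f : R := Num.sqrt (L2dot f f).

Lemma L2P f : L2 f <->
  measurable_fun setT f /\ (\int[mu]_x (f x ^+ 2)%:E < +oo)%E.
Proof.
have sqE : (\int[mu]_x (`|(f x)%:E| `^ 2) = \int[mu]_x (f x ^+ 2)%:E)%E.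
  by apply: eq_integral => x _; rewrite /= powR_mulrn// real_normK ?num_real.
rewrite /Defs.L2; split => [|[mf foo]].
  move=> /[dup] L2f; rewrite inE => /andP[]; rewrite !inE/= => mf _; split => //.
  have := Lfun2_integrable_sqr L2f => /integrableP[_].
  by under eq_integral do rewrite /= ger0_norm ?sqr_ge0//.
rewrite inE; apply/andP; split; rewrite !inE//= /finite_norm unlock /=.
by rewrite sqE poweR_lty.
Qed.

Lemma L2_measurable f : L2 f -> measurable_fun setT f.
Proof. by move=> /L2P[]. Qed.

Lemma L2_le f g : measurable_fun setT f -> L2 g -> (forall x, `|f x| <= `|g x|) ->
  L2 f.
Proof.
move=> mf /L2P[mg goo] fg; apply/L2P; split => //; apply: le_lt_trans goo.
apply: ge0_le_integral => //.
- by move=> x _; rewrite lee_fin sqr_ge0.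
- by apply/measurable_EFinP; exact: measurable_funX.
- by apply/measurable_EFinP; exact: measurable_funX.
- by move=> x _; rewrite lee_fin -[leLHS]real_normK ?num_real// -[leRHS]real_normK ?num_real//
    lerXn2r ?nnegrE.
Qed.

Lemma L20 : L2 (cst 0).
Proof.
apply/L2P; split; first exact: measurable_cst.
by under eq_integral do rewrite /= expr0n/=; rewrite integral0.
Qed.

Lemma L2D f g : L2 f -> L2 g -> L2 (f \+ g).
Proof. by rewrite /Defs.L2 => Lf Lg; apply: (rpredD Lf Lg); rewrite ?lee1n. Qed.

Lemma L2Z c f : L2 f -> L2 (fun x => c * f x).
Proof.
move=> Lf; rewrite (_ : (fun x => _) = c \o* f).
  by apply: Lfun_scale => //; rewrite ler1n.
by apply/funext => x /=; rewrite mulrC.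
Qed.

Lemma L2B f g : L2 f -> L2 g -> L2 (f \- g).
Proof.
move=> Lf /(L2Z (-1)) Lg; have := L2D Lf Lg.
by congr (Defs.L2 _ _); apply/funext => x /=; rewrite mulN1r.
Qed.

Lemma ip_integrable f g : L2 f -> L2 g ->
  mu.-integrable setT (fun x => (f x * g x)%:E).
Proof. by move=> Lf Lg; apply/Lfun1_integrable; exact: Lfun2_mul_Lfun1. Qed.

Lemma ip_EFin f g : L2 f -> L2 g -> (L2dot f g)%:E = (\int[mu]_x (f x * g x)%:E)%E.
Proof.
move=> Lf Lg; rewrite /L2dot /Rintegral fineK//.
exact: integrable_fin_num (ip_integrable Lf Lg).
Qed.

Lemma ipC f g : L2dot f g = L2dot g f.
Proof. by apply: eq_Rintegral => x _; rewrite mulrC. Qed.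

Lemma ipDl f g h : L2 f -> L2 g -> L2 h -> L2dot (f \+ g) h = L2dot f h + L2dot g h.
Proof.
move=> Lf Lg Lh; rewrite /L2dot -RintegralD//; last 2 first.
  exact: ip_integrable.
  exact: ip_integrable.
by apply: eq_Rintegral => x _ /=; rewrite mulrDl.
Qed.

Lemma ipZl c f g : L2 f -> L2 g -> L2dot (fun x => c * f x) g = c * L2dot f g.
Proof.
move=> Lf Lg; rewrite /L2dot -RintegralZl//; last exact: ip_integrable.
by apply: eq_Rintegral => x _ /=; rewrite mulrA.
Qed.

Lemma ipBl f g h : L2 f -> L2 g -> L2 h -> L2dot (f \- g) h = L2dot f h - L2dot g h.
Proof.
move=> Lf Lg Lh; rewrite -mulN1r -ipZl// -ipDl//; last exact: L2Z.
by congr L2dot; apply/funext => x /=; rewrite mulN1r.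
Qed.

Lemma ipDr f g h : L2 f -> L2 g -> L2 h -> L2dot h (f \+ g) = L2dot h f + L2dot h g.
Proof. by move=> *; rewrite ipC ipDl// ![L2dot h _]ipC. Qed.

Lemma ipBr f g h : L2 f -> L2 g -> L2 h -> L2dot h (f \- g) = L2dot h f - L2dot h g.
Proof. by move=> *; rewrite ipC ipBl// ![L2dot h _]ipC. Qed.

Lemma ipZr c f g : L2 f -> L2 g -> L2dot f (fun x => c * g x) = c * L2dot f g.
Proof. by move=> *; rewrite ipC ipZl// ipC. Qed.

Lemma ip_ge0 f : 0 <= L2dot f f.
Proof. by apply: Rintegral_ge0 => x _; rewrite -expr2 sqr_ge0. Qed.

Lemma nm_ge0 f : 0 <= L2norm f.
Proof. exact: sqrtr_ge0. Qed.

Lemma nm_sqr f : L2norm f ^+ 2 = L2dot f f.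
Proof. by rewrite sqr_sqrtr// ip_ge0. Qed.

Lemma nmZ c f : L2 f -> L2norm (fun x => c * f x) = `|c| * L2norm f.
Proof.
move=> Lf; rewrite /L2norm ipZl ?ipZr//; last exact: L2Z.
by rewrite mulrA -expr2 sqrtrM ?sqr_ge0// sqrtr_sqr.
Qed.

(** The quadratic [ip (f + t g) (f + t g)] in [t] is nonnegative, so
    its discriminant is not positive. *)
Lemma ip_CS f g : L2 f -> L2 g -> `|L2dot f g| <= L2norm f * L2norm g.
Proof.
move=> Lf Lg.
rewrite -(@ler_pXn2r _ 2)// ?nnegrE ?mulr_ge0 ?nm_ge0//.
rewrite exprMn !nm_sqr real_normK ?num_real//.
have quad t : 0 <= L2dot f f + 2 * t * L2dot f g + t ^+ 2 * L2dot g g.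
  have := ip_ge0 (f \+ (fun x => t * g x)).
  rewrite ipDl//; [|exact: L2Z|by apply: L2D => //; exact: L2Z].
  rewrite !ipDr// ?ipZl ?ipZr//; try exact: L2Z.
  by rewrite (ipC g f); congr (_ <= _); ring.
have [g0|gn0] := eqVneq (L2dot g g) 0.
  rewrite g0 mulr0; have [->|fgn0] := eqVneq (L2dot f g) 0; first by rewrite expr0n.
  have := quad (- (L2dot f f + 1) / (2 * L2dot f g)); rewrite g0 mulr0 addr0.
  rewrite (_ : _ + _ = -1); first by rewrite oppr_ge0 ler10.
  by field.
have gg0 : 0 < L2dot g g by rewrite lt_def gn0 ip_ge0.
have := quad (- L2dot f g / L2dot g g).
rewrite (_ : _ + _ = (L2dot f f * L2dot g g - L2dot f g ^+ 2) / L2dot g g); last by field.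
by rewrite pmulr_lge0 ?invr_gt0// subr_ge0.
Qed.

Lemma nmD f g : L2 f -> L2 g -> L2norm (f \+ g) <= L2norm f + L2norm g.
Proof.
move=> Lf Lg.
rewrite -(@ler_pXn2r _ 2)// ?nnegrE ?addr_ge0 ?nm_ge0//.
rewrite sqrrD !nm_sqr ipDl//; last exact: L2D.
rewrite !ipDr// (ipC g f).
have := le_trans (ler_norm _) (ip_CS Lf Lg); lra.
Qed.

Lemma nmN f : L2norm (\- f) = L2norm f.
Proof. by rewrite /L2norm /L2dot; under eq_Rintegral do rewrite /= mulrNN. Qed.

Lemma nmBC f g : L2norm (f \- g) = L2norm (g \- f).
Proof. by rewrite -nmN; congr L2norm; apply/funext => x /=; rewrite opprB. Qed.

Lemma L2N f : L2 f -> L2 (\- f).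
Proof.
by move=> /(L2Z (-1)); congr (Defs.L2 _ _); apply/funext => x /=; rewrite mulN1r.
Qed.

Lemma nmB f g : L2 f -> L2 g -> L2norm (f \- g) <= L2norm f + L2norm g.
Proof. by move=> Lf Lg; rewrite -(nmN g); apply: nmD => //; exact: L2N. Qed.

Lemma nm_dist f g h : L2 f -> L2 g -> L2 h ->
  L2norm (f \- h) <= L2norm (f \- g) + L2norm (g \- h).
Proof.
move=> Lf Lg Lh; apply: le_trans (nmD (L2B Lf Lg) (L2B Lg Lh)).
by rewrite le_eqVlt; apply/orP; left; apply/eqP; congr L2norm; apply/funext => x /=; ring.
Qed.

Lemma ae_ip f f' g g' : L2 f -> L2 f' -> L2 g -> L2 g' ->
  f = f' %[ae mu] -> g = g' %[ae mu] -> L2dot f g = L2dot f' g'.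
Proof.
move=> Lf Lf' Lg Lg' ff' gg'; rewrite /L2dot /Rintegral; congr fine.
apply: ae_eq_integral => //.
- by apply/measurable_EFinP; apply: measurable_funM; exact: L2_measurable.
- by apply/measurable_EFinP; apply: measurable_funM; exact: L2_measurable.
- by move: ff' gg'; apply: filterS2 => x /= fx gx _; rewrite fx// gx.
Qed.

Lemma ae_nm f g : L2 f -> L2 g -> f = g %[ae mu] -> L2norm f = L2norm g.
Proof. by move=> Lf Lg fg; rewrite /L2norm (ae_ip Lf Lg Lf Lg). Qed.

Lemma le_nm_ae f g : L2 f -> L2 g -> {ae mu, forall x, `|f x| <= `|g x|} ->
  L2norm f <= L2norm g.
Proof.
move=> Lf Lg fg; rewrite ler_sqrt ?ip_ge0// -lee_fin !ip_EFin//.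
have mf2 h : L2 h -> measurable_fun setT (fun x => (h x * h x)%:E).
  by move=> Lh; apply/measurable_EFinP; apply: measurable_funM; exact: L2_measurable.
apply: ae_ge0_le_integral => //; [|exact: mf2| |exact: mf2|].
- by move=> x _; rewrite lee_fin -expr2 sqr_ge0.
- by move=> x _; rewrite lee_fin -expr2 sqr_ge0.
- move: fg; apply: filterS => x fgx _; rewrite lee_fin -!expr2.
  by rewrite -[leLHS]real_normK ?num_real// -[leRHS]real_normK ?num_real// lerXn2r ?nnegrE.
Qed.

Lemma le_nm f g : L2 f -> L2 g -> (forall x, `|f x| <= `|g x|) -> L2norm f <= L2norm g.
Proof. by move=> Lf Lg fg; apply: le_nm_ae => //; exact: aeW. Qed.

Lemma nm0_ae f : L2 f -> L2norm f = 0 -> {ae mu, forall x, f x = 0}.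
Proof.
move=> Lf f0.
have : (\int[mu]_x `|(f x * f x)%:E| = 0)%E.
  have := ip_EFin Lf Lf; rewrite -nm_sqr f0 expr0n /= => E0; rewrite [RHS]E0.
  by apply: eq_integral => x _; rewrite /= ger0_norm// -expr2 sqr_ge0.
have mff : measurable_fun setT (fun x => (f x * f x)%:E).
  by apply/measurable_EFinP; apply: measurable_funM; exact: L2_measurable.
move=> /(ae_eq_integral_abs mu measurableT mff).
by apply: filterS => x /= /(_ Logic.I) [] /eqP; rewrite mulf_eq0 orbb => /eqP.
Qed.

Lemma Lnorm_nm f : L2 f -> 'N[mu]_2%:E [EFin \o f]%E = (L2norm f)%:E.
Proof.
move=> Lf; have E : ('N[mu]_2%:E [EFin \o f] `^ 2 = (L2dot f f)%:E)%E.
  rewrite poweR_Lnorm// ip_EFin//; apply: eq_integral => x _ /=.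
  by rewrite powR_mulrn// real_normK ?num_real// expr2.
have : ('N[mu]_2%:E [EFin \o f] < +oo)%E.
  by move: Lf; rewrite /Defs.L2 inE => /andP[_]; rewrite inE.
have := Lnorm_ge0 mu 2%:E (EFin \o f); move: E.
case: ('N[mu]_2%:E [EFin \o f])%E => [r| |]//=.
rewrite lee_fin => /eqP; rewrite eqe => /eqP E r0 _; congr EFin.
by rewrite /L2norm -E powR_mulrn// sqrtr_sqr ger0_norm.
Qed.

Lemma strong_cvgP (S : Type) (G : set_system S) (f_ : S -> T -> R) f :
  Filter G -> (\forall s \near G, L2 (f_ s)) -> L2 f ->
  strong_cvg mu G f_ f <-> (L2norm (f_ s \- f) @[s --> G] --> 0).
Proof.
move=> FG Lf_ Lf; rewrite /strong_cvg.
have E : \forall s \near G, 'N[mu]_2%:E [EFin \o (f_ s \- f)%R]%E = (L2norm (f_ s \- f))%:E.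
  by apply: filterS Lf_ => s Lfs; rewrite Lnorm_nm//; exact: L2B.
split => [H|H].
- have /fine_cvg : (L2norm (f_ s \- f))%:E @[s --> G] --> 0%:E.
    apply: cvg_trans H; apply: near_eq_cvg.
    by apply: filterS E => s <-.
  by [].
- apply: (@cvg_trans _ ((L2norm (f_ s \- f))%:E @[s --> G])).
    by apply: near_eq_cvg; apply: filterS E => s <-.
  by apply: cvg_EFin => //; exact: nearW.
Qed.
End L2_theory.

(** * Limits superior and completeness of L^2 *)

Section limits.
Context {R : realType}.
Implicit Types (u : (\bar R)^nat).

Lemma limn_esup_near u (l : \bar R) (y : \bar R) : (limn_esup u <= l)%E -> (l < y)%E ->
  \forall n \near \oo, (u n < y)%E.
Proof.
move=> ul ly; have /ereal_inf_lt[_ [V VF <-] Vy] := le_lt_trans ul ly.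
apply: filterS VF => n Vn; apply: le_lt_trans Vy.
by apply: ereal_sup_ubound; exists n.
Qed.

Lemma limn_einf_le_near u (l : \bar R) : (\forall n \near \oo, (u n <= l)%E) ->
  (limn_einf u <= l)%E.
Proof.
move=> ul; rewrite /limn_einf /limf_einf leeNl; apply: le_ereal_inf_tmp.
move=> _ [V VF <-]; have [n [ln Vn]] := filter_ex (filterI ul VF).
by apply: (@le_trans _ _ (- u n)%E); rewrite ?leeN2//; apply: ereal_sup_ubound; exists n.
Qed.

Lemma limn_esup_ge0 u : (forall n, (0 <= u n)%E) -> (0 <= limn_esup u)%E.
Proof.
move=> u0; apply: le_ereal_inf_tmp => _ [V VF <-].
have [n Vn] := filter_ex VF.
by apply: (@le_trans _ _ (u n)) => //; apply: ereal_sup_ubound; exists n.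
Qed.
End limits.

Section L2_complete.
Context d (T : measurableType d) (R : realType).
Variable mu : {measure set T -> \bar R}.
Implicit Types (f g h : T -> R).
Local Notation L2 := (L2 mu).
Local Notation nm := (L2norm mu).

Lemma L2_sum (f_ : nat -> T -> R) n : (forall k, L2 (f_ k)) ->
  L2 (fun x => \sum_(k < n) f_ k x).
Proof.
move=> Lf; elim: n => [|n ih].
  by under eq_fun do rewrite big_ord0; exact: L20.
by under eq_fun do rewrite big_ord_recr/=; exact: (L2D ih).
Qed.

Lemma nm_sum (f_ : nat -> T -> R) n : (forall k, L2 (f_ k)) ->
  nm (fun x => \sum_(k < n) f_ k x) <= \sum_(k < n) nm (f_ k).
Proof.
move=> Lf; elim: n => [|n ih].
  under eq_fun do rewrite big_ord0.
  by rewrite big_ord0 /L2norm /L2dot; under eq_Rintegral do rewrite mul0r; rewrite /Rintegral integral0 sqrtr0.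
under eq_fun do rewrite big_ord_recr/=.
rewrite big_ord_recr/=; apply: (le_trans (nmD (L2_sum n Lf) (Lf n))).
by rewrite lerD2r.
Qed.

Lemma L2_norm f : L2 f -> L2 (fun x => `|f x|).
Proof.
move=> Lf; apply: (L2_le _ Lf) => [|x]; last by rewrite normr_id.
by apply: measurableT_comp => //; exact: L2_measurable Lf.
Qed.

Lemma nm_norm f : nm (fun x => `|f x|) = nm f.
Proof.
by rewrite /L2norm /L2dot; congr Num.sqrt; apply: eq_Rintegral => x _; rewrite -!expr2 real_normK ?num_real.
Qed.

(** A sequence with summable increments in norm converges almost everywhere,
    because the sum of the absolute increments is in L^2, hence finite. *)
Lemma L2_summable_ae_cvg (g : nat -> T -> R) (M : R) : (forall k, L2 (g k)) ->
  (forall n, \sum_(k < n) nm (g k.+1 \- g k) <= M) ->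
  {ae mu, forall x, cvgn (fun k => g k x)}.
Proof.
move=> Lg gM.
pose F n x := \sum_(k < n) `|g k.+1 x - g k x|.
have LFk k : L2 (fun x => `|g k.+1 x - g k x|) by apply: L2_norm; exact: L2B.
have LF n : L2 (F n) by apply: (@L2_sum (fun k x => `|g k.+1 x - g k x|)).
have nmF n : nm (F n) <= \sum_(k < n) nm (fun x => `|g k.+1 x - g k x|).
  exact: (@nm_sum (fun k x => `|g k.+1 x - g k x|)).
have F_pos n x : 0 <= F n x by apply: sumr_ge0.
have Fnd x : nondecreasing_seq (F ^~ x).
  by apply/nondecreasing_seqP => n; rewrite /F big_ord_recr/= lerDl.
have M0 : 0 <= M by apply: le_trans (gM 0%N); rewrite big_ord0.
have FM n : (\int[mu]_x (F n x ^+ 2)%:E <= (M ^+ 2)%:E)%E.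
  rewrite (_ : (\int[mu]_x _)%E = (nm (F n) ^+ 2)%:E).
    rewrite lee_fin lerXn2r ?nnegrE ?nm_ge0//.
    apply: le_trans (nmF n) _; apply: le_trans (gM n).
    by apply: ler_sum => k _; rewrite (nm_norm (g k.+1 \- g k)).
  by rewrite nm_sqr ip_EFin//; apply: eq_integral => x _; rewrite expr2.
have mF2 n : measurable_fun setT (fun x => (F n x ^+ 2)%:E).
  by apply/measurable_EFinP; apply: measurable_funX; exact: L2_measurable (LF n).
have F2nd x : {homo (fun n => (F n x ^+ 2)%:E) : n m / (n <= m)%N >-> (n <= m)%E}.
  by move=> n m nm; rewrite lee_fin lerXn2r ?nnegrE// Fnd.
have Foo : (\int[mu]_x limn (fun n => (F n x ^+ 2)%:E) <= (M ^+ 2)%:E)%E.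
  have cvgF := @cvg_monotone_convergence _ _ _ mu setT measurableT
    (fun n x => (F n x ^+ 2)%:E) mF2 (fun n x _ => ltac:(by rewrite lee_fin sqr_ge0))
    (fun x _ => F2nd x).
  have H := cvg_lim (@ereal_hausdorff R) cvgF; rewrite -H.
  apply: lime_le; first exact: (cvgP _ cvgF).
  exact: nearW.
have lim0 x : (0 <= limn (fun n => (F n x ^+ 2)%:E))%E.
  apply: lime_ge; first exact: ereal_nondecreasing_is_cvgn.
  by apply: nearW => n; rewrite lee_fin sqr_ge0.
have : mu.-integrable setT (fun x => limn (fun n => (F n x ^+ 2)%:E)).
  apply/integrableP; split.
    apply: (@emeasurable_fun_cvg _ _ _ setT (fun n x => (F n x ^+ 2)%:E)) => // x _.
    exact: ereal_nondecreasing_is_cvgn.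
  under eq_integral do rewrite gee0_abs//.
  by apply: le_lt_trans Foo _; rewrite ltry.
move=> /(integrable_ae measurableT); apply: filterS => x /(_ Logic.I) Lfin.
have Fb n : F n x <= fine (limn (fun n => (F n x ^+ 2)%:E)) + 1.
  have : ((F n x ^+ 2)%:E <= limn (fun n => (F n x ^+ 2)%:E))%E.
    have H := ereal_nondecreasing_cvgn (F2nd x).
    by rewrite (cvg_lim (@ereal_hausdorff R) H); apply: ereal_sup_ubound; exists n.
  rewrite -[in leRHS](fineK Lfin) lee_fin => H.
  have := sqr_ge0 (F n x - 1); have := F_pos n x; move: H; lra.
have /normed_cvg : cvgn [normed series (telescope (g ^~ x))].
  have -> : [normed series (telescope (g ^~ x))] = F ^~ x.
    by apply/funext => n; rewrite [LHS]big_mkord.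
  apply: nondecreasing_is_cvgn => //.
  by exists (fine (limn (fun n => (F n x ^+ 2)%:E)) + 1) => _ [n _ <-].
rewrite telescopeK => /(is_cvgD (is_cvg_cst (g 0%N x))).
by congr (cvgn _); apply/funext => n /=; rewrite addrC subrK.
Qed.

(** A subsequence with geometrically small increments converges almost
    everywhere; Fatou's lemma identifies its limit as the limit in norm of the
    whole sequence. *)
Theorem L2_complete (f_ : nat -> T -> R) : (forall n, L2 (f_ n)) ->
  (forall e, 0 < e -> exists N, forall i j, (N <= i)%N -> (N <= j)%N ->
     nm (f_ i \- f_ j) <= e) ->
  exists2 f, L2 f & nm (f_ n \- f) @[n --> \oo] --> 0.
Proof.
move=> Lf_ cauchy.
have e2 k : 0 < (2^-1 : R) ^+ k by rewrite exprn_gt0// invr_gt0.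
pose N k := sval (cid (cauchy _ (e2 k))).
have NP k i j : (N k <= i)%N -> (N k <= j)%N -> nm (f_ i \- f_ j) <= 2^-1 ^+ k.
  by rewrite /N; case: cid => /= n; apply.
(* Adding up the [N i] makes the indices increasing, as well as large. *)
pose phi k := (\sum_(i < k.+1) N i + k)%N.
have phiN k : (N k <= phi k)%N by rewrite /phi big_ord_recr/= addnAC leq_addl.
have phiS k : (N k <= phi k.+1)%N.
  by rewrite (leq_trans (phiN k))// /phi [in leqRHS]big_ord_recr/= addnS -addSn leq_add// leqW// leq_addr.
have phik k : (k <= phi k)%N by rewrite /phi leq_addl.
pose g k := f_ (phi k).
have Lg k : L2 (g k) by exact: Lf_.
have gM n : \sum_(k < n) nm (g k.+1 \- g k) <= 2.
  apply: (@le_trans _ _ (\sum_(k < n) 2^-1 ^+ k)).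
    by apply: ler_sum => k _; apply: NP.
  have : \sum_(k < n) (2^-1 : R) ^+ k = 2 - 2 * 2^-1 ^+ n.
    elim: n => [|n ih]; first by rewrite big_ord0 expr0 mulr1 subrr.
    by rewrite big_ord_recr/= ih exprS; field.
  by move=> ->; have := e2 n; lra.
have gcvg := L2_summable_ae_cvg Lg gM.
have mgE k : measurable_fun setT (fun x => (g k x)%:E).
  by apply/measurable_EFinP; exact: L2_measurable.
pose f x := fine (limn_esup (fun k => (g k x)%:E)).
have mf : measurable_fun setT f.
  apply: measurableT_comp; first exact: fine_measurable.
  exact: measurable_fun_limn_esup.
have gf : {ae mu, forall x, g k x @[k --> \oo] --> f x}.
  move: gcvg; apply: filterS => x gx.
  have gxE : (g k x)%:E @[k --> \oo] --> (limn (g ^~ x))%:E.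
    by apply: cvg_EFin => //; exact: nearW.
  by rewrite /f (cvg_limn_einf_sup gxE).
have key e n : 0 < e -> (\forall k \near \oo, nm (g k \- f_ n) <= e) ->
    (\int[mu]_x ((f x - f_ n x) ^+ 2)%:E <= (e ^+ 2)%:E)%E.
  move=> e0 ge.
  have mh k : measurable_fun setT (fun x => ((g k x - f_ n x) ^+ 2)%:E).
    by apply/measurable_EFinP; apply: measurable_funX; apply: measurable_funB; exact: L2_measurable.
  have F := fatou mu measurableT mh (fun k x _ => ltac:(by rewrite lee_fin sqr_ge0)).
  apply: (@le_trans _ _ (limn_einf (fun k => \int[mu]_x ((g k x - f_ n x) ^+ 2)%:E)%E)).
    apply: le_trans F; rewrite le_eqVlt; apply/orP; left; apply/eqP.
    apply: ae_eq_integral => //.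
    - by apply/measurable_EFinP; apply: measurable_funX; apply: measurable_funB => //; exact: L2_measurable.
    - rewrite (_ : (fun x => _) = (fun x => - limn_esup (fun k => - ((g k x - f_ n x) ^+ 2)%:E)))%E//.
      apply: measurableT_comp => //; apply: measurable_fun_limn_esup => k.
      by apply: measurableT_comp => //; exact: mh.
    - move: gf; apply: filterS => x gfx _.
      have H : ((g k x - f_ n x) ^+ 2)%:E @[k --> \oo] --> ((f x - f_ n x) ^+ 2)%:E.
        apply: cvg_EFin; first exact: nearW.
        have H : g k x - f_ n x @[k --> \oo] --> f x - f_ n x by apply: cvgB => //; exact: cvg_cst.
        by under eq_fun do rewrite /= expr2; rewrite expr2; exact: cvgM.
      by rewrite (cvg_limn_einf_sup H).
  apply: limn_einf_le_near; move: ge; apply: filterS => k gke.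
  have -> : (\int[mu]_x ((g k x - f_ n x) ^+ 2)%:E = (nm (g k \- f_ n) ^+ 2)%:E)%E.
    by rewrite nm_sqr ip_EFin//; exact: L2B.
  by rewrite lee_fin lerXn2r ?nnegrE ?nm_ge0// ltW.
have gnear e : 0 < e -> exists M, forall n, (M <= n)%N -> \forall k \near \oo, nm (g k \- f_ n) <= e.
  move=> /cauchy[M MP]; exists M => n Mn; exists M => // k /= Mk.
  by apply: MP => //; exact: (leq_trans Mk).
have Lff n e : 0 < e -> (\forall k \near \oo, nm (g k \- f_ n) <= e) ->
    L2 (f \- f_ n) /\ nm (f \- f_ n) <= e.
  move=> e0 /(key _ _ e0) H.
  have L : L2 (f \- f_ n).
    apply/L2P; split; last by apply: le_lt_trans H _; rewrite ltry.
    by apply: measurable_funB => //; exact: L2_measurable.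
  split => //; rewrite -(@ler_pXn2r _ 2)// ?nnegrE ?nm_ge0//; last exact: ltW.
  rewrite nm_sqr -lee_fin ip_EFin//; exact: H.
have Lf : L2 f.
  have [M MP] := gnear _ ltr01; have [L _] := Lff M _ ltr01 (MP M (leqnn M)).
  rewrite (_ : f = (f \- f_ M) \+ f_ M); first exact: L2D.
  by apply/funext => x /=; rewrite subrK.
exists f => //; apply/cvgrPdist_le => e e0.
have [M MP] := gnear _ e0.
exists M => // n /= Mn; rewrite sub0r normrN ger0_norm ?nm_ge0// nmBC.
by have [] := Lff n _ e0 (MP n Mn).
Qed.
End L2_complete.

(** * Semigroups on L^2 and their generators *)

Section semigroup.
Context d (T : measurableType d) (R : realType).
Variable mu : {measure set T -> \bar R}.
Implicit Types (f g h u v : T -> R) (s t e c : R).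
Local Notation L2 := (L2 mu).
Local Notation nm := (L2norm mu).
Local Notation ip := (L2dot mu).
Local Notation "f =ae g" := (f = g %[ae mu]) (at level 70).

Lemma nm_le_ae f g c : L2 f -> L2 g -> f =ae g -> nm g <= c -> nm f <= c.
Proof. by move=> Lf Lg fg; rewrite (ae_nm Lf Lg fg). Qed.

Lemma ae_nmB0 f g : L2 f -> L2 g -> f =ae g -> nm (f \- g) = 0.
Proof.
move=> Lf Lg fg; rewrite (@ae_nm _ _ _ _ _ (cst 0) (L2B Lf Lg) (L20 mu)).
  by rewrite /L2norm /L2dot; under eq_Rintegral do rewrite mul0r; rewrite /Rintegral integral0 sqrtr0.
by move: fg; apply: filterS => x /= fg /fg ->; rewrite subrr.
Qed.

Lemma nm0_aeE f g : L2 f -> L2 g -> nm (f \- g) = 0 -> f =ae g.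
Proof.
by move=> Lf Lg /(nm0_ae (L2B Lf Lg)); apply: filterS => x /= /eqP + _; rewrite subr_eq0 => /eqP.
Qed.

(** [f] is in the domain of the generator [- L] and [L f = g]. *)
Definition gen (P : R -> (T -> R) -> T -> R) f g :=
  strong_cvg mu 0^'+ (fun t x => t^-1 * (f x - P t f x)) g.

Variable P : R -> (T -> R) -> T -> R.
Hypothesis sgP : L2_semigroup mu P.

Lemma nm_contr t f : 0 < t -> L2 f -> nm (P t f) <= nm f.
Proof.
move=> t0 Lf; have := sg_contr sgP t0 Lf.
by rewrite !Lnorm_nm ?lee_fin//; exact: (sg_L2 sgP).
Qed.

Let LP t f : 0 < t -> L2 f -> L2 (P t f).
Proof. exact: (sg_L2 sgP). Qed.

(** The limit defining the generator, multiplied out by [t]: in this form the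
    errors of [n] steps of length [t / n] add up. *)
Lemma gen_eps f g : L2 f -> L2 g -> gen P f g <->
  forall e, 0 < e -> exists2 del, 0 < del &
    forall t, 0 < t -> t < del -> nm (fun x => f x - P t f x - t * g x) <= e * t.
Proof.
move=> Lf Lg.
have Lq : \forall t \near 0^'+, L2 (fun x => t^-1 * (f x - P t f x)).
  near=> t; apply: (@L2Z _ _ _ _ _ (f \- P t f)).
  by apply: L2B => //; exact: LP.
have E t : 0 < t -> nm (fun x => f x - P t f x - t * g x) =
    t * nm ((fun x => t^-1 * (f x - P t f x)) \- g).
  move=> t0; rewrite -[X in _ = X * _](gtr0_norm t0) -nmZ.
    by congr L2norm; apply/funext => x /=; field; rewrite gt_eqF.
  apply: L2B => //; apply: (@L2Z _ _ _ _ _ (f \- P t f)); apply: L2B => //; exact: LP.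
rewrite /gen strong_cvgP//; split.
- move=> /cvgrPdist_le H e e0; have [del /= del0 delP] := H e e0.
  exists del => // t t0 tdel; rewrite E// mulrC ler_pM2r//.
  have : `|0 - nm ((fun x => t^-1 * (f x - P t f x)) \- g)| <= e.
    by apply: delP => //=; rewrite sub0r normrN gtr0_norm.
  by rewrite sub0r normrN ger0_norm ?nm_ge0.
- move=> H; apply/cvgrPdist_le => e e0; have [del del0 delP] := H e e0.
  exists del => //= t /=; rewrite sub0r normrN => tdel t0; rewrite sub0r normrN ger0_norm ?nm_ge0//.
  have := delP t t0; rewrite E// mulrC ler_pM2r//; apply.
  by rewrite (le_lt_trans _ tdel)// ler_norm.
Unshelve. all: by end_near. Qed.

Lemma P_cont f e : L2 f -> 0 < e -> exists2 del, 0 < del &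
  forall t, 0 < t -> t < del -> nm (P t f \- f) <= e.
Proof.
move=> Lf e0; have := sg_cont sgP Lf; rewrite strong_cvgP//; last first.
  by near=> t; exact: LP.
move=> /cvgrPdist_le H; have [del /= del0 delP] := H e e0.
exists del => // t t0 tdel; have : `|0 - nm (P t f \- f)| <= e.
  by apply: delP => //=; rewrite sub0r normrN gtr0_norm.
by rewrite sub0r normrN ger0_norm ?nm_ge0.
Unshelve. all: by end_near. Qed.

(** The axioms constrain [P t] for [0 < t] only; with the identity at the
    other times the semigroup law holds for all nonnegative times and Riemann
    sums may start at time 0. *)
Definition sg0 t f := if 0 < t then P t f else f.

Lemma S_gt0 t f : 0 < t -> sg0 t f = P t f. Proof. by rewrite /sg0 => ->. Qed.
Lemma S0 f : sg0 0 f = f. Proof. by rewrite /sg0 ltxx. Qed.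

Lemma L2_sg0 t f : L2 f -> L2 (sg0 t f).
Proof. by rewrite /sg0; case: ifPn => // t0 Lf; exact: LP. Qed.

Lemma nm_sg0 t f : L2 f -> nm (sg0 t f) <= nm f.
Proof. by rewrite /sg0; case: ifPn => // t0 Lf; exact: nm_contr. Qed.

Lemma S_lin t c f g : L2 f -> L2 g ->
  sg0 t (fun x => c * f x + g x) =ae (fun x => c * sg0 t f x + sg0 t g x).
Proof.
rewrite /sg0; case: ifPn => [t0 Lf Lg|_ _ _]; first exact: (sg_linear sgP).
exact: ae_eq_refl.
Qed.

Lemma S_add s t f : 0 <= s -> 0 <= t -> L2 f -> sg0 (s + t) f =ae sg0 s (sg0 t f).
Proof.
rewrite !le_eqVlt => /predU1P[<-|s0] /predU1P[<-|t0] Lf.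
- by rewrite addr0 !S0; exact: ae_eq_refl.
- by rewrite add0r S0; exact: ae_eq_refl.
- by rewrite addr0 S0; exact: ae_eq_refl.
- by rewrite !S_gt0 ?addr_gt0//; exact: (sg_add sgP).
Qed.

Lemma S_C s t f : 0 <= s -> 0 <= t -> L2 f -> sg0 s (sg0 t f) =ae sg0 t (sg0 s f).
Proof.
move=> s0 t0 Lf; apply: (ae_eq_trans (ae_eq_sym (S_add s0 t0 Lf))).
by rewrite addrC; exact: S_add.
Qed.

Lemma S_cst0 t : sg0 t (cst 0) =ae cst 0.
Proof.
apply: nm0_aeE; [exact/L2_sg0/L20|exact: L20|].
apply/eqP; rewrite eq_le nm_ge0 andbT.
rewrite (_ : sg0 t _ \- _ = sg0 t (cst 0)); last by apply/funext => x /=; rewrite subr0.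
apply: le_trans (nm_sg0 t (L20 mu)) _.
by rewrite /L2norm /L2dot; under eq_Rintegral do rewrite mul0r; rewrite /Rintegral integral0 sqrtr0.
Qed.

Lemma S_D t f g : L2 f -> L2 g -> sg0 t (f \+ g) =ae (sg0 t f \+ sg0 t g).
Proof.
move=> Lf Lg; have -> : f \+ g = (fun x => 1 * f x + g x).
  by apply/funext => x /=; rewrite mul1r.
by move: (S_lin t 1 Lf Lg); apply: filterS => x /= /[apply] ->; rewrite mul1r.
Qed.

Lemma S_B t f g : L2 f -> L2 g -> sg0 t (f \- g) =ae (sg0 t f \- sg0 t g).
Proof.
move=> Lf Lg; have -> : f \- g = (fun x => -1 * g x + f x).
  by apply/funext => x /=; rewrite mulN1r addrC.
by move: (S_lin t (-1) Lg Lf); apply: filterS => x /= /[apply] ->; rewrite mulN1r addrC.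
Qed.

Lemma S_Z t c f : L2 f -> sg0 t (fun x => c * f x) =ae (fun x => c * sg0 t f x).
Proof.
move=> Lf; have -> : (fun x => c * f x) = (fun x => c * f x + cst 0 x).
  by apply/funext => x /=; rewrite addr0.
move: (S_lin t c Lf (L20 mu)) (S_cst0 t); apply: filterS2 => x /= + + Tx.
by move=> /(_ Tx) -> /(_ Tx) ->; rewrite addr0.
Qed.

Lemma S_sum t (f_ : nat -> T -> R) n : (forall k, L2 (f_ k)) ->
  sg0 t (fun x => \sum_(k < n) f_ k x) =ae (fun x => \sum_(k < n) sg0 t (f_ k) x).
Proof.
move=> Lf; elim: n => [|n ih].
  have -> : (fun x => \sum_(k < 0) f_ k x) = cst 0 by apply/funext => x; rewrite big_ord0.
  by move: (S_cst0 t); apply: filterS => x /= /[apply] ->; rewrite big_ord0.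
have -> : (fun x => \sum_(k < n.+1) f_ k x) = (fun x => \sum_(k < n) f_ k x) \+ f_ n.
  by apply/funext => x; rewrite big_ord_recr.
apply: (ae_eq_trans (S_D t (L2_sum n Lf) (Lf n))).
by move: ih; apply: filterS => x /= /[apply] ->; rewrite big_ord_recr.
Qed.

Lemma nm_SB t f g : L2 f -> L2 g -> nm (sg0 t f \- sg0 t g) <= nm (f \- g).
Proof.
move=> Lf Lg; apply: (@nm_le_ae _ (sg0 t (f \- g))).
- by apply: L2B; exact: L2_sg0.
- exact/L2_sg0/L2B.
- exact/ae_eq_sym/S_B.
- by apply: nm_sg0; exact: L2B.
Qed.

Lemma S_cont f e : L2 f -> 0 < e -> exists2 del, 0 < del &
  forall t, t < del -> nm (sg0 t f \- f) <= e.
Proof.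
move=> Lf e0; have [del del0 delP] := P_cont Lf e0; exists del => // t tdel.
have [t0|t0] := ltP 0 t; first by rewrite S_gt0//; exact: delP.
rewrite /sg0 ltNge t0/= ae_nmB0//; [exact: ltW|exact: ae_eq_refl].
Qed.

End semigroup.

(** * Averages of trajectories *)

(** Repeating [J] times each term of a Riemann sum makes it comparable term by
    term with one on a subdivision [J] times finer. *)
Lemma sum_divn (V : zmodType) (F : nat -> V) n J : (0 < J)%N ->
  \sum_(i < n * J) F (i %/ J)%N = (\sum_(k < n) F k) *+ J.
Proof.
move=> J0; elim: n => [|n ih]; first by rewrite !big_ord0 mul0rn.
rewrite big_ord_recr/= mulrnDl -ih -!(big_mkord xpredT (fun i => F (i %/ J)%N)).
rewrite (@big_cat_nat _ _ _ (n * J)%N)//=; last by rewrite leq_mul2r leqnSn orbT.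
congr (_ + _); rewrite mulSnr big_nat_cond (eq_bigr (fun=> F n)).
  by rewrite -big_nat_cond sumr_const_nat addKn.
move=> i; rewrite andbT => /andP[ni in_].
by congr F; apply/eqP; rewrite eqn_leq -ltnS ltn_divLR// mulSnr in_ leq_divRL.
Qed.

Section averages.
Context d (T : measurableType d) (R : realType).
Variable mu : {measure set T -> \bar R}.
Implicit Types (f g h u v : T -> R) (s t e c : R).
Local Notation L2 := (L2 mu).
Local Notation nm := (L2norm mu).

Lemma nm_sum_le (f_ : nat -> T -> R) e c n : 0 <= c -> (forall k, L2 (f_ k)) ->
  (forall k, (k < n)%N -> nm (f_ k) <= e) ->
  nm (fun x => c * \sum_(k < n) f_ k x) <= c * n%:R * e.
Proof.
move=> c0 Lf fe; rewrite nmZ; last exact: L2_sum.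
rewrite ger0_norm// -mulrA ler_wpM2l//; apply: le_trans (nm_sum n Lf) _.
apply: (@le_trans _ _ (\sum_(k < n) e)); first by apply: ler_sum => k _; exact: fe.
by rewrite sumr_const card_ord mulr_natl.
Qed.

Variable P : R -> (T -> R) -> T -> R.
Hypothesis sgP : L2_semigroup mu P.
Local Notation S := (sg0 P).

Let LS' t f : L2 f -> L2 (S t f).
Proof. exact: L2_sg0. Qed.
Hint Resolve LS' : core.

(** By contractivity, continuity at time 0 controls continuity at every time,
    uniformly. *)
Lemma S_shift s t f : 0 <= s -> 0 <= t -> L2 f -> nm (S (s + t) f \- S s f) <= nm (S t f \- f).
Proof.
move=> s0 t0 Lf; apply: (@nm_le_ae _ _ _ _ _ (S s (S t f) \- S s f)).
- by apply: L2B; auto.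
- by apply: L2B; auto.
- by move: (S_add sgP s0 t0 Lf); apply: filterS => x /= /[apply] ->.
- by apply: nm_SB => //; auto.
Qed.

Section average.
Variables (eps : R) (f : T -> R).
Hypotheses (eps0 : 0 < eps) (Lf : L2 f).

(** Riemann sums of the average of [s |-> S s f] over [[0, eps]]; its
    limit, taken along the Riemann sums, is obtained without integrating
    functions with values in L^2. *)
Definition Ravg n x : R := n%:R^-1 * \sum_(k < n) S (k%:R * (eps / n%:R)) f x.

Lemma L2_Ravg n : L2 (Ravg n).
Proof. by apply/L2Z/(@L2_sum _ _ _ _ (fun k x => S (k%:R * (eps / n%:R)) f x)) => k; auto. Qed.
Hint Resolve L2_Ravg : core.

(** A point of the finer subdivision follows one of the coarser by less than a
    step, so [S_shift] compares the two sums term by term. *)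
Lemma Ravg_refine n J e : (0 < n)%N -> (0 < J)%N ->
  (forall s, s <= eps / n%:R -> nm (S s f \- f) <= e) ->
  nm (Ravg (n * J) \- Ravg n) <= e.
Proof.
move=> n0 J0 fe; have n0R : (0 : R) < n%:R by rewrite ltr0n.
have J0R : (0 : R) < J%:R by rewrite ltr0n.
pose D i x := S (i%:R * (eps / (n * J)%:R)) f x - S ((i %/ J)%:R * (eps / n%:R)) f x.
have -> : Ravg (n * J) \- Ravg n = fun x => (n * J)%:R^-1 * \sum_(i < n * J) D i x.
  apply/funext => x /=; rewrite /Ravg /D sumrB mulrBr; congr (_ - _).
  rewrite (sum_divn (fun k => S (k%:R * (eps / n%:R)) f x))// -mulr_natr natrM invfM.
  by field; rewrite !gt_eqF.
have LD i : L2 (D i) by apply: L2B; auto.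
have := @nm_sum_le D e (n * J)%:R^-1 (n * J)%N; rewrite mulVf ?mul1r; last first.
  by rewrite pnatr_eq0 muln_eq0 negb_or -!lt0n n0 J0.
apply => // k kn.
have -> : D k = S ((k %/ J)%:R * (eps / n%:R) + (k %% J)%:R * (eps / (n * J)%:R)) f
                \- S ((k %/ J)%:R * (eps / n%:R)) f.
  apply/funext => x; rewrite /D; congr (S _ f x - _).
  rewrite {1}(divn_eq k J) natrD !natrM; field; rewrite !gt_eqF//.
have dn0 : 0 <= eps / n%:R by rewrite divr_ge0// ltW.
apply: (@le_trans _ _ (nm (S ((k %% J)%:R * (eps / (n * J)%:R)) f \- f))).
  by apply: S_shift => //; rewrite mulr_ge0// divr_ge0// ltW.
apply: fe; have -> : (k %% J)%:R * (eps / (n * J)%:R) = (k %% J)%:R / J%:R * (eps / n%:R).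
  by rewrite natrM; field; rewrite !gt_eqF.
by rewrite ler_piMl// ler_pdivrMr// mul1r ler_nat ltnW// ltn_mod.
Qed.

Lemma Ravg_near e : (0 < e) -> exists2 N, (0 < N)%N &
  forall n, (N <= n)%N -> forall s, s <= eps / n%:R -> nm (S s f \- f) <= e.
Proof.
move=> e0; have [del del0 delP] := S_cont sgP Lf e0.
exists (Num.truncn (eps / del)).+1 => // n Nn s sn; apply: delP.
apply: le_lt_trans sn _.
have n0 : (0 : R) < n%:R by rewrite ltr0n (leq_trans _ Nn).
rewrite ltr_pdivrMr// mulrC -ltr_pdivrMr//.
by apply: (lt_le_trans (truncnS_gt _)); rewrite ler_nat.
Qed.

Lemma Ravg_cvg : exists2 u, L2 u & nm (Ravg n \- u) @[n --> \oo] --> 0.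
Proof.
apply: L2_complete => // e e0.
have [N N0 NP] := Ravg_near (divr_gt0 e0 (ltr0n R 2)).
exists N => i j Ni Nj.
have i0 : (0 < i)%N := leq_trans N0 Ni.
have j0 : (0 < j)%N := leq_trans N0 Nj.
apply: le_trans (nm_dist (L2_Ravg i) (L2_Ravg (i * j)) (L2_Ravg j)) _.
rewrite (splitr e) lerD//; last by rewrite mulnC; apply: Ravg_refine => //; exact: NP.
by rewrite nmBC; apply: Ravg_refine => //; exact: NP.
Qed.

Lemma Ravg_dist n e : (0 < n)%N ->
  (forall s, s <= eps -> nm (S s f \- f) <= e) -> nm (Ravg n \- f) <= e.
Proof.
move=> n0 fe; pose D i x := S (i%:R * (eps / n%:R)) f x - f x.
have n0R : (0 : R) < n%:R by rewrite ltr0n.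
have -> : Ravg n \- f = fun x => n%:R^-1 * \sum_(i < n) D i x.
  apply/funext => x /=; rewrite /Ravg /D sumrB mulrBr; congr (_ - _).
  by rewrite sumr_const card_ord -[f x *+ n]mulr_natl mulrA mulVf ?mul1r// gt_eqF.
have LD i : L2 (D i) by apply: L2B; auto.
have := @nm_sum_le D e n%:R^-1 n; rewrite mulVf ?mul1r ?gt_eqF//.
apply => // k kn; apply: fe.
by rewrite mulrC -mulrA ler_piMr ?(ltW eps0)// mulrC ltW// ltr_pdivrMr// mul1r ltr_nat.
Qed.

(** Telescoping: a shift by a multiple [j] of the step only changes the first
    and last [j] terms of the Riemann sum. *)
Lemma Ravg_shift n j e : (0 < n)%N -> 0 <= e ->
  (forall s, s <= j%:R * (eps / n%:R) ->
    nm (S s (f \- S eps f) \- (f \- S eps f)) <= e) ->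
  nm (fun x => Ravg n x - S (j%:R * (eps / n%:R)) (Ravg n) x
               - j%:R / n%:R * (f x - S eps f x)) <= j%:R / n%:R * e.
Proof.
move=> n0 e0 ge; set g := f \- S eps f in ge *; set del := eps / n%:R in ge *.
have n0R : (0 : R) < n%:R by rewrite ltr0n.
have del0 : 0 <= del by rewrite divr_ge0// ltW.
have Lg : L2 g by apply: L2B; auto.
pose D k x := S (k%:R * del) g x - g x.
have LD k : L2 (D k) by apply: L2B; auto.
apply: (@nm_le_ae _ _ _ _ _ (fun x => n%:R^-1 * \sum_(k < j) D k x)).
- by apply: (@L2B _ _ _ _ (Ravg n \- S (j%:R * del) (Ravg n)) (fun x => j%:R / n%:R * g x));
    [apply: L2B; auto|exact: L2Z].
- by apply/L2Z/L2_sum.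
- have H1 : {ae mu, forall x, forall k, S (j%:R * del) (S (k%:R * del) f) x = S ((j + k)%:R * del) f x}.
    apply/ae_foralln => k; have := S_add sgP (mulr_ge0 (ler0n R j) del0) (mulr_ge0 (ler0n R k) del0) Lf.
    by rewrite -mulrDl -natrD; apply: filterS => x /= /(_ Logic.I) ->.
  have H2 : {ae mu, forall x, forall k, S (k%:R * del) g x = S (k%:R * del) f x - S ((k + n)%:R * del) f x}.
    apply/ae_foralln => k.
    have kd0 : 0 <= k%:R * del by rewrite mulr_ge0.
    have := S_add sgP kd0 (ltW eps0) Lf.
    have -> : k%:R * del + eps = (k + n)%:R * del.
      by rewrite natrD mulrDl; congr (_ + _); rewrite /del mulrC divfK// gt_eqF.
    have := S_B sgP (k%:R * del) Lf (LS' eps Lf).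
    by apply: filterS2 => x /= + + => /(_ Logic.I) -> /(_ Logic.I) ->.
  have H3 : {ae mu, forall x, S (j%:R * del) (Ravg n) x = n%:R^-1 * \sum_(k < n) S (j%:R * del) (S (k%:R * del) f) x}.
    have := S_sum sgP (j%:R * del) n (fun k => LS' (k%:R * del) Lf).
    have := S_Z sgP (j%:R * del) n%:R^-1 (L2_sum n (fun k => LS' (k%:R * del) Lf)).
    by apply: filterS2 => x /= + + => /(_ Logic.I) -> /(_ Logic.I) ->.
  move: H1 H2 H3; apply: filterS3 => x H1 H2 H3 _ /=; rewrite H3 /Ravg /D -/del.
  rewrite -[X in X - _ = _]mulrBr [X in _ - X * _]mulrC -[X in _ - X = _]mulrA -[LHS]mulrBr.
  congr (_ * _).
  under [X in _ - X - _]eq_bigr do rewrite H1.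
  rewrite sumrB sumr_const card_ord -[X in _ = _ - X]mulr_natl -/(g x); congr (_ - _).
  under [RHS]eq_bigr do rewrite H2.
  rewrite sumrB.
  pose G k := S (k%:R * del) f x.
  rewrite -(big_mkord xpredT G) -(big_mkord xpredT (fun k => G (j + k)%N)).
  rewrite -(big_mkord xpredT G) -(big_mkord xpredT (fun k => G (k + n)%N)).
  have E a b : \sum_(0 <= k < b) G (k + a)%N = \sum_(a <= k < a + b) G k.
    by rewrite -{2}[a]add0n big_addn addKn.
  under [X in _ - X = _]eq_bigr do rewrite addnC.
  rewrite !E; apply/eqP; rewrite subr_eq addrAC eq_sym subr_eq; apply/eqP.
  rewrite -!big_cat_nat//; [|exact: leq_addr|exact: leq_addr].
  by rewrite addnC.
- have := @nm_sum_le D e n%:R^-1 j; rewrite (mulrC _ j%:R); apply.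
  + by rewrite invr_ge0 ltW.
  + by [].
  + by move=> k kj; apply: ge; rewrite ler_wpM2r// ler_nat ltnW.
Qed.
End average.
End averages.

(** * The domain of the generator *)

Section generator.
Context d (T : measurableType d) (R : realType).
Variable mu : {measure set T -> \bar R}.
Implicit Types (f g h u v : T -> R) (s t e c : R).
Local Notation L2 := (L2 mu).
Local Notation nm := (L2norm mu).

Variable P : R -> (T -> R) -> T -> R.
Hypothesis sgP : L2_semigroup mu P.
Local Notation S := (sg0 P).

Let LP t f : 0 < t -> L2 f -> L2 (P t f).
Proof. exact: (sg_L2 sgP). Qed.
Let LS' t f : L2 f -> L2 (S t f).
Proof. exact: L2_sg0. Qed.
Hint Resolve LS' : core.

Lemma nm_near0 (f_ : nat -> T -> R) u e : L2 u -> nm (f_ n \- u) @[n --> \oo] --> 0 -> 0 < e ->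
  \forall n \near \oo, nm (f_ n \- u) <= e.
Proof.
move=> Lu /cvgrPdist_le H e0; have := H _ e0; apply: filterS => n.
by rewrite sub0r normrN ger0_norm ?nm_ge0.
Qed.

(** The average [u] over [[0, eps]] of a trajectory is in the domain, since
    [(u - S h u) / h] tends to [(f - S eps f) / eps]; and it is
    close to [f] for small [eps]. *)
Lemma gen_dense f e : L2 f -> 0 < e ->
  exists u g, [/\ L2 u, L2 g, gen mu P u g & nm (u \- f) <= e].
Proof.
move=> Lf e0; have [del del0 delP] := S_cont sgP Lf e0.
pose eps := del / 2; have eps0 : 0 < eps by rewrite divr_gt0.
have [u Lu Au] := Ravg_cvg sgP eps0 Lf.
pose A n := Ravg P eps f n.
have LA n : L2 (A n) by exact: L2_Ravg.
pose g := f \- S eps f.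
have Lg : L2 g by apply: L2B; auto.
have Lg' : L2 (fun x => eps^-1 * g x) by exact: L2Z.
exists u, (fun x => eps^-1 * g x); split => //.
  apply/gen_eps => // e1 e10.
  have [del1 del10 del1P] := S_cont sgP Lg (mulr_gt0 e10 eps0).
  exists del1 => // t t0 tdel1; apply/ler_addgt0Pr => eta eta0.
  have eta6 : 0 < eta / 6 by rewrite divr_gt0.
  have [del2 del20 del2P] := S_cont sgP Lu eta6.
  have Knear : \forall K \near \oo, [/\ (0 < K)%N, nm (A K \- u) <= eta / 6,
      eps / K%:R < del2 & nm g / K%:R <= eta / 6].
    near=> K; split.
    - by near: K; exists 1%N.
    - near: K; exact: nm_near0.
    - near: K; exists (Num.truncn (eps / del2)).+1 => // K /= Kn.
      have K0 : (0 : R) < K%:R by rewrite ltr0n (leq_trans _ Kn).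
      rewrite ltr_pdivrMr// mulrC -ltr_pdivrMr//.
      by apply: (lt_le_trans (truncnS_gt _)); rewrite ler_nat.
    - near: K; exists (Num.truncn (nm g / (eta / 6))).+1 => // K /= Kn.
      have K0 : (0 : R) < K%:R by rewrite ltr0n (leq_trans _ Kn).
      rewrite ler_pdivrMr// mulrC -ler_pdivrMr//; apply/ltW.
      by apply: (lt_le_trans (truncnS_gt _)); rewrite ler_nat.
  have [K [K0 Ku Kdel2 Kg]] := filter_ex Knear.
  have K0R : (0 : R) < K%:R by rewrite ltr0n.
  pose j := Num.truncn (t * K%:R / eps); pose hK := j%:R * (eps / K%:R).
  have tK0 : 0 <= t * K%:R / eps by rewrite divr_ge0 ?mulr_ge0 ?ltW.
  have jle : j%:R <= t * K%:R / eps by rewrite truncn_le.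
  have jgt : t * K%:R / eps < j%:R + 1 by rewrite natr1 truncnS_gt.
  have jK : j%:R / K%:R <= t / eps.
    by rewrite ler_pdivrMr// mulrAC.
  have jK1 : t / eps - j%:R / K%:R <= K%:R^-1.
    rewrite lerBlDr -[X in X + _]mul1r -mulrDl ler_pdivlMr// mulrAC.
    by rewrite addrC ltW.
  have hKE : hK = j%:R / K%:R * eps by rewrite /hK mulrA mulrAC.
  have hKt : hK <= t by rewrite hKE -ler_pdivlMr.
  have hK0 : 0 <= hK by rewrite hKE !mulr_ge0// ?invr_ge0 ltW.
  have r0 : 0 <= t - hK by rewrite subr_ge0.
  have rdel2 : t - hK < del2.
    apply: le_lt_trans Kdel2; rewrite hKE.
    have : (t / eps - j%:R / K%:R) * eps <= K%:R^-1 * eps by rewrite ler_pM2r.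
    by rewrite mulrBl divfK ?gt_eqF// [X in _ <= X]mulrC.
  have H1 : nm (fun x => A K x - S hK (A K) x - j%:R / K%:R * g x) <= e1 * t.
    apply: le_trans (Ravg_shift sgP eps0 Lf K0 (ltW (mulr_gt0 e10 eps0)) _) _.
      by move=> s sh; apply: del1P; apply: le_lt_trans sh _; apply: le_lt_trans tdel1.
    by rewrite mulrCA ler_pM2l// -hKE.
  have H2 : nm (S t (A K) \- S hK (A K)) <= 3 * (eta / 6).
    have -> : t = hK + (t - hK) by rewrite addrC subrK.
    apply: le_trans (S_shift sgP hK0 r0 (LA K)) _; move: (t - hK) rdel2 => r rdel2.
    have D1 := nm_dist (LS' r (LA K)) (LS' r Lu) (LA K).
    have D2 := nm_dist (LS' r Lu) Lu (LA K).
    have D3 := nm_SB sgP r (LA K) Lu.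
    have D4 := del2P r rdel2.
    move: Ku D1 D2 D3 D4; rewrite (nmBC mu u (A K)); lra.
  have H3 : nm (S t u \- S t (A K)) <= eta / 6.
    by rewrite nmBC; apply: le_trans Ku; exact: nm_SB.
  have H4 : nm (fun x => (t / eps - j%:R / K%:R) * g x) <= eta / 6.
    rewrite nmZ// ger0_norm ?subr_ge0//; apply: le_trans Kg; rewrite mulrC.
    by rewrite ler_wpM2l ?nm_ge0.
  have LX : L2 (fun x => (t / eps - j%:R / K%:R) * g x) by exact: L2Z.
  have LY : L2 (fun x => A K x - S hK (A K) x - j%:R / K%:R * g x).
    by apply: (@L2B _ _ _ _ (A K \- S hK (A K))); [apply: L2B; auto|exact: L2Z].
  have LZ : L2 (S t (A K) \- S hK (A K)) by apply: L2B; auto.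
  have LW : L2 (S t u \- S t (A K)) by apply: L2B; auto.
  have LV : L2 (A K \- u) by apply: L2B; auto.
  rewrite -(S_gt0 P u t0).
  rewrite (_ : (fun x => _) = ((fun x => A K x - S hK (A K) x - j%:R / K%:R * g x) \-
    (S t (A K) \- S hK (A K)) \- (S t u \- S t (A K)) \-
    (fun x => (t / eps - j%:R / K%:R) * g x)) \- (A K \- u)); last first.
    by apply/funext => x /=; ring.
  apply: le_trans (nmB (L2B (L2B (L2B LY LZ) LW) LX) LV) _.
  have N1 := nmB (L2B (L2B LY LZ) LW) LX.
  have N2 := nmB (L2B LY LZ) LW.
  have N3 := nmB LY LZ.
  move: N1 N2 N3 H1 H2 H3 H4 Ku; lra.
have fe n : (0 < n)%N -> nm (A n \- f) <= e.
  move=> n0; apply: Ravg_dist => // s seps; apply: delP.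
  by apply: le_lt_trans seps _; rewrite /eps ltr_pdivrMr// ltr_pMr// ltr1n.
apply/ler_addgt0Pr => eta eta0.
have /filter_ex [n [An n0]] : \forall n \near \oo, nm (A n \- u) <= eta /\ (0 < n)%N.
  near=> n; split; last by near: n; exists 1%N.
  by near: n; exact: nm_near0.
apply: le_trans (nm_dist Lu (LA n) Lf) _; rewrite addrC lerD ?fe//.
by rewrite nmBC.
Unshelve. all: by end_near. Qed.

Lemma genD f1 g1 f2 g2 : L2 f1 -> L2 g1 -> L2 f2 -> L2 g2 ->
  gen mu P f1 g1 -> gen mu P f2 g2 -> gen mu P (f1 \+ f2) (g1 \+ g2).
Proof.
move=> Lf1 Lg1 Lf2 Lg2 /(gen_eps sgP Lf1 Lg1) G1 /(gen_eps sgP Lf2 Lg2) G2.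
apply/(gen_eps sgP (L2D Lf1 Lf2) (L2D Lg1 Lg2)) => e e0.
have e20 : 0 < e / 2 by rewrite divr_gt0.
have [d1 d10 d1P] := G1 _ e20; have [d2 d20 d2P] := G2 _ e20.
exists (Num.min d1 d2) => [|t t0]; first by rewrite lt_min d10.
rewrite lt_min => /andP[td1 td2].
have LX f g : L2 f -> L2 g -> L2 (fun x => f x - P t f x - t * g x).
  by move=> Lf Lg; apply: (@L2B _ _ _ _ (f \- P t f)); [apply: L2B; auto|exact: L2Z].
apply: (@nm_le_ae _ _ _ _ _ ((fun x => f1 x - P t f1 x - t * g1 x) \+
                             (fun x => f2 x - P t f2 x - t * g2 x))).
- by apply: (LX (f1 \+ f2) (g1 \+ g2)); exact: L2D.
- by apply: L2D; exact: LX.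
- have := S_D sgP t Lf1 Lf2; rewrite !S_gt0//; apply: filterS => x /= /[apply] ->; ring.
- apply: le_trans (nmD (LX _ _ Lf1 Lg1) (LX _ _ Lf2 Lg2)) _.
  by rewrite [e]splitr mulrDl lerD ?d1P ?d2P.
Qed.

Lemma genZ c f g : L2 f -> L2 g -> gen mu P f g ->
  gen mu P (fun x => c * f x) (fun x => c * g x).
Proof.
move=> Lf Lg /(gen_eps sgP Lf Lg) G; apply/(gen_eps sgP (L2Z c Lf) (L2Z c Lg)) => e e0.
have c0 : 0 < `|c| + 1 by rewrite ltr_wpDl.
have [d1 d10 d1P] := G _ (divr_gt0 e0 c0); exists d1 => // t t0 td.
have LX : L2 (fun x => f x - P t f x - t * g x).
  by apply: (@L2B _ _ _ _ (f \- P t f)); [apply: L2B; auto|exact: L2Z].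
apply: (@nm_le_ae _ _ _ _ _ (fun x => c * (f x - P t f x - t * g x))).
- apply: (@L2B _ _ _ _ ((fun x => c * f x) \- P t (fun x => c * f x)) (fun x => t * (c * g x))).
    by apply: L2B; [exact: L2Z|apply: LP => //; exact: L2Z].
  exact/L2Z/L2Z.
- exact: L2Z.
- have := S_Z sgP t c Lf; rewrite !S_gt0//; apply: filterS => x /= /[apply] ->; ring.
- rewrite nmZ//; apply: le_trans (ler_wpM2l (normr_ge0 c) (d1P t t0 td)) _.
  rewrite mulrA ler_pM2r// mulrCA ler_piMr//; first exact: ltW.
  by rewrite ler_pdivrMr// mul1r lerDl.
Qed.

(** The semigroup commutes with the difference quotients at time 0. *)
Lemma gen_S s f g : 0 <= s -> L2 f -> L2 g -> gen mu P f g -> gen mu P (S s f) (S s g).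
Proof.
move=> s0 Lf Lg /(gen_eps sgP Lf Lg) G; apply/(gen_eps sgP (LS' s Lf) (LS' s Lg)) => e e0.
have [d1 d10 d1P] := G _ e0; exists d1 => // t t0 td.
have LX : L2 (fun x => f x - P t f x - t * g x).
  by apply: (@L2B _ _ _ _ (f \- P t f)); [apply: L2B; auto|exact: L2Z].
apply: (@nm_le_ae _ _ _ _ _ (S s (fun x => f x - P t f x - t * g x))).
- by apply: (@L2B _ _ _ _ (S s f \- P t (S s f))); [apply: L2B; auto|apply: L2Z; auto].
- by auto.
- have A1 := S_B sgP s (L2B Lf (LP t0 Lf)) (L2Z t Lg).
  have A2 := S_B sgP s Lf (LP t0 Lf).
  have A3 := S_Z sgP s t Lg.
  have := S_C sgP s0 (ltW t0) Lf; rewrite !(S_gt0 P _ t0) => A4.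
  apply: (filterS3 _ _ A1 A2 (filterI A3 A4)) => x /= B1 B2 [B3 B4] Tx.
  by rewrite -(B4 Tx) -(B3 Tx) -(B2 Tx) (B1 Tx).
- by apply: le_trans (nm_sg0 sgP _ LX) _; exact: d1P.
Qed.

End generator.

(** * The Markov property *)

Section markov.
Context d (T : measurableType d) (R : realType).
Variable mu : {measure set T -> \bar R}.
Implicit Types (f g h u v : T -> R) (s t e c : R).
Local Notation L2 := (L2 mu).
Local Notation nm := (L2norm mu).
Local Notation ip := (L2dot mu).

Definition excess f x := Num.max (f x - 1) 0.

Lemma L2_excess f : L2 f -> L2 (excess f).
Proof.
move=> Lf; apply: (L2_le _ Lf) => [|x].
  apply: measurable_maxr => //; apply: measurable_funB => //; exact: L2_measurable Lf.
by rewrite /excess; case: (leP (f x - 1) 0) => H; rewrite ?normr0//; rewrite !ger0_norm; lra.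
Qed.

Lemma excess_lip f g x : `|excess f x - excess g x| <= `|f x - g x|.
Proof.
by rewrite /excess !ler_norml; case: (leP (f x - 1) 0) => H1; case: (leP (g x - 1) 0) => H2;
  case: (leP 0 (f x - g x)) => H3; rewrite ?(ger0_norm H3) ?(ltr0_norm H3); lra.
Qed.

(** Convexity of [f |-> nm (excess f) ^+ 2], whose gradient at [b] is [2 (excess b)]. *)
Lemma excess_convex a b : L2 a -> L2 b ->
  nm (excess b) ^+ 2 <= nm (excess a) ^+ 2 + 2 * ip (excess b) (b \- a).
Proof.
move=> La Lb; have Lpa := L2_excess La; have Lpb := L2_excess Lb.
have Lba := L2B Lb La.
rewrite !nm_sqr -ipZr// /L2dot -RintegralD//; last 2 first.
  exact: ip_integrable.
  by apply: ip_integrable => //; exact: L2Z.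
apply: le_Rintegral => //.
- exact: ip_integrable.
- apply: (@integrableD _ _ _ _ _ measurableT (fun x => (excess a x * excess a x)%:E)
    (fun x => (excess b x * (2 * (b \- a) x))%:E)); first exact: ip_integrable.
  by apply: ip_integrable => //; exact: L2Z.
- move=> x _ /=; rewrite /excess.
  case: (leP (b x - 1) 0) => H1; case: (leP (a x - 1) 0) => H2;
    have := sqr_ge0 (b x - a x); nra.
Qed.

(** A decreasing sequence of nonnegative functions converges pointwise, and
    its limit has norm zero. *)
Lemma ae_cvg0_decr (f_ : nat -> T -> R) : (forall n, L2 (f_ n)) ->
  (forall n, {ae mu, forall x, 0 <= f_ n.+1 x <= f_ n x}) ->
  nm (f_ n) @[n --> \oo] --> 0 ->
  {ae mu, forall x, f_ n x @[n --> \oo] --> 0}.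
Proof.
move=> Lf fd f0.
have fd' : {ae mu, forall x, forall n, 0 <= f_ n.+1 x <= f_ n x} by apply/ae_foralln.
pose L x := fine (limn_esup (fun n => (f_ n x)%:E)).
have Lcvg : {ae mu, forall x, f_ n x @[n --> \oo] --> L x /\ (forall n, 0 <= L x <= f_ n x)}.
  move: fd'; apply: filterS => x fx.
  have nd : nonincreasing_seq (f_ ^~ x).
    by apply/nonincreasing_seqP => n; have /andP[] := fx n.
  have lb n : 0 <= f_ n x by have /andP[? ?] := fx n; lra.
  have H : f_ n x @[n --> \oo] --> limn (f_ ^~ x).
    by apply: nonincreasing_is_cvgn => //; exists 0 => _ [n _ <-].
  have HE : (f_ n x)%:E @[n --> \oo] --> (limn (f_ ^~ x))%:E.
    by apply: cvg_EFin => //; exact: nearW.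
  rewrite /L (cvg_limn_einf_sup HE)/=; split => // n; apply/andP; split.
    by apply: limr_ge; [exact: cvgP H|exact: nearW].
  by apply: nonincreasing_cvgn_ge => //; exact: cvgP H.
have mL : measurable_fun setT L.
  apply: measurableT_comp; first exact: fine_measurable.
  by apply: measurable_fun_limn_esup => n; apply/measurable_EFinP; exact: L2_measurable.
have LL' : L2 L.
  apply/L2P; split => //; have /L2P[mf0] := Lf 0%N; apply: le_lt_trans.
  apply: ae_ge0_le_integral => //.
  - by move=> x _; rewrite lee_fin sqr_ge0.
  - by apply/measurable_EFinP; exact: measurable_funX.
  - by move=> x _; rewrite lee_fin sqr_ge0.
  - by apply/measurable_EFinP; exact: measurable_funX.
  - move: Lcvg; apply: filterS => x [_ /(_ 0%N)/andP[L0 Lf0]] _.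
    by rewrite lee_fin lerXn2r ?nnegrE// (le_trans L0).
have L0 : nm L = 0.
  apply/eqP; rewrite eq_le nm_ge0 andbT; apply: (cvgr_to_ge f0).
  apply: nearW => n; apply: le_nm_ae => //.
  by move: Lcvg; apply: filterS => x [_ /(_ n)/andP[Lx Lfx]]; rewrite !ger0_norm// (le_trans Lx).
have := nm0_ae LL' L0; move: Lcvg; apply: filterS2 => x [Lx _] Lx0.
by rewrite -Lx0.
Qed.

Variable P : R -> (T -> R) -> T -> R.
Hypothesis sgP : L2_semigroup mu P.
Local Notation S := (sg0 P).

Let LS' t f : L2 f -> L2 (S t f).
Proof. exact: L2_sg0. Qed.
Hint Resolve LS' : core.

(** A number of steps for which both the generator estimate and the
    oscillation of [g] over one step are small. *)
Lemma gen_step f g e t : L2 f -> L2 g -> gen mu P f g -> 0 < e -> 0 < t ->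
  exists2 n, (0 < n)%N & let h := t / n%:R in
   nm (fun x => f x - S h f x - h * g x) <= e * h /\ nm (S h g \- g) <= e.
Proof.
move=> Lf Lg /(gen_eps sgP Lf Lg) G e0 t0.
have [d1 d10 d1P] := G _ e0; have [d2 d20 d2P] := S_cont sgP Lg e0.
pose d0 := Num.min d1 d2; have d00 : 0 < d0 by rewrite lt_min d10.
exists (Num.truncn (t / d0)).+1 => //=; set n := _.+1.
have n0 : (0 : R) < n%:R by rewrite ltr0n.
have h0 : 0 < t / n%:R by rewrite divr_gt0.
have : t / n%:R < d0 by rewrite ltr_pdivrMr// mulrC -ltr_pdivrMr// truncnS_gt.
by rewrite lt_min => /andP[h1 h2]; split; [rewrite S_gt0//; exact: d1P|exact: d2P].
Qed.

Section contraction.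
(** [E (b, (b - 1)^+) >= 0]: the unit contraction operates on the form [E] of [P]. *)
Hypothesis unit_contr : forall b g, L2 b -> L2 g -> gen mu P b g -> 0 <= ip g (excess b).

(** One implicit Euler step of the semigroup, started at [a] and arriving at
    [b], decreases the excess up to the discretization error
    [a - b - h g]: by convexity the change is at most twice the pairing
    of [excess b] with [b - a], which is [- h g] up to this error, and
    [g] pairs nonnegatively with [excess b]. *)
Lemma excess_decr_step a b g (h : R) : L2 a -> L2 b -> L2 g -> gen mu P b g -> 0 < h ->
  nm (excess b) ^+ 2 <= nm (excess a) ^+ 2 + 2 * (nm (fun x => a x - b x - h * g x) * nm b).
Proof.
move=> La Lb Lg G h0; apply: le_trans (excess_convex La Lb) _.
rewrite lerD2l ler_pM2l//.
have Lpb := L2_excess Lb.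
have LX : L2 (fun x => a x - b x - h * g x).
  by apply: (@L2B _ _ _ _ (a \- b)); [exact: L2B|exact: L2Z].
have -> : ip (excess b) (b \- a) = - h * ip (excess b) g - ip (excess b) (fun x => a x - b x - h * g x).
  rewrite -ipZr// -ipBr//; last exact: L2Z.
  by congr L2dot; apply/funext => x /=; ring.
apply: (@le_trans _ _ (`|ip (excess b) (fun x => a x - b x - h * g x)|)).
  have := unit_contr Lb Lg G; rewrite ipC => H.
  have := ler_norm (- ip (excess b) (fun x => a x - b x - h * g x)); rewrite normrN.
  nra.
apply: le_trans (ip_CS Lpb LX) _; rewrite mulrC ler_wpM2l ?nm_ge0//.
apply: le_nm => // x; have := excess_lip b (cst 0) x.
by rewrite {2}/excess /= subr0 sub0r max_r ?subr0// lerN10.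
Qed.

(** [excess_decr_step] is applied along [n] steps of length [t / n], whose
    errors add up to an arbitrarily small number. *)
Lemma nm_excess_decr f g t : L2 f -> L2 g -> gen mu P f g -> 0 < t ->
  nm (excess (S t f)) <= nm (excess f).
Proof.
move=> Lf Lg G t0; rewrite -(@ler_pXn2r _ 2)// ?nnegrE ?nm_ge0//.
apply/ler_addgt0Pr => eta eta0.
have c0 : 0 < 4 * t * (nm f + 1) by rewrite !mulr_gt0// ltr_wpDl// nm_ge0.
pose e := eta / (4 * t * (nm f + 1)).
have e0 : 0 < e by rewrite divr_gt0.
have [n n0 /= [H1 H2]] := gen_step Lf Lg G e0 t0.
set h := t / n%:R in H1 H2.
have n0R : (0 : R) < n%:R by rewrite ltr0n.
have h0 : 0 < h by rewrite divr_gt0.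
have LX : L2 (fun x => f x - S h f x - h * g x).
  by apply: (@L2B _ _ _ _ (f \- S h f)); [apply: L2B; auto|exact: L2Z].
have LY : L2 (fun x => f x - S h f x - h * S h g x).
  by apply: (@L2B _ _ _ _ (f \- S h f)); [apply: L2B; auto|apply: L2Z; auto].
have rho : nm (fun x => f x - S h f x - h * S h g x) <= 2 * e * h.
  rewrite (_ : (fun x => _) = (fun x => f x - S h f x - h * g x) \-
     (fun x => h * (S h g \- g) x)); last by apply/funext => x /=; ring.
  have Lgg : L2 (S h g \- g) by apply: L2B; auto.
  apply: le_trans (nmB LX (L2Z h Lgg)) _; rewrite nmZ// gtr0_norm//; nra.
have hk k : 0 <= k%:R * h :> R by rewrite mulr_ge0// ltW.
have step k : nm (excess (S (k%:R * h) f)) ^+ 2 <= nm (excess f) ^+ 2 + k%:R * (4 * e * h * nm f).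
  elim: k => [|k ih]; first by rewrite !mul0r S0 addr0.
  have A1 := S_B sgP (k%:R * h) (L2B Lf (LS' h Lf)) (L2Z h (LS' h Lg)).
  have A2 := S_B sgP (k%:R * h) Lf (LS' h Lf).
  have A3 := S_Z sgP (k%:R * h) h (LS' h Lg).
  have A4 := S_add sgP (hk k) (ltW h0) Lf.
  have A5 := S_add sgP (hk k) (ltW h0) Lg.
  have kS : k%:R * h + h = k.+1%:R * h by rewrite -natr1 mulrDl mul1r.
  rewrite kS in A4 A5.
  have := @excess_decr_step (S (k%:R * h) f) (S (k.+1%:R * h) f) (S (k.+1%:R * h) g) h
    (LS' _ Lf) (LS' _ Lf) (LS' _ Lg) (gen_S sgP (hk _) Lf Lg G) h0.
  have N1 : nm (fun x => S (k%:R * h) f x - S (k.+1%:R * h) f x - h * S (k.+1%:R * h) g x)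
      <= 2 * e * h.
    apply: (@nm_le_ae _ _ _ _ _ (S (k%:R * h) (fun x => f x - S h f x - h * S h g x))).
    - by apply: (@L2B _ _ _ _ (S (k%:R * h) f \- S (k.+1%:R * h) f)); [apply: L2B; auto|apply: L2Z; auto].
    - by auto.
    - apply: (filterS3 _ _ A1 (filterI A2 A3) (filterI A4 A5)) => x /= B1 [B2 B3] [B4 B5] Tx.
      by rewrite (B4 Tx) (B5 Tx) -(B3 Tx) -(B2 Tx) (B1 Tx).
    - exact: le_trans (nm_sg0 sgP _ LY) rho.
  have N2 := nm_sg0 sgP (k.+1%:R * h) Lf.
  move=> H; apply: le_trans H _.
  have N3 := ler_pM (nm_ge0 _ _) (nm_ge0 _ _) N1 N2.
  rewrite -[in leRHS]natr1 mulrDl mul1r addrA.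
  move: ih N3; lra.
have := step n; rewrite {1}/h mulrCA divff ?mulr1 ?gt_eqF// => H; apply: le_trans H _.
rewrite lerD2l.
have -> : n%:R * (4 * e * h * nm f) = eta * (nm f / (nm f + 1)).
  rewrite /e /h; field; rewrite !gt_eqF//; last by rewrite ltr_wpDl// nm_ge0.
by rewrite ler_piMr ?(ltW eta0)// ler_pdivrMr ?mul1r ?lerDl// ltr_wpDl// nm_ge0.
Qed.

(** The norm of the excess over 1 does not increase: for functions in the
    domain by [nm_excess_decr], and in general by density. *)
Lemma S_le1 f t : L2 f -> {ae mu, forall x, f x <= 1} -> 0 < t ->
  {ae mu, forall x, S t f x <= 1}.
Proof.
move=> Lf f1 t0.
have LSt := LS' t Lf.
suff H : nm (excess (S t f)) = 0.
  have := nm0_ae (L2_excess LSt) H; apply: filterS => x; rewrite /excess.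
  by case: (leP (S t f x - 1) 0) => H1 H2; lra.
apply/eqP; rewrite eq_le nm_ge0 andbT; apply/ler_addgt0Pr => e e0; rewrite add0r.
have [u [g [Lu Lg G uf]]] := gen_dense sgP Lf (divr_gt0 e0 (ltr0n R 2)).
have LSu := LS' t Lu.
have pf0 : nm (excess f) = 0.
  rewrite (ae_nm (L2_excess Lf) (L20 mu)).
    by rewrite /L2norm /L2dot; under eq_Rintegral do rewrite mul0r; rewrite /Rintegral integral0 sqrtr0.
  by move: f1; apply: filterS => x fx _; rewrite /excess max_r// subr_le0.
(* The norm of the excess is 1-Lipschitz. *)
have pd a b : L2 a -> L2 b -> nm (excess a) <= nm (excess b) + nm (a \- b).
  move=> La Lb; have -> : excess a = excess b \+ (excess a \- excess b) by apply/funext => x /=; ring.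
  apply: le_trans (nmD (L2_excess Lb) (L2B (L2_excess La) (L2_excess Lb))) _; rewrite lerD2l.
  by apply: le_nm; [exact/L2B/L2_excess/Lb/L2_excess|exact: L2B|exact: excess_lip].
apply: le_trans (pd _ _ LSt LSu) _.
have H1 := nm_excess_decr Lu Lg G t0.
have H2 := nm_SB sgP t Lf Lu.
have H3 := pd _ _ Lu Lf.
move: H1 H2 H3 uf; rewrite (nmBC mu f u) pf0; lra.
Qed.

Lemma S_le_cst f c t : L2 f -> 0 < c -> {ae mu, forall x, f x <= c} -> 0 < t ->
  {ae mu, forall x, S t f x <= c}.
Proof.
move=> Lf c0 fc t0.
have H1 : {ae mu, forall x, c^-1 * f x <= 1}.
  by move: fc; apply: filterS => x fx; rewrite mulrC ler_pdivrMr// mul1r.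
apply: (filterS2 _ _ (S_le1 (L2Z c^-1 Lf) H1 t0) (S_Z sgP t c^-1 Lf)) => x /= + /(_ Logic.I) E.
by rewrite E mulrC ler_pdivrMr// mul1r.
Qed.

Lemma S_le0 f t : L2 f -> {ae mu, forall x, f x <= 0} -> 0 < t ->
  {ae mu, forall x, S t f x <= 0}.
Proof.
move=> Lf f0 t0.
have : {ae mu, forall x, forall n : nat, S t f x <= n.+1%:R^-1}.
  apply/ae_foralln => n; apply: S_le_cst => //.
  by move: f0; apply: filterS => x fx; apply: (le_trans fx); rewrite invr_ge0.
apply: filterS => x H; rewrite leNgt; apply/negP => Sx0.
have := H (Num.truncn (S t f x)^-1); rewrite leNgt => /negP; apply.
by rewrite invf_plt ?posrE// truncnS_gt.
Qed.

Lemma S_mono f g t : L2 f -> L2 g -> {ae mu, forall x, f x <= g x} -> 0 < t ->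
  {ae mu, forall x, S t f x <= S t g x}.
Proof.
move=> Lf Lg fg t0.
have H : {ae mu, forall x, (f \- g) x <= 0}.
  by move: fg; apply: filterS => x fx /=; rewrite subr_le0.
apply: (filterS2 _ _ (S_le0 (L2B Lf Lg) H t0) (S_B sgP t Lf Lg)) => x /= + /(_ Logic.I) E.
by rewrite E subr_le0.
Qed.

(** If [L chi <= c] then the mass lost by [chi] up to time [t] is at most
    [c t]: over a step of length [h] the loss is close to the image under a
    power of the semigroup of [h L chi], which is at most [c h] by
    [S_le_cst]. *)
Lemma S_supersol chi g c t : L2 chi -> L2 g -> gen mu P chi g -> 0 < c ->
  {ae mu, forall x, g x <= c} -> 0 < t ->
  {ae mu, forall x, chi x - S t chi x <= c * t}.
Proof.
move=> Lf Lg G c0 gc t0; have LSt := LS' t Lf.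
have LD : L2 (chi \- S t chi) by apply: L2B; auto.
have Lp : L2 (fun x => Num.max (chi x - S t chi x - c * t) 0).
  apply: (L2_le _ LD) => [|x /=].
    apply: measurable_maxr => //; apply: measurable_funB => //; exact: L2_measurable LD.
  have ct : 0 < c * t by rewrite mulr_gt0.
  case: (leP (chi x - S t chi x - c * t) 0) => H; first by rewrite normr0.
  by rewrite !ger0_norm//; lra.
suff H : nm (fun x => Num.max (chi x - S t chi x - c * t) 0) = 0.
  have := nm0_ae Lp H; apply: filterS => x.
  by case: (leP (chi x - S t chi x - c * t) 0) => H1 H2; lra.
apply/eqP; rewrite eq_le nm_ge0 andbT; apply/ler_addgt0Pr => eta eta0; rewrite add0r.
have [n n0 /= [H1 _]] := gen_step Lf Lg G (divr_gt0 eta0 t0) t0.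
set h := t / n%:R in H1.
have n0R : (0 : R) < n%:R by rewrite ltr0n.
have h0 : 0 < h by rewrite divr_gt0.
pose r x := chi x - S h chi x - h * g x.
have Lr : L2 r.
  by apply: (@L2B _ _ _ _ (chi \- S h chi)); [apply: L2B; auto|exact: L2Z].
have hk k : 0 <= k%:R * h :> R by rewrite mulr_ge0// ltW.
pose Rn n x := \sum_(k < n) S (k%:R * h) r x.
have LR k : L2 (Rn k) by apply: (@L2_sum _ _ _ _ (fun k => S (k%:R * h) r)); auto.
have step k : {ae mu, forall x, chi x - S (k%:R * h) chi x <= k%:R * (c * h) + Rn k x}.
  elim: k => [|k ih].
    by apply: aeW => x; rewrite !mul0r S0 subrr /Rn big_ord0 addr0.
  have A1 := S_B sgP (k%:R * h) (L2B Lf (LS' h Lf)) (L2Z h Lg).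
  have A2 := S_B sgP (k%:R * h) Lf (LS' h Lf).
  have A3 := S_Z sgP (k%:R * h) h Lg.
  have A4 := S_add sgP (hk k) (ltW h0) Lf.
  have kS : k%:R * h + h = k.+1%:R * h by rewrite -natr1 mulrDl mul1r.
  rewrite kS in A4.
  have A5 : {ae mu, forall x, S (k%:R * h) g x <= c}.
    have [->|k0] := posnP k; first by rewrite mul0r S0.
    by apply: (S_le_cst Lg c0 gc); rewrite mulr_gt0 ?ltr0n.
  apply: (filterS3 _ _ (filterI ih A5) (filterI A1 A2) (filterI A3 A4)) => x /= [Hi B5] [B1 B2] [B3 B4].
  have E : S (k%:R * h) chi x - S (k.+1%:R * h) chi x = h * S (k%:R * h) g x + S (k%:R * h) r x.
    have := B1 Logic.I => /= ->; rewrite (B2 Logic.I) (B3 Logic.I) (B4 Logic.I); ring.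
  rewrite /Rn big_ord_recr/= -/(Rn k x).
  have -> : k.+1%:R * (c * h) = k%:R * (c * h) + c * h by rewrite -natr1; ring.
  have : h * S (k%:R * h) g x <= c * h by rewrite mulrC ler_pM2r.
  move: Hi E; lra.
have Rle : nm (Rn n) <= eta.
  have := @nm_sum_le _ _ _ mu (fun k => S (k%:R * h) r) (eta / t * h) 1 n ler01.
  rewrite (_ : (fun x => 1 * _) = Rn n); last by apply/funext => x; rewrite mul1r.
  move=> H; apply: le_trans (H _ _) _; first by auto.
    by move=> k _; apply: le_trans (nm_sg0 sgP _ Lr) H1.
  by rewrite mul1r /h le_eqVlt; apply/orP; left; apply/eqP; field; rewrite !gt_eqF.
apply: le_trans Rle; apply: le_nm_ae => //.
move: (step n); rewrite {1}/h mulrCA divff ?mulr1 ?gt_eqF//; apply: filterS => x.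
have -> : n%:R * (c * h) = c * t by rewrite /h; field; rewrite gt_eqF.
move=> H; case: (leP (chi x - S t chi x - c * t) 0) => H2; first by rewrite normr0.
by rewrite gtr0_norm//; apply: le_trans (ler_norm _); lra.
Qed.
End contraction.
End markov.

(** * Conservativeness and the generator *)

Section conservative.
Context d (T : measurableType d) (R : realType).
Variable mu : {measure set T -> \bar R}.
Implicit Types (f g h u v : T -> R) (s t e c : R).
Local Notation L2 := (L2 mu).
Local Notation nm := (L2norm mu).
Local Notation ip := (L2dot mu).
Variable P : R -> (T -> R) -> T -> R.
Hypothesis sgP : L2_semigroup mu P.
Local Notation S := (sg0 P).

Let LS' t f : L2 f -> L2 (S t f).
Proof. exact: L2_sg0. Qed.
Hint Resolve LS' : core.

(** On a finite measure space conservativeness puts 1 in the kernel of the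
    generator: if [P t 1 = 1] for one [t], the decreasing function
    [s |-> nm (P s 1)] is constant on [[0, t]], and symmetry gives
    [P s 1 = 1] there. *)
Lemma conservative_gen1 : L2 (cst 1) -> conservative mu P -> gen mu P (cst 1) (cst 0).
Proof.
move=> L1 [t t0 ext].
have Pt1 : S t (cst 1) = cst 1 %[ae mu].
  have := ext (fun=> cst 1) (fun=> L1) _ _.
  have A (n : nat) : {ae mu, forall x, 0 <= (cst 1 : T -> R) x <= (cst 1 : T -> R) x}.
    by apply: aeW => x; rewrite /= ler01 lexx.
  have B : {ae mu, forall x, (cst 1 : T -> R) x @[n --> \oo] --> (cst 1 : T -> R) x}.
    by apply: aeW => x; exact: cvg_cst.
  move=> /(_ A B); apply: filterS => x H _; rewrite S_gt0//.
  by apply/esym; move: H => /(cvg_lim (@Rhausdorff R)) <-; rewrite lim_cst.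
apply/(gen_eps sgP L1 (L20 mu)) => e e0; exists t => // s s0 st.
have nmle r : 0 <= r -> r <= t -> nm (S r (cst 1)) = nm (cst 1).
  move=> r0 rt; apply/eqP; rewrite eq_le nm_sg0//=.
  have tr0 : 0 <= t - r by rewrite subr_ge0.
  rewrite -(@ae_nm _ _ _ _ _ _ (LS' t L1) L1 Pt1).
  rewrite (@ae_nm _ _ _ _ _ (S (t - r) (S r (cst 1)))); [|by auto|by auto|].
    by apply: nm_sg0; auto.
  by have := S_add sgP tr0 r0 L1; rewrite subrK.
have s20 : 0 < s / 2 by rewrite divr_gt0.
have ip1 : ip (S s (cst 1)) (cst 1) = ip (cst 1) (cst 1).
  have -> : ip (S s (cst 1)) (cst 1) = ip (S (s / 2) (cst 1)) (S (s / 2) (cst 1)).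
    transitivity (ip (S (s / 2) (S (s / 2) (cst 1))) (cst 1)).
      apply: ae_ip; [by auto|by auto|by []|by []| |exact: ae_eq_refl].
      by have := S_add sgP (ltW s20) (ltW s20) L1; rewrite -splitr.
    by rewrite /ip !S_gt0//; apply: (sg_sym sgP) => //; rewrite -(S_gt0 P (cst 1) s20); auto.
  rewrite -nm_sqr nmle ?nm_sqr//; first exact: ltW.
  by apply: le_trans (ltW st); rewrite ler_pdivrMr// ler_pMr// ler1n.
rewrite -(S_gt0 P _ s0).
have -> : (fun x => cst 1 x - S s (cst 1) x - s * cst 0 x) = (cst 1 : T -> R) \- S s (cst 1).
  by apply/funext => x /=; rewrite mulr0 subr0.
have : nm (cst 1 \- S s (cst 1)) ^+ 2 = 0.
  have LSs := LS' s L1.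
  rewrite nm_sqr (ipBl L1 LSs (L2B L1 LSs)) (ipBr L1 LSs L1) (ipBr L1 LSs LSs).
  rewrite (ipC _ (cst 1) (S s _)) ip1 -(nm_sqr _ (S s _)) nmle ?(ltW s0) ?(ltW st)//.
  by rewrite nm_sqr; ring.
by move/eqP; rewrite sqrf_eq0 => /eqP ->; rewrite mulr_ge0 ?ltW.
Qed.

Hypothesis unit_contr : forall b g, L2 b -> L2 g -> gen mu P b g -> 0 <= ip g (excess b).

(** Each cutoff is dominated, up to a small error in norm, by the functions
    approximating 1, so the limit of their images is at least
    [S 1 (chi_ m)], and this is at least [chi_ m - C / m.+1]. *)
Theorem conservative_cutoff (chi_ g_ : nat -> T -> R) (C : R) : 0 < C ->
  (forall m, L2 (chi_ m)) -> (forall m, L2 (g_ m)) ->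
  (forall m, gen mu P (chi_ m) (g_ m)) ->
  (forall m x, 0 <= chi_ m x <= 1) ->
  {ae mu, forall x, chi_ m x @[m --> \oo] --> (1 : R)} ->
  (forall m, {ae mu, forall x, g_ m x <= C / m.+1%:R}) ->
  conservative mu P.
Proof.
move=> C0 Lchi Lg G chi01 chi1 gC; exists 1 => // f_ Lf f0 f1.
have f01 : {ae mu, forall x n, 0 <= f_ n x <= f_ n.+1 x /\ f_ n x <= 1}.
  have f0' : {ae mu, forall x n, 0 <= f_ n x <= f_ n.+1 x} by apply/ae_foralln.
  apply: (filterS2 _ _ f0' f1) => x fx fx1 n; split => //.
  apply: (cvgr_to_ge fx1); exists n => // k /= nk.
  have nd : nondecreasing_seq (f_ ^~ x).
    by apply/nondecreasing_seqP => i; have /andP[] := fx i.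
  exact: nd.
have Pnd : {ae mu, forall x n, S 1 (f_ n) x <= S 1 (f_ n.+1) x}.
  apply/ae_foralln => n; apply: S_mono => //.
  by move: f01; apply: filterS => x /(_ n)[/andP[]].
have P1 : {ae mu, forall x n, S 1 (f_ n) x <= 1}.
  apply/ae_foralln => n; apply: S_le1 => //.
  by move: f01; apply: filterS => x /(_ n)[].
have loss : {ae mu, forall x m, chi_ m x - S 1 (chi_ m) x <= C / m.+1%:R}.
  apply/ae_foralln => m.
  have Cm : 0 < C / m.+1%:R by rewrite divr_gt0.
  have := S_supersol sgP unit_contr (Lchi m) (Lg m) (G m) Cm (gC m) ltr01.
  by rewrite mulr1.
pose fc m n x := f_ n x * chi_ m x.
have mfc m n : measurable_fun setT (fc m n).
  by apply: measurable_funM; exact: L2_measurable.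
have Lfc m n : L2 (fc m n).
  apply: (L2_le (mfc m n) (Lf n)) => x; rewrite /fc normrM ler_piMr//.
  by have /andP[c0 c1] := chi01 m x; rewrite ger0_norm.
have fc_cvg m : nm (chi_ m \- fc m n) @[n --> \oo] --> 0.
  have dom := @dominated_convergence _ _ _ mu setT measurableT
    (fun n x => (((chi_ m \- fc m n) x) ^+ 2)%:E) (cst 0) (fun x => ((chi_ m x) ^+ 2)%:E).
  have [|||||_ _ /=] := dom.
  - move=> n; apply/measurable_EFinP; apply: measurable_funX.
    by apply: measurable_funB; exact: L2_measurable.
  - exact: measurable_cst.
  - move: f1; apply: filterS => x fx _ /=; rewrite /fc.
    apply: cvg_EFin; first exact: nearW.
    have -> : (0 : R) = (chi_ m x - 1 * chi_ m x) ^+ 2 by rewrite mul1r subrr expr0n.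
    have H : chi_ m x - f_ n x * chi_ m x @[n --> \oo] --> chi_ m x - 1 * chi_ m x.
      by apply: cvgB; [exact: cvg_cst|apply: cvgM => //; exact: cvg_cst].
    by under eq_fun do rewrite /= expr2; rewrite expr2; exact: cvgM.
  - exact: (Lfun2_integrable_sqr (Lchi m)).
  - move: f01; apply: filterS => x fx n _ /=; rewrite lee_fin ger0_norm ?sqr_ge0//.
    have [/andP[a b] c] := fx n; have /andP[c0 c1] := chi01 m x.
    by rewrite /fc lerXn2r ?nnegrE//; nra.
  rewrite integral0 => H.
  have H2 : nm (chi_ m \- fc m n) ^+ 2 @[n --> \oo] --> 0.
    have /fine_cvg : (nm (chi_ m \- fc m n) ^+ 2)%:E @[n --> \oo] --> 0%:E.
      apply: cvg_trans H; apply: near_eq_cvg; apply: nearW => n.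
      by rewrite nm_sqr ip_EFin//; exact: L2B.
    by [].
  apply/cvgrPdist_le => e e0; move/cvgrPdist_le : H2 => /(_ _ (exprn_gt0 2 e0)).
  apply: filterS => n; rewrite !sub0r !normrN normrX ger0_norm ?nm_ge0//.
  by rewrite ler_pXn2r ?nnegrE ?nm_ge0// ltW.
(* What [S 1 (chi_ m)] exceeds [S 1 (f_ n)] by decreases in [n], and its norm
   tends to 0 as [f_ n * chi_ m] tends to [chi_ m]. *)
pose D m n x := Num.max (S 1 (chi_ m) x - S 1 (f_ n) x) 0.
have LD m n : L2 (D m n).
  have L : L2 (S 1 (chi_ m) \- S 1 (f_ n)) by apply: L2B; auto.
  apply: (L2_le _ L) => [|x].
    by apply: measurable_maxr => //; exact: L2_measurable L.
  by rewrite /D /=; case: (leP (S 1 (chi_ m) x - S 1 (f_ n) x) 0) => H; rewrite ?normr0.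
have Dcvg : {ae mu, forall x m, D m n x @[n --> \oo] --> 0}.
  apply/ae_foralln => m; apply: ae_cvg0_decr => //.
    move=> n; move: Pnd; apply: filterS => x /(_ n) H; rewrite /D.
    by apply/andP; split; [rewrite le_max lexx orbT|rewrite ge_max le_max lerB//= le_max lexx orbT].
  apply: (@squeeze_cvgr _ _ _ _ (fun=> 0) (fun n => nm (chi_ m \- fc m n))) => //; last exact: cvg_cst.
  apply: nearW => n; rewrite nm_ge0/=.
  apply: le_trans (nm_SB sgP 1 (Lchi m) (Lfc m n)).
  apply: le_nm_ae => //; first by apply: L2B; auto.
  have : {ae mu, forall x, S 1 (fc m n) x <= S 1 (f_ n) x}.
    apply: S_mono => //; move: f01; apply: filterS => x /(_ n)[/andP[a b] c].
    by have /andP[c0 c1] := chi01 m x; rewrite /fc; nra.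
  apply: filterS => x H; rewrite /D /=.
  case: (leP (S 1 (chi_ m) x - S 1 (f_ n) x) 0) => H1; first by rewrite normr0.
  by rewrite gtr0_norm//; apply: le_trans (ler_norm _); rewrite lerB.
apply: (filterS3 _ _ (filterI P1 loss) Dcvg chi1) => x [Px lx] Dx cx.
have E n : P 1 (f_ n) x = S 1 (f_ n) x by rewrite S_gt0.
under eq_fun do rewrite E.
apply/cvgrPdist_le => e e0; have e3 : 0 < e / 3 by rewrite divr_gt0.
have Cm0 : C / m.+1%:R @[m --> \oo] --> 0.
  rewrite -[0](mulr0 C); apply: cvgM; first exact: cvg_cst.
  exact: cvg_harmonic.
have /filter_ex [m [m1 m2]] : \forall m \near \oo, chi_ m x >= 1 - e / 3 /\ C / m.+1%:R <= e / 3.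
  near=> m; split.
    near: m; move/cvgrPdist_le : cx => /(_ _ e3); apply: filterS => m.
    by move=> /(le_trans (ler_norm _)); lra.
  near: m; move/cvgrPdist_le : Cm0 => /(_ _ e3); apply: filterS => m.
  by rewrite sub0r normrN => /(le_trans (ler_norm _)).
move/cvgrPdist_le : (Dx m) => /(_ _ e3); apply: filterS => n.
rewrite sub0r normrN => /(le_trans (ler_norm _)); rewrite /D ge_max => /andP[H _].
rewrite ger0_norm ?subr_ge0//.
have sum3 (p q r w y : R) : 1 - y / 3 <= p -> q <= y / 3 -> r - w <= y / 3 ->
  p - r <= q -> 1 - w <= y by lra.
exact: sum3 m1 m2 H (lx m).
Unshelve. all: by end_near. Qed.
End conservative.

(** * Absolutely continuous functions *)

Section abs_cont.
Context {R : realType}.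
Implicit Types (u v : R -> R) (a b c e : R).

(** The same for families indexed by any finite type, which makes it possible
    to merge or to cut the intervals of a family. *)
Lemma AC_fin a b u e : abs_cont_itv a b u -> 0 < e -> exists2 del : R, 0 < del &
  forall (J : finType) (l r : J -> R),
    (forall j, a <= l j /\ l j <= r j /\ r j <= b) ->
    (forall i j, i != j -> r i <= l j \/ r j <= l i) ->
    \sum_j (r j - l j) < del -> \sum_j `|u (r j) - u (l j)| < e.
Proof.
move=> ACu e0; have [del del0 delP] := ACu e e0; exists del => // J l r lr dis.
rewrite !(reindex _ (onW_bij _ (enum_val_bij J)))/=.
apply: (delP _ (l \o enum_val) (r \o enum_val)) => [i|i j ij] /=; first exact: lr.
by apply: dis; apply: contra_neq ij => /enum_val_inj.
Qed.

Lemma AC_sub a b c d u : a <= c -> d <= b -> abs_cont_itv a b u -> abs_cont_itv c d u.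
Proof.
move=> ac db ACu e e0; have [del del0 delP] := ACu e e0; exists del => // n l r lr dis.
apply: delP => // i; have [cl [lri rd]] := lr i.
by split; [exact: le_trans cl|split => //; exact: le_trans db].
Qed.

Lemma AC_eq a b u v : (forall x, a <= x <= b -> u x = v x) ->
  abs_cont_itv a b u -> abs_cont_itv a b v.
Proof.
move=> uv ACu e e0; have [del del0 delP] := ACu e e0; exists del => // n l r lr dis s.
rewrite (eq_bigr (fun i => `|u (r i) - u (l i)|)); first exact: delP.
move=> i _; have [al [lri rb]] := lr i; rewrite !uv ?al ?rb ?andbT//.
  exact: le_trans rb.
exact: (le_trans al).
Qed.

(** The stability properties below are instances of this one: the increments
    of the new function are dominated by those of the given ones. *)
Lemma AC_dom2 a b (k1 k2 : R) u v w : 0 <= k1 -> 0 <= k2 ->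
  (forall x y, a <= x -> x <= y -> y <= b ->
    `|w y - w x| <= k1 * `|u y - u x| + k2 * `|v y - v x|) ->
  abs_cont_itv a b u -> abs_cont_itv a b v -> abs_cont_itv a b w.
Proof.
move=> k10 k20 wuv ACu ACv e e0.
have k1p : 0 < k1 + 1 by rewrite ltr_wpDl.
have k2p : 0 < k2 + 1 by rewrite ltr_wpDl.
have e20 : 0 < e / 2 by rewrite divr_gt0.
have [d1 d10 d1P] := ACu _ (divr_gt0 e20 k1p).
have [d2 d20 d2P] := ACv _ (divr_gt0 e20 k2p).
exists (Num.min d1 d2) => [|n l r lr dis]; first by rewrite lt_min d10.
rewrite lt_min => /andP[s1 s2].
have := d1P n l r lr dis s1; have := d2P n l r lr dis s2.
rewrite !ltr_pdivlMr// => H2 H1.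
apply: (@le_lt_trans _ _ (k1 * (\sum_i `|u (r i) - u (l i)|) + k2 * (\sum_i `|v (r i) - v (l i)|))).
  rewrite !mulr_sumr -big_split/=; apply: ler_sum => i _.
  by have [al [lri rb]] := lr i; exact: wuv.
have S1 : 0 <= \sum_i `|u (r i) - u (l i)| by apply: sumr_ge0.
have S2 : 0 <= \sum_i `|v (r i) - v (l i)| by apply: sumr_ge0.
move: H1 H2 S1 S2; rewrite !mulrDr !mulr1 (mulrC k1) (mulrC k2); lra.
Qed.

Lemma AC_id a b : abs_cont_itv a b (@id R).
Proof.
move=> e e0; exists e => // n l r lr _ H; apply: le_lt_trans H.
by apply: ler_sum => i _ /=; have [_ [? _]] := lr i; rewrite ger0_norm// subr_ge0.
Qed.

Lemma AC_lip a b (k : R) w : 0 <= k ->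
  (forall x y, a <= x -> x <= y -> y <= b -> `|w y - w x| <= k * (y - x)) ->
  abs_cont_itv a b w.
Proof.
move=> k0 wk; apply: (@AC_dom2 a b k 0 id id) => //; try exact: AC_id.
move=> x y ax xy yb; rewrite mul0r addr0 (ger0_norm (x := y - x)) ?subr_ge0//.
exact: wk.
Qed.

Lemma AC_D a b u v : abs_cont_itv a b u -> abs_cont_itv a b v ->
  abs_cont_itv a b (u \+ v).
Proof.
apply: (@AC_dom2 a b 1 1) => // x y _ _ _; rewrite !mul1r/=.
by rewrite opprD addrACA ler_normD.
Qed.

Lemma AC_Z a b c u : abs_cont_itv a b u -> abs_cont_itv a b (fun x => c * u x).
Proof.
move=> ACu; apply: (@AC_dom2 a b `|c| 0 u u) => // x y _ _ _.
by rewrite mul0r addr0 -mulrBr normrM.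
Qed.

Lemma AC_B a b u v : abs_cont_itv a b u -> abs_cont_itv a b v ->
  abs_cont_itv a b (u \- v).
Proof.
apply: (@AC_dom2 a b 1 1) => // x y _ _ _; rewrite !mul1r/=.
have -> : u y - v y - (u x - v x) = (u y - u x) - (v y - v x) by ring.
exact: ler_normB.
Qed.

Lemma AC_comp_lip a b (k : R) (phi : R -> R) u : 0 <= k ->
  (forall x y, `|phi x - phi y| <= k * `|x - y|) ->
  abs_cont_itv a b u -> abs_cont_itv a b (phi \o u).
Proof.
move=> k0 phik ACu; apply: (@AC_dom2 a b k 0 u u) => // x y _ _ _.
by rewrite mul0r addr0; exact: phik.
Qed.

(** An interval of a family is cut at [b] into its intersections with the two
    pieces. *)
Lemma AC_glue a b c u : a <= b -> b <= c -> abs_cont_itv a b u -> abs_cont_itv b c u ->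
  abs_cont_itv a c u.
Proof.
move=> ab bc AC1 AC2 e e0; have e20 : 0 < e / 2 by rewrite divr_gt0.
have [d1 d10 d1P] := AC1 _ e20; have [d2 d20 d2P] := AC2 _ e20.
exists (Num.min d1 d2) => [|n l r lr dis]; first by rewrite lt_min d10.
rewrite lt_min => /andP[s1 s2].
have minle (x y : R) : x <= y -> Num.min x b <= Num.min y b.
  by move=> xy; rewrite le_min !ge_min xy lexx orbT.
have maxle (x y : R) : x <= y -> Num.max x b <= Num.max y b.
  by move=> xy; rewrite ge_max !le_max xy lexx orbT.
have H1 : \sum_(i < n) `|u (Num.min (r i) b) - u (Num.min (l i) b)| < e / 2.
  apply: (d1P n (fun i => Num.min (l i) b) (fun i => Num.min (r i) b)) => [i|i j /dis[]H|].
  - have [al [lri rc]] := lr i; rewrite le_min al ab; split => //.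
    by rewrite minle//; split => //; rewrite ge_min lexx orbT.
  - by left; exact: minle.
  - by right; exact: minle.
  - apply: le_lt_trans s1; apply: ler_sum => i _; have [al [lri rc]] := lr i.
    by case: (leP (r i) b) => rb; case: (leP (l i) b) => lb; lra.
have H2 : \sum_(i < n) `|u (Num.max (r i) b) - u (Num.max (l i) b)| < e / 2.
  apply: (d2P n (fun i => Num.max (l i) b) (fun i => Num.max (r i) b)) => [i|i j /dis[]H|].
  - have [al [lri rc]] := lr i; rewrite le_max lexx orbT; split => //.
    by rewrite maxle//; split => //; rewrite ge_max rc bc.
  - by left; exact: maxle.
  - by right; exact: maxle.
  - apply: le_lt_trans s2; apply: ler_sum => i _; have [al [lri rc]] := lr i.
    by case: (leP (r i) b) => rb; case: (leP (l i) b) => lb; lra.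
rewrite (splitr e); apply: le_lt_trans (ltrD H1 H2).
rewrite -big_split/=; apply: ler_sum => i _; have [al [lri rc]] := lr i.
case: (leP (r i) b) => rb; case: (leP (l i) b) => lb.
- by rewrite lerDl.
- by move: lb; rewrite ltNge (le_trans lri rb).
- by rewrite addrC; apply: le_trans (ler_normD _ _); rewrite addrA subrK.
- by rewrite lerDr.
Qed.

Lemma AC_unif a b u e : abs_cont_itv a b u -> 0 < e -> exists2 del, 0 < del &
  forall x y, a <= x -> x <= y -> y <= b -> y - x < del -> `|u y - u x| < e.
Proof.
move=> ACu e0; have [del del0 delP] := ACu e e0; exists del => // x y ax xy yb yx.
have := delP 1%N (fun=> x) (fun=> y); rewrite !big_ord1; apply => //.
by move=> i j; rewrite !ord1.
Qed.

Lemma AC_continuous_at a b u x : abs_cont_itv a b u -> a < x < b -> {for x, continuous u}.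
Proof.
move=> ACu /andP[ax xb]; apply/cvgrPdist_lt => e e0.
have [del del0 delP] := AC_unif ACu e0.
pose d := Num.min del (Num.min (x - a) (b - x)).
have d0 : 0 < d by rewrite !lt_min del0 !subr_gt0 ax xb.
near=> y; have : `|x - y| < d.
  by near: y; apply: (@cvgr_dist_lt _ _ _ _ _ id x) => //; exact: cvg_id.
rewrite !lt_min => /and3P[xy]; rewrite !ltr_norml => /andP[ya1 ya2] /andP[yb1 yb2].
have ay : a <= y by lra.
have yb : y <= b by lra.
rewrite -ltr_norml.
have [xley|/ltW ylex] := leP x y.
  rewrite distrC; apply: delP => //; first exact: ltW.
  by apply: le_lt_trans xy; rewrite distrC ler_norm.
apply: delP => //; first exact: ltW.
by apply: le_lt_trans xy; rewrite ler_norm.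
Unshelve. all: by end_near. Qed.

Lemma AC_bounded a b u : abs_cont_itv a b u -> exists2 M, 0 <= M &
  forall x, a <= x <= b -> `|u x| <= M.
Proof.
move=> ACu; have [del del0 delP] := AC_unif ACu ltr01.
pose del' := del / 2; have del'0 : 0 < del' by rewrite divr_gt0.
have del'1 : del' < del by rewrite ltr_pdivrMr// ltr_pMr// ltr1n.
have step (n : nat) : forall x, a <= x <= b -> x <= a + n%:R * del' -> `|u x| <= `|u a| + n%:R.
  elim: n => [|n ih] x /andP[ax xb] xn.
    have -> : x = a by apply/eqP; rewrite eq_le ax andbT; move: xn; rewrite mul0r addr0.
    by rewrite addr0.
  have [xn'|nx] := leP x (a + n%:R * del').
    by apply: le_trans (ih x _ xn') _; rewrite ?ax// lerD2l ler_nat.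
  set y := a + n%:R * del' in nx ih.
  have ay : a <= y by rewrite lerDl mulr_ge0// ltW.
  have yb : y <= b by rewrite (le_trans (ltW nx)).
  have := ih y; rewrite ay yb => /(_ isT (lexx _)) uy.
  have := delP y x ay (ltW nx) xb.
  have : x - y < del.
    by apply: le_lt_trans del'1; move: xn; rewrite -natr1 mulrDl mul1r addrA lerBlDl.
  move=> /[swap] /[apply] uxy.
  rewrite -natr1 addrA; have := ler_normD (u x - u y) (u y); rewrite subrK.
  by move: uy uxy; lra.
exists (`|u a| + (Num.truncn ((b - a) / del')).+1%:R); first by rewrite addr_ge0.
move=> x /[dup] axb /andP[ax xb]; apply: step => //.
rewrite -lerBlDl -ler_pdivrMr//; apply/ltW; apply: le_lt_trans (truncnS_gt _).
by rewrite ler_pM2r ?invr_gt0// lerD2r.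
Qed.

(** On a bounded interval the factors are bounded, so the increments of the
    product are dominated by those of the factors. *)
Lemma AC_M a b u v : abs_cont_itv a b u -> abs_cont_itv a b v ->
  abs_cont_itv a b (fun x => u x * v x).
Proof.
move=> ACu ACv; have [M M0 MP] := AC_bounded ACu; have [N N0 NP] := AC_bounded ACv.
apply: (@AC_dom2 a b N M u v) => // x y ax xy yb.
have -> : u y * v y - u x * v x = (u y - u x) * v y + u x * (v y - v x) by ring.
apply: le_trans (ler_normD _ _) _; rewrite !normrM mulrC lerD//.
  by rewrite ler_wpM2r// NP// yb (le_trans ax).
by rewrite ler_wpM2r// MP// ax (le_trans xy).
Qed.
End abs_cont.

(** * Variation of absolutely continuous functions *)

Section total_variation_AC.
Context {R : realType}.
Implicit Types (u v : R -> R) (a b c d e : R).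
Local Notation TV := total_variation.

Lemma itv_partition_nth_homo c d s i j : itv_partition c d s -> (i <= j)%N -> (j <= size s)%N ->
  nth d (c :: s) i <= nth d (c :: s) j.
Proof.
move=> [ps _] ij js; rewrite le_eqVlt; move: ij; rewrite leq_eqVlt => /predU1P[->|ij].
  by rewrite eqxx.
apply/orP; right; apply: (@sorted_ltn_nth _ <%O lt_trans d (c :: s)) => //.
by rewrite inE /= ltnS (leq_trans (ltnW ij)).
Qed.

(** The subintervals of all the partitions [t j] form a single admissible
    family of the same total length. *)
Lemma AC_variation_fin a b u e : abs_cont_itv a b u -> 0 < e -> exists2 del : R, 0 < del &
  forall (J : finType) (l r : J -> R) (t : J -> seq R),
    (forall j, a <= l j /\ l j <= r j /\ r j <= b) ->
    (forall i j, i != j -> r i <= l j \/ r j <= l i) ->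
    (forall j, itv_partition (l j) (r j) (t j)) ->
    \sum_j (r j - l j) < del -> \sum_j variation (l j) (r j) u (t j) < e.
Proof.
move=> ACu e0; have [del del0 delP] := AC_fin ACu e0; exists del => // J l r t lr dis part s.
pose N j i := nth (r j) (l j :: t j) i.
pose K := {j : J & 'I_(size (t j))}.
have N0 j : N j 0%N = l j by [].
have Nr j : N j (size (t j)) = r j by rewrite /N (itv_partition_nth_size _ (part j)).
have NP j i i' : (i <= i')%N -> (i' <= size (t j))%N -> N j i <= N j i'.
  by move=> ii' i's; apply: itv_partition_nth_homo.
have lN j i : (i <= size (t j))%N -> l j <= N j i by move=> H; rewrite -N0; exact: NP.
have Nrj j i : (i <= size (t j))%N -> N j i <= r j by move=> H; rewrite -Nr; exact: NP.
have := delP K (fun p => N (tag p) (tagged p)) (fun p => N (tag p) (tagged p).+1).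
have -> : \sum_(p : K) (N (tag p) (tagged p).+1 - N (tag p) (tagged p)) = \sum_j (r j - l j).
  rewrite -(@sig_big_dep _ _ _ J (fun j => 'I_(size (t j))) predT (fun _ => predT) (fun j (i : 'I_(size (t j))) => N j i.+1 - N j i))/=.
  apply: eq_bigr => j _; rewrite -(big_mkord xpredT (fun i => N j i.+1 - N j i)).
  by rewrite telescope_sumr// Nr N0.
have -> : \sum_(p : K) `|u (N (tag p) (tagged p).+1) - u (N (tag p) (tagged p))| =
          \sum_j variation (l j) (r j) u (t j).
  rewrite -(@sig_big_dep _ _ _ J (fun j => 'I_(size (t j))) predT (fun _ => predT) (fun j (i : 'I_(size (t j))) => `|u (N j i.+1) - u (N j i)|))/=.
  by apply: eq_bigr => j _; rewrite /variation big_mkord.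
apply => //.
- move=> [j i] /=; have [al [lri rb]] := lr j.
  split; first by rewrite (le_trans al)// lN// ltnW.
  by split; [exact: NP|rewrite (le_trans _ rb)// Nrj].
- move=> [j i] [j' i'] /=; have [E|jj'] := eqVneq j j'.
    subst j' => ii'; have [ltii|ltii|eqii] := ltngtP i i'.
    + by left; apply: NP => //; exact: ltnW.
    + by right; apply: NP => //; exact: ltnW.
    + by exfalso; move: ii' => /eqP; apply; congr (existT _ _ _); exact: val_inj.
  move=> _; have [H|H] := dis j j' jj'.
    by left; rewrite (le_trans (Nrj _ _ _))// (le_trans H)// lN// ltnW.
  by right; rewrite (le_trans (Nrj _ _ _))// (le_trans H)// lN// ltnW.
Qed.

(** The variation over an interval shorter than the [del] for [eps = 1] is
    at most 1, and finitely many such intervals cover [[a, b]]. *)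
Lemma AC_BV a b u : a <= b -> abs_cont_itv a b u -> bounded_variation a b u.
Proof.
move=> ab ACu; apply/bounded_variationP => //.
have [del del0 delP] := AC_variation_fin ACu ltr01.
have small c d : a <= c -> c <= d -> d <= b -> d - c < del -> TV c d u \is a fin_num.
  move=> ac cd db dc; apply/bounded_variationP => //; exists 1 => _ [s cds <-].
  have := delP unit (fun=> c) (fun=> d) (fun=> s).
  have sum1 (x : R) : \sum_(j : unit) x = x by rewrite big_const card_unit /= addr0.
  rewrite !sum1 => /(_ _ _ (fun=> cds) dc) H; apply/ltW/H; first by [].
  by move=> [] [].
pose del' := del / 2; have del'0 : 0 < del' by rewrite divr_gt0.
have del'1 : del' < del by rewrite ltr_pdivrMr// ltr_pMr// ltr1n.
have step (n : nat) : forall x, a <= x <= b -> x <= a + n%:R * del' -> TV a x u \is a fin_num.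
  elim: n => [|n ih] x /andP[ax xb] xn.
    have -> : x = a by apply/eqP; rewrite eq_le ax andbT; move: xn; rewrite mul0r addr0.
    by rewrite total_variationxx.
  have [xn'|nx] := leP x (a + n%:R * del'); first by apply: ih => //; rewrite ax.
  set y := a + n%:R * del' in nx ih.
  have ay : a <= y by rewrite lerDl mulr_ge0// ltW.
  have yb : y <= b by rewrite (le_trans (ltW nx)).
  rewrite (total_variationD _ ay (ltW nx)) fin_numD ih ?ay//=.
  apply: small => //; first exact: ltW.
  by apply: le_lt_trans del'1; move: xn; rewrite -natr1 mulrDl mul1r addrA lerBlDl.
apply: (step (Num.truncn ((b - a) / del')).+1); first by rewrite ab lexx.
by rewrite -lerBlDl -ler_pdivrMr//; apply/ltW; exact: truncnS_gt.
Qed.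

Lemma AC_TV_fin_num a b u c d : abs_cont_itv a b u -> a <= c -> c <= d -> d <= b ->
  TV c d u \is a fin_num.
Proof.
move=> ACu ac cd db; apply/bounded_variationP => //.
by apply: AC_BV => //; exact: AC_sub ACu.
Qed.

Lemma AC_TV_fin a b u e : abs_cont_itv a b u -> 0 < e -> exists2 del : R, 0 < del &
  forall (J : finType) (l r : J -> R),
    (forall j, a <= l j /\ l j <= r j /\ r j <= b) ->
    (forall i j, i != j -> r i <= l j \/ r j <= l i) ->
    \sum_j (r j - l j) < del -> \sum_j fine (TV (l j) (r j) u) <= e.
Proof.
move=> ACu e0; have e20 : 0 < e / 2 by rewrite divr_gt0.
have [del del0 delP] := AC_variation_fin ACu e20; exists del => // J l r lr dis s.
pose eta := e / 2 / (#|J|.+1)%:R.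
have eta0 : 0 < eta by rewrite divr_gt0.
have TVfin j : TV (l j) (r j) u \is a fin_num.
  by have [al [lri rb]] := lr j; exact: AC_TV_fin_num ACu _ _ _.
have ext j : exists t, itv_partition (l j) (r j) t /\
    fine (TV (l j) (r j) u) <= variation (l j) (r j) u t + eta.
  have [_ [_ [t part <-] <-]] := ub_ereal_sup_adherent eta0 (TVfin j).
  rewrite -/(TV (l j) (r j) u) => H; exists t; split => //.
  rewrite -lerBlDr -lee_fin EFinB fineK//; exact: ltW.
pose t j := sval (cid (ext j)).
have [tpart tvar] : (forall j, itv_partition (l j) (r j) (t j)) /\
    (forall j, fine (TV (l j) (r j) u) <= variation (l j) (r j) u (t j) + eta).
  by split => j; rewrite /t; case: cid => ? [].
apply: (@le_trans _ _ (\sum_j (variation (l j) (r j) u (t j) + eta))).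
  by apply: ler_sum => j _; exact: tvar.
rewrite big_split/= sumr_const.
have := delP J l r t lr dis tpart s.
have : eta *+ #|J| <= e / 2.
  by rewrite -mulr_natr -mulrA ler_piMr ?(ltW e20)// mulrC ltW// ltr_pdivrMr// mul1r ltr_nat.
by rewrite cardT -cardE; lra.
Qed.
End total_variation_AC.

(** * Densities of monotone functions *)

Section mono_density.
Context {R : realType}.
Local Notation leb := (@lebesgue_measure R).
Implicit Types (A B : set R).

Section bounded_interval.
Variables (a b : R).

(** [lend] and [rend] are the endpoints of a bounded interval; the default [b]
    turns an empty interval into a degenerate one, which a family of disjoint
    intervals tolerates. *)
Definition lend A := if `[< A !=set0 >] then inf A else b.
Definition rend A := if `[< A !=set0 >] then sup A else b.

Let lendE A x : A x -> lend A = inf A.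
Proof. by move=> Ax; rewrite /lend asboolT//; exists x. Qed.
Let rendE A x : A x -> rend A = sup A.
Proof. by move=> Ax; rewrite /rend asboolT//; exists x. Qed.
Let lend0 A : ~ (A !=set0) -> lend A = b.
Proof. by move=> A0; rewrite /lend asboolF. Qed.
Let rend0 A : ~ (A !=set0) -> rend A = b.
Proof. by move=> A0; rewrite /rend asboolF. Qed.

Lemma lend_lb A x : (forall z, A z -> a <= z <= b) -> A x -> a <= lend A <= x.
Proof.
move=> Aab Ax; rewrite (lendE Ax); have A0 : A !=set0 by exists x.
have lbA : lbound A a by move=> z /Aab/andP[].
by rewrite lb_le_inf// ge_inf//; exists a.
Qed.

Lemma rend_ub A x : (forall z, A z -> a <= z <= b) -> A x -> x <= rend A <= b.
Proof.
move=> Aab Ax; rewrite (rendE Ax); have A0 : A !=set0 by exists x.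
have ubA : ubound A b by move=> z /Aab/andP[].
by rewrite ge_sup// ub_le_sup//; exists b.
Qed.

Lemma lend_rend_bnd A : a <= b -> (forall z, A z -> a <= z <= b) ->
  a <= lend A /\ lend A <= rend A /\ rend A <= b.
Proof.
move=> ab Aab; have [[x Ax]|nA] := pselect (A !=set0).
  have /andP[? ?] := lend_lb Aab Ax; have /andP[? ?] := rend_ub Aab Ax.
  by split => //; split => //; lra.
by rewrite lend0// rend0.
Qed.

Lemma lend_rend_disj A B : is_interval A -> is_interval B -> A `&` B = set0 ->
  (forall z, A z -> a <= z <= b) -> (forall z, B z -> a <= z <= b) -> a <= b ->
  rend A <= lend B \/ rend B <= lend A.
Proof.
move=> iA iB AB Aab Bab ab.
have [[x Ax]|nA] := pselect (A !=set0); last first.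
  right; rewrite (lend0 nA).
  by have [_ []] := lend_rend_bnd ab Bab.
have [[y By]|nB] := pselect (B !=set0); last first.
  left; rewrite (lend0 nB).
  by have [_ []] := lend_rend_bnd ab Aab.
have key C D (u v : R) : is_interval C -> is_interval D -> C `&` D = set0 -> C u -> D v -> u < v ->
    (forall z, C z -> a <= z <= b) -> (forall z, D z -> a <= z <= b) -> rend C <= lend D.
  move=> iC iD CD Cu Dv uv Cab Dab.
  have noCD z : C z -> D z -> False by move=> Cz Dz; have CDz : (C `&` D) z by []; rewrite CD in CDz.
  have zw z w : C z -> D w -> z <= w.
    move=> Cz Dw; rewrite leNgt; apply/negP => wz.
    have [zv|vz] := leP z v.
      by apply: (noCD z) => //; apply: (iD w v) => //; rewrite ltW.
    by apply: (noCD v) => //; apply: (iC u z) => //; rewrite !ltW.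
  rewrite (rendE Cu) (lendE Dv); have C0 : C !=set0 by exists u.
  have D0 : D !=set0 by exists v.
  by apply: ge_sup => // z Cz; apply: lb_le_inf => // w Dw; exact: zw.
have [xy|yx|xy] := ltgtP x y.
- by left; apply: (key A B x y).
- by right; apply: (key B A y x) => //; rewrite setIC.
- have ABx : (A `&` B) x by split => //; rewrite xy.
  by rewrite AB in ABx.
Qed.

Lemma lend_rend_leb A : a <= b -> measurable A -> is_interval A -> (forall z, A z -> a <= z <= b) ->
  ((rend A - lend A)%:E <= leb A)%E.
Proof.
move=> ab mA iA Aab; have [[x Ax]|nA] := pselect (A !=set0); last first.
  by rewrite lend0// rend0// subrr.
have [_ [lr _]] := lend_rend_bnd ab Aab.
apply: (@le_trans _ _ (leb `]lend A, rend A[)).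
  rewrite lebesgue_measure_itv/= lte_fin; case: ltP => // rl.
  by rewrite lee_fin subr_le0.
apply: le_measure; rewrite ?inE// => z /=; rewrite in_itv/= => /andP[].
have [A0 lE rE] : [/\ A !=set0, lend A = inf A & rend A = sup A].
  by split; [exists x|exact: lendE Ax|exact: rendE Ax].
rewrite lE rE => lz zr.
have hs : has_sup A by split => //; exists b => w /Aab/andP[].
have hi : has_inf A by split => //; exists a => w /Aab/andP[].
have [w Aw wz] := @inf_lt _ A z A0 lz.
have [w' Aw' zw'] := @sup_gt _ A z A0 zr.
by apply: (iA w w') => //; rewrite !ltW.
Qed.
End bounded_interval.

Variables (a b : R) (ab : a < b) (W : R -> R).
Hypothesis ndW : {homo W : x y / x <= y}.
Hypothesis Wl : forall x, x <= a -> W x = W a.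
Hypothesis Wr : forall x, b <= x -> W x = W b.
Hypothesis modW : forall e : R, 0 < e -> exists2 del : R, 0 < del &
  forall (J : finType) (l r : J -> R),
    (forall j, a <= l j /\ l j <= r j /\ r j <= b) ->
    (forall i j, i != j -> r i <= l j \/ r j <= l i) ->
    \sum_j (r j - l j) < del -> \sum_j (W (r j) - W (l j)) <= e.

Lemma W_right_continuous : right_continuous W.
Proof.
move=> x; apply/cvgrPdist_le => e e0; have [del del0 delP] := modW e0.
have key y : x <= y -> y < x + del -> W y - W x <= e.
  move=> xy yd; pose c z := Num.min (Num.max z a) b.
  have Wc z : W z = W (c z).
    rewrite /c; case: (leP z a) => za; first by rewrite min_l ?(ltW ab)// Wl.
    by case: (leP z b) => zb //; rewrite Wr// ltW.
  have cmono : c x <= c y.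
    by rewrite /c le_min !ge_min ge_max !le_max xy !lexx !orbT/= ?orbT.
  have cab z : a <= c z <= b by rewrite /c le_min le_max lexx orbT (ltW ab) ge_min lexx orbT.
  rewrite Wc (Wc x).
  have := delP unit (fun=> c x) (fun=> c y).
  have sum1 (z : R) : \sum_(j : unit) z = z by rewrite big_const card_unit /= addr0.
  rewrite !sum1; apply.
  - by move=> _; have /andP[? ?] := cab x; have /andP[? ?] := cab y.
  - by move=> [] [].
  - rewrite /c; case: (leP x a) => xa; case: (leP y a) => ya; rewrite ?(min_l (ltW ab));
      try (case: (leP x b) => xb); try (case: (leP y b) => yb); lra.
near=> y.
have xy : x <= y by near: y; exact: nbhs_right_ge.
rewrite distrC ger0_norm ?subr_ge0 ?ndW//; apply: key => //.
by near: y; apply: nbhs_right_lt; rewrite ltrDl.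
Unshelve. all: by end_near. Qed.

HB.instance Definition _ := isCumulative.Build R _ R W ndW W_right_continuous.

Let nu := lebesgue_stieltjes_measure W.

Let nu_oc x y : x <= y -> nu `]x, y] = (W y - W x)%:E.
Proof.
move=> xy; rewrite /nu /lebesgue_stieltjes_measure /measure_extension/=.
by rewrite measurable_mu_extE/= ?wlength_itv_bnd//; exact: is_ocitv.
Qed.

Let mab : measurable (`]a, b]%classic : set (measurableTypeR R)).
Proof. exact: measurable_itv. Qed.

Let nuab : (nu `]a, b] < +oo)%E.
Proof. by rewrite nu_oc ?ltry// ltW. Qed.

Let nur := mfrestr mab nuab.

Let nur_open (e : R) : 0 < e -> exists2 del : R, 0 < del & forall U, open U -> (leb U < del%:E)%E ->
  (nur U <= e%:E)%E.
Proof.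
move=> e0; have [del del0 delP] := modW e0; exists del => // U oU Udel.
pose A q := open_disjoint_itv oU q `&` `]a, b].
have mO q : measurable (open_disjoint_itv oU q) by apply: open_measurable; exact: open_disjoint_itv_open.
have mA q : measurable (A q) by exact: measurableI.
have tA : trivIset setT A.
  apply/trivIsetP => i j _ _ ij; rewrite /A setIACA.
  by have /trivIsetP/(_ i j Logic.I Logic.I ij) -> := @open_disjoint_itv_trivIset _ _ oU; rewrite set0I.
have iA q : is_interval (A q).
  move=> x y [Ox /= xab] [Oy /= yab] z /andP[xz zy]; split.
    by apply: (@open_disjoint_itv_is_interval _ _ oU q x y) => //; rewrite xz.
  move: xab yab; rewrite /= !in_itv/= => /andP[ax xb] /andP[ay yb].
  by rewrite (lt_le_trans ax)//= (le_trans zy).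
have Aab q z : A q z -> a <= z <= b by move=> [_]/=; rewrite in_itv/= => /andP[/ltW -> ->].
have nuA q : (nu (A q) <= (W (rend b (A q)) - W (lend b (A q)))%:E)%E.
  have [al [lr rb]] := lend_rend_bnd (ltW ab) (@Aab q).
  rewrite -nu_oc//; apply: le_measure => [||x Ax]; rewrite ?inE; [exact: mA|exact: measurable_itv|].
  have /andP[_ lx] := lend_lb (@Aab q) Ax.
  have /andP[xr _] := rend_ub (@Aab q) Ax.
  rewrite /= in_itv/= xr andbT lt_neqAle lx andbT; apply/eqP => lxE.
  have [Ox /=] := Ax; rewrite in_itv/= => /andP[ax xb].
  have := @open_disjoint_itv_open _ _ oU q; rewrite openE => /(_ _ Ox) /nbhs_ballP[r /= r0 rO].
  pose y := Num.max (x - r / 2) ((a + x) / 2).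
  have yx : y < x by rewrite /y gt_max; apply/andP; split; lra.
  have ay : a < y by rewrite /y lt_max; apply/orP; right; lra.
  have Ay : A q y.
    split; last by rewrite /= in_itv/= ay (le_trans (ltW yx)).
    apply: rO; rewrite /ball/= ger0_norm ?subr_ge0 ?(ltW yx)//.
    by rewrite ltrBlDl -ltrBlDr lt_max; apply/orP; left; lra.
  by have /andP[_] := lend_lb (@Aab q) Ay; rewrite lxE leNgt yx.
have -> : nur U = (\sum_(0 <= q <oo) nu (A q))%E.
  rewrite /nur /mfrestr /mrestr {1}(open_disjoint_itv_bigcup oU) setI_bigcupl.
  apply: (@measure_semi_bigcup _ _ _ (lebesgue_stieltjes_measure W) A) => //.
  exact: bigcupT_measurable.
have lebA n : (\sum_(q < n) leb (A q) < del%:E)%E.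
  apply: le_lt_trans Udel.
  have -> : (\sum_(q < n) leb (A q) = leb (\big[setU/set0]_(q < n) A q))%E.
    by rewrite measure_bigsetU//; exact: (sub_trivIset _ tA).
  apply: le_measure; rewrite ?inE.
  - by apply: bigsetU_measurable => q _; exact: mA.
  - exact: open_measurable.
  apply: (subset_trans (@bigsetU_bigcup _ A n)).
  rewrite [X in _ `<=` X](open_disjoint_itv_bigcup oU).
  by move=> x [q _ [Ox _]]; exists q.
apply: lime_le; first exact: is_cvg_nneseries.
apply: nearW => n; rewrite big_mkord.
apply: (@le_trans _ _ (\sum_(q < n) (W (rend b (A q)) - W (lend b (A q))))%:E).
  by rewrite -sumEFin; apply: lee_sum => q _.
rewrite lee_fin; apply: delP.
- by move=> q; exact: lend_rend_bnd (ltW ab) (@Aab q).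
- move=> i j ij; apply: (lend_rend_disj (iA i) (iA j) _ (@Aab i) (@Aab j) (ltW ab)).
  by move/trivIsetP : tA; exact.
- rewrite -lte_fin -sumEFin; apply: le_lt_trans (lebA n).
  by apply: lee_sum => q _; exact: lend_rend_leb (ltW ab) (mA q) (iA q) (@Aab q).
Qed.

Let nur_dom : nur `<< leb.
Proof.
apply/null_content_dominatesP => A mA A0.
apply/eqP; rewrite eq_le measure_ge0 andbT; apply/lee_addgt0Pr => e e0; rewrite add0e.
have [del del0 delP] := nur_open e0.
have Aoo : (leb A < +oo)%E by rewrite A0.
have [U [oU AU Udel]] := lebesgue_regularity_outer mA Aoo del0.
apply: (@le_trans _ _ (nur U)).
  by apply: le_measure => //; rewrite ?inE//; exact: open_measurable.
apply: delP => //; rewrite -(setDUK AU).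
apply: le_lt_trans (measureU2 leb mA _) _; first by apply: measurableD => //; exact: open_measurable.
by rewrite A0 add0e.
Qed.

(** For open sets, hence by outer regularity for all sets, the modulus of
    continuity [modW] makes the Stieltjes measure of [W] absolutely continuous
    with respect to the Lebesgue measure; the density is given by the
    Radon-Nikodym theorem. *)
Lemma mono_density : exists g : R -> R, [/\ measurable_fun setT g,
  leb.-integrable setT (EFin \o g) &
  forall x y, a <= x -> x <= y -> y <= b -> W y - W x = \int[leb]_(t in `]x, y]) g t].
Proof.
have [f [f0 ffin intf fE]] := @radon_nikodym_sigma_finite _ _ _ leb (mfrestr mab nuab) nur_dom.
have fgE : EFin \o (fine \o f) = f by apply/funext => x /=; rewrite fineK.
exists (fine \o f); split.
- apply: measurableT_comp; first exact: fine_measurable.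
  by case/integrableP : intf.
- by rewrite fgE.
- move=> x y ax xy yb; have mxy : measurable (`]x, y]%classic : set R) by exact: measurable_itv.
  have : nur `]x, y] = (W y - W x)%:E.
    rewrite /nur /mfrestr /mrestr setIidl ?nu_oc//.
    by move=> z /=; rewrite !in_itv/= => /andP[xz zy]; rewrite (le_lt_trans ax)//= (le_trans zy).
  move=> H; have E := etrans (esym H) (fE _ mxy).
  apply: EFin_inj; rewrite E /Rintegral fineK//.
    by apply: eq_integral => z _ /=; rewrite fineK.
  apply: integrable_fin_num => //; apply: (integrableS measurableT) => //.
  by rewrite -[X in _.-integrable _ X]/(EFin \o (fine \o f)) fgE.
Qed.

End mono_density.

(** * The fundamental theorem of calculus *)

Lemma ae_integrable d (T : measurableType d) (R : realType) (mu : {measure set T -> \bar R})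
    (D : set T) (f g : T -> \bar R) : measurable D -> measurable_fun D f ->
  ae_eq mu D f g -> mu.-integrable D g -> mu.-integrable D f.
Proof.
move=> mD mf fg /integrableP[mg goo]; apply/integrableP; split => //.
rewrite (ae_eq_integral (abse \o g))//; [exact: measurableT_comp|exact: measurableT_comp|].
exact: ae_eq_abse.
Qed.

#[global] Instance lebesgue_ae_filter (R : realType) :
  Filter (nbhs (almost_everywhere (@lebesgue_measure R))).
Proof. exact: (ae_filter_ringOfSetsType (@lebesgue_measure R)). Qed.

Lemma ae_neq {R : realType} (b : R) : {ae @lebesgue_measure R, forall x, x != b}.
Proof.
exists [set b]; split; [exact: measurable_set1|exact: lebesgue_measure_set1|].
by move=> x /=; apply: contra_notP => /eqP.
Qed.

Section FTC_AC.
Context {R : realType}.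
Local Notation leb := (@lebesgue_measure R).
Implicit Types (u v : R -> R) (a b c e x y : R).
Local Notation TV := total_variation.

(** With [W] the variation of [u] on [[a, x]], both [W] and [W - u] are
    nondecreasing and absolutely continuous, and [mono_density] applies to
    them. *)
Lemma AC_density a b u : a < b -> abs_cont_itv a b u -> exists g : R -> R,
  [/\ measurable_fun setT g, leb.-integrable setT (EFin \o g) &
  forall x y, a <= x -> x <= y -> y <= b -> u y - u x = \int[leb]_(t in `]x, y]) g t].
Proof.
move=> ab ACu; pose c z := Num.min (Num.max z a) b.
have cab z : a <= c z <= b by rewrite /c le_min le_max lexx orbT (ltW ab) ge_min lexx orbT.
have cid z : a <= z -> z <= b -> c z = z by move=> az zb; rewrite /c max_l// min_l.
have cmono x y : x <= y -> c x <= c y.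
  by move=> xy; rewrite /c le_min !ge_min ge_max !le_max xy !lexx !orbT/= ?orbT.
have ca x : x <= a -> c x = c a by move=> xa; rewrite /c max_r// max_l.
have cb x : b <= x -> c x = c b.
  by move=> bx; rewrite /c !max_l ?(ltW ab) ?(le_trans (ltW ab))// min_r// min_r.
have TVfin x y : a <= x -> x <= y -> y <= b -> TV x y u \is a fin_num by exact: AC_TV_fin_num.
have TVD x y : a <= x -> x <= y -> y <= b -> fine (TV a y u) - fine (TV a x u) = fine (TV x y u).
  move=> ax xy yb; have xb := le_trans xy yb.
  by rewrite (total_variationD _ ax xy) fineD ?TVfin// addrAC subrr add0r.
have TVge x y : a <= x -> x <= y -> y <= b -> `|u y - u x| <= fine (TV x y u).
  by move=> ax xy yb; rewrite -lee_fin fineK ?TVfin//; exact: total_variation_ge.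
pose W1 x := fine (TV a (c x) u); pose W2 x := W1 x - u (c x).
have W1D x y : x <= y -> W1 y - W1 x = fine (TV (c x) (c y) u).
  move=> xy; have /andP[? ?] := cab x; have /andP[? ?] := cab y.
  by apply: TVD => //; exact: cmono.
have uc x y : x <= y -> `|u (c y) - u (c x)| <= W1 y - W1 x.
  move=> xy; have /andP[? ?] := cab x; have /andP[? ?] := cab y.
  by rewrite W1D//; apply: TVge => //; exact: cmono.
have ndW1 : {homo W1 : x y / x <= y}.
  by move=> x y xy; rewrite -subr_ge0; apply: le_trans (uc _ _ xy).
have ndW2 : {homo W2 : x y / x <= y}.
  move=> x y xy; have := uc _ _ xy; rewrite /W2.
  by move=> /(le_trans (ler_norm _)); lra.
have mod1 (e : R) : 0 < e -> exists2 del : R, 0 < del &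
    forall (J : finType) (l r : J -> R),
    (forall j, a <= l j /\ l j <= r j /\ r j <= b) ->
    (forall i j, i != j -> r i <= l j \/ r j <= l i) ->
    \sum_j (r j - l j) < del -> \sum_j (W1 (r j) - W1 (l j)) <= e.
  move=> e0; have [del del0 delP] := AC_TV_fin ACu e0; exists del => // J l r lr dis s.
  rewrite (eq_bigr (fun j => fine (TV (l j) (r j) u))); first exact: delP.
  move=> j _; have [al [lrj rb]] := lr j.
  by rewrite W1D// !cid// ?(le_trans al)// (le_trans lrj).
have mod2 (e : R) : 0 < e -> exists2 del : R, 0 < del &
    forall (J : finType) (l r : J -> R),
    (forall j, a <= l j /\ l j <= r j /\ r j <= b) ->
    (forall i j, i != j -> r i <= l j \/ r j <= l i) ->
    \sum_j (r j - l j) < del -> \sum_j (W2 (r j) - W2 (l j)) <= e.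
  move=> e0; have [del del0 delP] := mod1 _ (divr_gt0 e0 (ltr0n R 2)).
  exists del => // J l r lr dis s; have := delP J l r lr dis s.
  have : \sum_j (W2 (r j) - W2 (l j)) <= 2 * \sum_j (W1 (r j) - W1 (l j)).
    rewrite mulr_sumr; apply: ler_sum => j _; have [al [lrj rb]] := lr j.
    by have := uc _ _ lrj; rewrite ler_norml /W2 => /andP[]; lra.
  lra.
have [g1 [mg1 ig1 g1P]] := mono_density ab ndW1 (fun x xa => ltac:(by rewrite /W1 ca))
  (fun x bx => ltac:(by rewrite /W1 cb)) mod1.
have [g2 [mg2 ig2 g2P]] := mono_density ab ndW2 (fun x xa => ltac:(by rewrite /W2 /W1 ca))
  (fun x bx => ltac:(by rewrite /W2 /W1 cb)) mod2.
exists (g1 \- g2); split.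
- exact: measurable_funB.
- rewrite (_ : EFin \o _ = (EFin \o g1) \- (EFin \o g2))%E; first exact: integrableB.
  by apply/funext => x.
- move=> x y ax xy yb; rewrite RintegralB//; last 2 first.
    exact: integrableS ig1.
    exact: integrableS ig2.
  have ay := le_trans ax xy; have xb := le_trans xy yb.
  by rewrite -g1P// -g2P// /W2 !cid//; ring.
Qed.

(** The derivative from the right along [x + 1 / n.+1], as an upper limit:
    it is measurable as soon as [u] is, and it agrees with the derivative of
    [u] wherever this exists. *)
Definition dq u x := fine (limn_esup (fun n => (n.+1%:R * (u (x + n.+1%:R^-1) - u x))%:E)).

Lemma measurable_dq u : measurable_fun setT u -> measurable_fun setT (dq u).
Proof.
move=> mu; apply: measurableT_comp; first exact: fine_measurable.
apply: measurable_fun_limn_esup => n; apply/measurable_EFinP.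
apply: measurable_funM => //; apply: measurable_funB => //.
by apply: measurableT_comp => //; apply: measurable_funD.
Qed.

Lemma dq_cvg u x (l : R) : n.+1%:R * (u (x + n.+1%:R^-1) - u x) @[n --> \oo] --> l -> dq u x = l.
Proof.
move=> H; have HE : (n.+1%:R * (u (x + n.+1%:R^-1) - u x))%:E @[n --> \oo] --> l%:E.
  by apply: cvg_EFin => //; exact: nearW.
by rewrite /dq (cvg_limn_einf_sup HE).
Qed.

Lemma derivable_dq_cvg u x : derivable u x 1 ->
  n.+1%:R * (u (x + n.+1%:R^-1) - u x) @[n --> \oo] --> derive1 u x.
Proof.
move=> du; have H : h^-1 *: (u (h + x) - u x) @[h --> 0^'] --> derive1 u x.
  rewrite derive1E; have := du; rewrite /derivable => /cvg_ex[l Hl].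
  rewrite /derive (cvg_lim _ Hl)//; apply: cvg_trans Hl; apply: near_eq_cvg.
  by apply: nearW => h /=; rewrite /shift /= [X in u (X + _)]mulr1.
move/cvgr_dnbhsP : H => /(_ (fun n => n.+1%:R^-1)) H.
have -> : (fun n => n.+1%:R * (u (x + n.+1%:R^-1) - u x)) =
          (fun n => n.+1%:R^-1^-1 *: (u (n.+1%:R^-1 + x) - u x)).
  by apply/funext => n; rewrite invrK [x + _]addrC.
by apply: H; split => //; exact: cvg_harmonic.
Qed.

Lemma derivable_dq u x : derivable u x 1 -> dq u x = derive1 u x.
Proof. by move=> /derivable_dq_cvg/dq_cvg. Qed.

(** By Lebesgue's differentiation theorem [u] is differentiable almost
    everywhere, with derivative the density of [AC_density]. *)
Theorem AC_FTC a b u : measurable_fun setT u -> a < b -> abs_cont_itv a b u ->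
  [/\ {ae leb, forall x, a < x < b -> derivable u x 1},
      leb.-integrable `]a, b] (EFin \o dq u) &
      forall x y, a <= x -> x <= y -> y <= b ->
        u y - u x = \int[leb]_(t in `]x, y]) dq u t].
Proof.
move=> mu ab ACu; have [g [mg ig gP]] := AC_density ab ACu.
have ug : {ae leb, forall x, a < x < b -> derivable u x 1 /\ dq u x = g x}.
  have locg : locally_integrable setT g by apply: open_integrable_locally => //; exact: openT.
  have igS y : leb.-integrable [set` Interval (BRight a) (BRight y)] (EFin \o g).
    by apply: integrableS ig.
  have := FTC1 igS locg.
  apply: filterS => x H /andP[ax xb].
  have ltax : (BRight a < BRight x)%O by [].
  have [dF F'] := H ltax.
  set G := (fun _ => _) in dF F'.
  have uG : {near x, (G \+ cst (u a)) =1 u}.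
    near=> z; rewrite /G /= -gP ?subrK//.
      by apply/ltW; near: z; exact: lt_nbhsr.
    by apply/ltW; near: z; exact: lt_nbhsl.
  have dc : derivable (cst (u a)) x 1 by exact: derivable_cst.
  have dG : derivable (G \+ cst (u a)) x 1 by exact: (derivableD dF dc).
  have du : derivable u x 1 by exact: near_eq_derivable uG dG.
  split; first exact: du.
  rewrite (derivable_dq du) derive1E -(@near_eq_derive _ _ _ _ _ x 1 uG) (deriveD dF dc).
  by rewrite derive_cst addr0 -derive1E.
have mdq := measurable_dq mu.
have dqg : ae_eq leb (`]a, b]%classic : set R) (EFin \o dq u) (EFin \o g).
  move: ug (ae_neq b); apply: filterS2 => x ugx xb /=; rewrite in_itv/= => /andP[ax xleb].
  by have [|_ ->] := ugx => //; rewrite ax lt_neqAle xb.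
have dqint x y : a <= x -> x <= y -> y <= b -> \int[leb]_(t in `]x, y]) dq u t = \int[leb]_(t in `]x, y]) g t.
  move=> ax xy yb; rewrite /Rintegral; congr fine; apply: ae_eq_integral => //.
  - by apply/measurable_EFinP; exact: measurable_funTS.
  - by apply/measurable_EFinP; exact: measurable_funTS.
  - apply: ae_eq_subset dqg => z /=; rewrite !in_itv/= => /andP[xz zy].
    by rewrite (le_lt_trans ax)//= (le_trans zy).
split.
- by move: ug; apply: filterS => x H /H[].
- apply: ae_integrable dqg _ => //; last exact: integrableS ig.
  by apply/measurable_EFinP; exact: measurable_funTS.
- by move=> x y ax xy yb; rewrite dqint// gP.
Unshelve. all: by end_near. Qed.
End FTC_AC.

(** * Integrals against a density *)

Section ae_integral.
Context d (T : measurableType d) (R : realType).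
Variable mu : {measure set T -> \bar R}.
Implicit Types f g : T -> \bar R.
Local Open Scope ereal_scope.
Import HBNNSimple.

Let integral_ae_ge0 f g N : measurable N -> mu N = 0 -> (forall x, 0 <= f x) ->
  (forall x, 0 <= g x) -> measurable_fun setT g -> (forall x, ~ N x -> f x = g x) ->
  \int[mu]_x f x = \int[mu]_x g x.
Proof.
move=> mN N0 f0 g0 mg fg.
have aeN (h k : T -> \bar R) : (forall x, ~ N x -> h x = k x) -> ae_eq mu setT h k.
  move=> hk; exists N; split => // x /= nx; apply: contrapT => Nx; apply: nx => _; exact: hk.
have mNC : measurable_fun setT (fun x => (\1_(~` N) x)%:E : \bar R).
  by apply/measurable_EFinP; apply: measurable_indic; exact: measurableC.
have NCle x : (0 : \bar R) <= (\1_(~` N) x)%:E by rewrite lee_fin.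
have NC1 x : ~ N x -> (\1_(~` N) x)%:E = 1 :> \bar R by move=> Nx; rewrite indicE mem_set.
have NC0 x : N x -> (\1_(~` N) x)%:E = 0 :> \bar R by move=> Nx; rewrite indicE memNset//; apply.
apply/eqP; rewrite eq_le; apply/andP; split.
- rewrite [leLHS]ge0_integralTE//; apply: ge_ereal_sup => _ [h /= hf <-].
  have mh : measurable_fun setT (fun x => (h x)%:E) by exact/measurable_EFinP.
  rewrite -integralT_nnsfun (@ae_eq_integral _ _ _ mu setT (fun x => (h x)%:E * (\1_(~` N) x)%:E))//.
  + apply: ge0_le_integral => //.
    * by move=> x _; rewrite mule_ge0// lee_fin.
    * exact: emeasurable_funM.
    * move=> x _; have [Nx|Nx] := pselect (N x); first by rewrite NC0// mule0.
      by rewrite NC1// mule1 -fg//; exact: hf.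
  + exact: emeasurable_funM.
  + by apply: aeN => x Nx; rewrite NC1// mule1.
- rewrite (@ae_eq_integral _ _ _ mu setT (fun x => g x * (\1_(~` N) x)%:E))//.
  + rewrite !ge0_integralTE//; last by move=> x; rewrite mule_ge0.
    apply: ereal_sup_le => _ [h /= hg <-]; exists h => //= x.
    apply: (le_trans (hg x)); have [Nx|Nx] := pselect (N x); first by rewrite NC0// mule0.
    by rewrite NC1// mule1 fg.
  + exact: emeasurable_funM.
  + by apply: aeN => x Nx; rewrite NC1// mule1.
Qed.

(** Only one of two almost everywhere equal functions has to be measurable:
    the integral is a supremum over simple functions. *)
Lemma ae_eq_integral_l (A : set T) f g : measurable A -> measurable_fun A g ->
  ae_eq mu A f g -> \int[mu]_(x in A) f x = \int[mu]_(x in A) g x.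
Proof.
move=> mA mg [N [mN N0 fgN]].
have H x : ~ N x -> (f \_ A) x = (g \_ A) x.
  move=> Nx; rewrite !patchE; case: ifPn => // /set_mem Ax.
  by apply: contrapT => fg; apply/Nx/fgN => /= /(_ Ax).
have mgA : measurable_fun setT (g \_ A) by apply/(measurable_restrictT g mA).
rewrite [LHS]integral_mkcond [RHS]integral_mkcond [LHS]integralE [RHS]integralE.
congr (_ - _); apply: (integral_ae_ge0 mN N0) => //.
- exact: measurable_funepos.
- by move=> x Nx; rewrite !funeposE H.
- exact: measurable_funeneg.
- by move=> x Nx; rewrite !funenegE H.
Qed.
End ae_integral.

Section density.
Context (R : realType).
Local Notation mu := (@lebesgue_measure R).
Variables (nu : {measure set R -> \bar R}) (rho : R -> R).
Hypotheses (rho0 : forall x, 0 <= rho x) (mrho : measurable_fun setT rho).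
Hypothesis nuE : forall A, measurable A -> (nu A = \int[mu]_(x in A) (rho x)%:E)%E.
Import HBNNSimple.
Local Open Scope ereal_scope.

Let mrhoE : measurable_fun (setT : set (measurableTypeR R)) (EFin \o rho).
Proof. exact/measurable_EFinP. Qed.

Lemma ge0_integral_density (f : R -> \bar R) : (forall x, 0 <= f x) -> measurable_fun setT f ->
  \int[nu]_x f x = \int[mu]_x (f x * (rho x)%:E).
Proof.
move=> f0 mf; pose h := nnsfun_approx measurableT mf.
have mh n : measurable_fun [set: R] (h n : R -> R) by [].
have hnd x (m n : nat) : (m <= n)%N -> (h m x <= h n x)%R.
  by move=> mn; have /lefP := nd_nnsfun_approx measurableT mf mn; exact.
have nuh : \int[nu]_x (h n x)%:E @[n --> \oo] --> \int[nu]_x f x.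
  have -> : \int[nu]_x f x = \int[nu]_x limn (fun n => (h n x)%:E).
    by apply: eq_integral => x _; apply/esym/cvg_lim => //; exact: cvg_nnsfun_approx.
  apply: cvg_monotone_convergence => //.
  - by move=> n; exact/measurable_EFinP.
  - by move=> n x _; rewrite lee_fin.
  - by move=> x _ m n mn; rewrite lee_fin; exact: hnd.
have muh : \int[mu]_x ((h n x)%:E * (rho x)%:E) @[n --> \oo] --> \int[mu]_x (f x * (rho x)%:E).
  have -> : \int[mu]_x (f x * (rho x)%:E) = \int[mu]_x limn (fun n => (h n x)%:E * (rho x)%:E).
    apply: eq_integral => x _; apply/esym/cvg_lim => //; apply: cvgeZr => //.
    exact: cvg_nnsfun_approx.
  apply: cvg_monotone_convergence => //.
  - by move=> n; apply: emeasurable_funM; [apply/measurable_EFinP; exact: mh|exact: mrhoE].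
  - by move=> n x _; rewrite mule_ge0// lee_fin.
  - by move=> x _ m n mn; rewrite lee_wpmul2r ?lee_fin//; exact: hnd.
suff E n : \int[nu]_x (h n x)%:E = \int[mu]_x ((h n x)%:E * (rho x)%:E).
  have nuh' : \int[mu]_x ((h n x)%:E * (rho x)%:E) @[n --> \oo] --> \int[nu]_x f x.
    by apply: cvg_trans nuh; apply: near_eq_cvg; apply: nearW => n; rewrite E.
  exact: cvg_unique nuh' muh.
rewrite integralT_nnsfun sintegralE.
have -> : \int[mu]_x ((h n x)%:E * (rho x)%:E) =
  \int[mu]_x (\sum_(y \in range (h n)) (y * \1_(h n @^-1` [set y]) x)%:E * (rho x)%:E).
  apply: eq_integral => x _; rewrite {1}(fimfunE (h n) x) -fsumEFin//.
  by rewrite ge0_mule_fsuml// => y; exact: nnfun_muleindic_ge0.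
have mi r : measurable_fun setT (fun x => (r * \1_(h n @^-1` [set r]) x)%:E).
  by apply/measurable_EFinP; apply: measurable_funM.
rewrite ge0_integral_fsum//; last 2 first.
- by move=> y; apply: emeasurable_funM; [exact: mi|exact: mrhoE].
- by move=> y x _; rewrite mule_ge0 ?nnfun_muleindic_ge0// lee_fin.
apply: eq_fsbigr => r /[!inE] -[t _ rE].
have r0 : (0 <= r)%R by rewrite -rE.
have mhr : measurable (h n @^-1` [set r] : set R) by [].
rewrite nuE// -ge0_integralZl//; [|exact: measurable_funTS|by move=> x _; rewrite lee_fin].
rewrite integral_mkcond; apply: eq_integral => x _ /=.
rewrite patchE indicE; case: ifPn => _; first by rewrite mulr1.
by rewrite mulr0 mul0e.
Qed.

Lemma integral_density (f : R -> \bar R) : measurable_fun setT f ->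
  \int[nu]_x f x = \int[mu]_x (f x * (rho x)%:E).
Proof.
move=> mf; rewrite [LHS]integralE [RHS]integralE.
rewrite !ge0_integral_density//; [|exact: measurable_funeneg|exact: measurable_funepos].
have key (y : \bar R) x : maxe y 0 * (rho x)%:E = maxe (y * (rho x)%:E) 0.
  have r0 : 0 <= (rho x)%:E by rewrite lee_fin.
  case: (leP y 0) => y0; first by rewrite max_r ?mul0e// mule_le0_ge0.
  by rewrite max_l// mule_ge0// ltW.
by congr (_ - _); apply: eq_integral => x _; rewrite ?funeposE ?funenegE key// -mulNe.
Qed.
End density.

(** * The Bessel space *)

Section bessel_space.
Context {R : realType}.
Local Notation leb := (@lebesgue_measure R).
Implicit Types (u v w : R -> R) (a b c e x y l : R).

(** The positive part: multiplying by it turns integrals over I into integrals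
    over R. *)
Definition wI x : R := Num.max x 0.
Definition wt u x := wI x * u x.
Definition grad u x := wI x * dq u x.

Lemma wI_pos x : 0 < x -> wI x = x. Proof. by move=> x0; rewrite /wI max_l// ltW. Qed.

Lemma wI_neg x : x <= 0 -> wI x = 0. Proof. by move=> x0; rewrite /wI max_r. Qed.

Lemma measurable_wI : measurable_fun setT wI.
Proof. by apply: measurable_maxr. Qed.

Lemma measurable_wt u : measurable_fun setT u -> measurable_fun setT (wt u).
Proof. by move=> mu; apply: measurable_funM => //; exact: measurable_wI. Qed.

Lemma measurable_grad u : measurable_fun setT u -> measurable_fun setT (grad u).
Proof.
by move=> mu; apply: measurable_funM; [exact: measurable_wI|exact: measurable_dq].
Qed.

Let rho x : R := 2 * wI x ^+ 2.

Let rho0 x : 0 <= rho x. Proof. by rewrite /rho mulr_ge0// sqr_ge0. Qed.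

Let mrho : measurable_fun setT rho.
Proof. by apply: measurable_funM => //; apply: measurable_funX; exact: measurable_wI. Qed.

Lemma in_I x : (x \in (I : set R)) = (0 < x).
Proof.
by apply/idP/idP; rewrite /I ?inE/= in_itv/= andbT.
Qed.

Let mE A : measurable A -> ((m : {measure set R -> \bar R}) A = \int[leb]_(x in A) (rho x)%:E)%E.
Proof.
move=> mA; rewrite /m /= /mscale /= /mrestr /sqdx /rho.
under [in RHS]eq_integral do rewrite EFinM.
rewrite ge0_integralZl//; last 2 first.
  apply/measurable_EFinP/measurable_funTS; apply: measurable_funX; exact: measurable_wI.
  by move=> x _; rewrite lee_fin sqr_ge0.
congr (_ * _)%E; rewrite [LHS]integral_mkcondr; apply: eq_integral => x _.
rewrite patchE in_I; case: ltP => x0; first by rewrite wI_pos.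
by rewrite wI_neg// expr0n.
Qed.

Lemma integral_m (f : R -> \bar R) : measurable_fun setT f ->
  (\int[m]_x f x = \int[leb]_x (f x * (2 * wI x ^+ 2)%:E))%E.
Proof. exact: (integral_density rho0 mrho mE). Qed.

Lemma L2_m u : L2 m u <-> measurable_fun setT u /\ L2 leb (wt u).
Proof.
have E : measurable_fun setT u -> (\int[m]_x (u x ^+ 2)%:E = 2%:E * \int[leb]_x (wt u x ^+ 2)%:E)%E.
  move=> mu; rewrite integral_m; last by apply/measurable_EFinP; exact: measurable_funX.
  rewrite -ge0_integralZl//; last 2 first.
    by apply/measurable_EFinP; apply: measurable_funX; exact: measurable_wt.
    by move=> x _; rewrite lee_fin sqr_ge0.
  by apply: eq_integral => x _; rewrite -!EFinM /wt; congr EFin; ring.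
rewrite !L2P; split => [[mu]|[mu [mw]]].
- rewrite E// => H; split => //; split; first exact: measurable_wt.
  have : (0 <= \int[leb]_x (wt u x ^+ 2)%:E)%E.
    by apply: integral_ge0 => x _; rewrite lee_fin sqr_ge0.
  move: H; case: (\int[leb]_x (wt u x ^+ 2)%:E)%E => [r _ _| |//].
    by rewrite ltry.
  by rewrite gt0_muley ?lte_fin.
- by rewrite E// => H; split => //; rewrite lte_mul_pinfty.
Qed.

Lemma ip_m u v : measurable_fun setT u -> measurable_fun setT v ->
  \int[m]_x (u x * v x) = 2 * L2dot leb (wt u) (wt v) \/ ~ (L2 leb (wt u) /\ L2 leb (wt v)).
Proof.
move=> mu mv; have [[Lu Lv]|] := pselect (L2 leb (wt u) /\ L2 leb (wt v)); last by right.
left; rewrite -ipZl// /L2dot /Rintegral integral_m; last first.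
  by apply/measurable_EFinP; exact: measurable_funM.
by congr fine; apply: eq_integral => x _; rewrite -EFinM /wt; congr EFin; ring.
Qed.

Lemma loc_AC_derivable u : measurable_fun setT u -> loc_abs_cont u ->
  {ae leb, forall x, 0 < x -> derivable u x 1}.
Proof.
move=> mu ACu.
have : {ae leb, forall x, forall n : nat, n.+2%:R^-1 < x < n.+2%:R -> derivable u x 1}.
  apply/ae_foralln => n.
  have n1 : (1 : R) < n.+2%:R by rewrite ltr1n.
  have n0 : (0 : R) < n.+2%:R^-1 by rewrite invr_gt0.
  have nn : (n.+2%:R^-1 : R) < n.+2%:R by apply: lt_trans n1; rewrite invf_lt1 ?ltr1n ?ltr0n.
  have [H _ _] := AC_FTC mu nn (ACu _ _ n0 nn); exact: H.
apply: filterS => x H x0.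
pose n := maxn (Num.truncn x) (Num.truncn x^-1).
apply: (H n); apply/andP; split.
- rewrite invf_plt ?posrE//; apply: (lt_le_trans (truncnS_gt _)).
  by rewrite ler_nat ltnS leqW// leq_maxr.
- by apply: (lt_le_trans (truncnS_gt _)); rewrite ler_nat ltnS leqW// leq_maxl.
Qed.

(** In terms of [wt] and [grad] the energies are combinations of squared norms
    in L^2(dx); [dq] may replace the derivative, which exists almost
    everywhere. *)
Lemma D_char u : D u <-> [/\ loc_abs_cont u, measurable_fun setT u,
  L2 leb (wt u) & L2 leb (grad u)].
Proof.
have E : measurable_fun setT u -> loc_abs_cont u ->
    (\int[lebesgue_measure]_(x in I) ((derive1 u x) ^+ 2 * x ^+ 2)%:E = \int[leb]_x (grad u x ^+ 2)%:E)%E.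
  move=> mu ACu; rewrite (@ae_eq_integral_l _ _ _ leb I _ (fun x => (grad u x ^+ 2)%:E)).
  - rewrite integral_mkcond; apply: eq_integral => x _; rewrite patchE in_I.
    by case: ltP => // x0; rewrite /grad wI_neg// mul0r expr0n.
  - exact: measurable_I.
  - by apply/measurable_EFinP/measurable_funTS/measurable_funX; exact: measurable_grad.
  - have := loc_AC_derivable mu ACu; apply: filterS => x dx /mem_set; rewrite in_I => x0.
    by rewrite /grad wI_pos// (derivable_dq (dx x0)) exprMn mulrC.
split => [[ACu /L2_m[mu Lw] H]|[ACu mu Lw /L2P[_ H]]].
- split => //; apply/L2P; split; first exact: measurable_grad.
  by rewrite -E.
- by split => //; [apply/L2_m|rewrite E].
Qed.

Lemma D_measurable u : D u -> measurable_fun setT u. Proof. by move=> /D_char[]. Qed.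
Lemma D_wt u : D u -> L2 leb (wt u). Proof. by move=> /D_char[]. Qed.
Lemma D_grad u : D u -> L2 leb (grad u). Proof. by move=> /D_char[]. Qed.
Lemma D_AC u : D u -> loc_abs_cont u. Proof. by move=> /D_char[]. Qed.
Lemma D_derivable u : D u -> {ae leb, forall x, 0 < x -> derivable u x 1}.
Proof. by move=> /D_char[ACu mu _ _]; exact: loc_AC_derivable. Qed.

Lemma bessel_lamE l u v : D u -> D v ->
  bessel_lam l u v = L2dot leb (grad u) (grad v) + 2 * l * L2dot leb (wt u) (wt v).
Proof.
move=> Du Dv; rewrite /bessel_lam; congr (_ + _); last first.
  have [->|[]] := ip_m (D_measurable Du) (D_measurable Dv); first by ring.
  by split; exact: D_wt.
rewrite /bessel /L2dot /Rintegral; congr fine.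
rewrite (@ae_eq_integral_l _ _ _ leb I _ (fun x => (grad u x * grad v x)%:E)).
- rewrite integral_mkcond; apply: eq_integral => x _; rewrite patchE in_I.
  by case: ltP => // x0; rewrite /grad wI_neg// !mul0r.
- exact: measurable_I.
- apply/measurable_EFinP/measurable_funTS/measurable_funM;
    by apply: measurable_grad; exact: D_measurable.
- move: (D_derivable Du) (D_derivable Dv); apply: filterS2 => x dux dvx /mem_set; rewrite in_I => x0.
  by rewrite /grad wI_pos// (derivable_dq (dux x0)) (derivable_dq (dvx x0)); congr EFin; ring.
Qed.

Lemma gradD u v : D u -> D v -> ae_eq leb setT (grad (u \+ v)) (grad u \+ grad v).
Proof.
move=> Du Dv; move: (D_derivable Du) (D_derivable Dv); apply: filterS2 => x dux dvx _.
have [x0|x0] := leP x 0; first by rewrite /grad /= wI_neg// !mul0r addr0.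
have [du dv] := (dux x0, dvx x0).
rewrite /grad /= -mulrDr (derivable_dq du) (derivable_dq dv) (derivable_dq (derivableD du dv)).
by rewrite !derive1E (deriveD du dv).
Qed.

Lemma gradZ c u : D u -> ae_eq leb setT (grad (fun x => c * u x)) (fun x => c * grad u x).
Proof.
move=> Du; move: (D_derivable Du); apply: filterS => x dux _.
have [x0|x0] := leP x 0; first by rewrite /grad /= wI_neg// !mul0r mulr0.
have dcu : derivable (fun x => c * u x) x 1 by exact: (derivableZ (k := c) (dux x0)).
rewrite /grad /= (derivable_dq dcu) (derivable_dq (dux x0)) !derive1E.
by have := @deriveZ _ _ _ u c x 1 (dux x0); rewrite /GRing.scale/= => ->; ring.
Qed.

Lemma D_D u v : D u -> D v -> D (u \+ v).
Proof.
move=> Du Dv; have mu := D_measurable Du; have mv := D_measurable Dv.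
have muv : measurable_fun setT (u \+ v) by exact: measurable_funD.
apply/D_char; split => //.
- by move=> a b a0 ab; apply: AC_D; [exact: D_AC|exact: D_AC].
- rewrite (_ : wt _ = wt u \+ wt v); first by apply: L2D; exact: D_wt.
  by apply/funext => x; rewrite /wt /= mulrDr.
- have L : L2 leb (grad u \+ grad v) by apply: L2D; exact: D_grad.
  apply/L2P; split; first exact: measurable_grad.
  rewrite (@ae_eq_integral _ _ _ leb setT (fun x => ((grad u \+ grad v) x ^+ 2)%:E))//.
  + by case/L2P : L.
  + by apply/measurable_EFinP/measurable_funX; exact: measurable_grad.
  + by apply/measurable_EFinP/measurable_funX; exact: L2_measurable L.
  + by have := gradD Du Dv; apply: filterS => x /= /[apply] ->.
Qed.

Lemma D_Z c u : D u -> D (fun x => c * u x).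
Proof.
move=> Du; have mu := D_measurable Du.
have mcu : measurable_fun setT (fun x => c * u x) by exact: measurable_funM.
apply/D_char; split => //.
- by move=> a b a0 ab; apply: AC_Z; exact: D_AC.
- rewrite (_ : wt _ = fun x => c * wt u x); first by apply: L2Z; exact: D_wt.
  by apply/funext => x; rewrite /wt /=; ring.
- have L : L2 leb (fun x => c * grad u x) by apply: L2Z; exact: D_grad.
  apply/L2P; split; first exact: measurable_grad.
  rewrite (@ae_eq_integral _ _ _ leb setT (fun x => ((c * grad u x) ^+ 2)%:E))//.
  + by case/L2P : L.
  + by apply/measurable_EFinP/measurable_funX; exact: measurable_grad.
  + by apply/measurable_EFinP/measurable_funX; exact: L2_measurable L.
  + by have := gradZ c Du; apply: filterS => x /= /[apply] ->.
Qed.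

Lemma D_B u v : D u -> D v -> D (u \- v).
Proof.
move=> Du Dv; have -> : u \- v = u \+ (fun x => -1 * v x).
  by apply/funext => x /=; rewrite mulN1r.
exact: D_D Du (D_Z (-1) Dv).
Qed.

Lemma bessel_lamC l u v : D u -> D v -> bessel_lam l u v = bessel_lam l v u.
Proof. by move=> Du Dv; rewrite !bessel_lamE// (ipC leb (grad u)) (ipC leb (wt u)). Qed.

Lemma bessel_lamDl l u v w : D u -> D v -> D w ->
  bessel_lam l (u \+ v) w = bessel_lam l u w + bessel_lam l v w.
Proof.
move=> Du Dv Dw; have Duv := D_D Du Dv; rewrite !bessel_lamE//.
rewrite (@ae_ip _ _ _ leb _ (grad u \+ grad v) (grad w) (grad w) (D_grad Duv)
  (L2D (D_grad Du) (D_grad Dv)) (D_grad Dw) (D_grad Dw) (gradD Du Dv) (ae_eq_refl _ _ _)).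
rewrite (_ : wt (u \+ v) = wt u \+ wt v); last by apply/funext => x; rewrite /wt /= mulrDr.
rewrite (ipDl (D_grad Du) (D_grad Dv) (D_grad Dw)) (ipDl (D_wt Du) (D_wt Dv) (D_wt Dw)).
by rewrite mulrDr addrACA.
Qed.

Lemma bessel_lamZl l c u w : D u -> D w ->
  bessel_lam l (fun x => c * u x) w = c * bessel_lam l u w.
Proof.
move=> Du Dw; have Dcu := D_Z c Du; rewrite !bessel_lamE//.
rewrite (@ae_ip _ _ _ leb _ (fun x => c * grad u x) (grad w) (grad w) (D_grad Dcu)
  (L2Z c (D_grad Du)) (D_grad Dw) (D_grad Dw) (gradZ c Du) (ae_eq_refl _ _ _)).
rewrite (_ : wt (fun x => c * u x) = fun x => c * wt u x); last by apply/funext => x; rewrite /wt /=; ring.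
rewrite (ipZl c (D_grad Du) (D_grad Dw)) (ipZl c (D_wt Du) (D_wt Dw)).
by rewrite mulrDr [c * (2 * l * _)]mulrCA.
Qed.

Lemma bessel_lamBl l u v w : D u -> D v -> D w ->
  bessel_lam l (u \- v) w = bessel_lam l u w - bessel_lam l v w.
Proof.
move=> Du Dv Dw; have -> : u \- v = u \+ (fun x => -1 * v x).
  by apply/funext => x /=; rewrite mulN1r.
by rewrite (bessel_lamDl l Du (D_Z (-1) Dv) Dw) (bessel_lamZl l (-1) Dv Dw) mulN1r.
Qed.

Lemma bessel_lam_ge0 l u : 0 <= l -> D u -> 0 <= bessel_lam l u u.
Proof.
by move=> l0 Du; rewrite bessel_lamE// addr_ge0 ?ip_ge0// mulr_ge0 ?ip_ge0// mulr_ge0.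
Qed.

Lemma bessel_lam_sqrD l u v : D u -> D v ->
  bessel_lam l (u \+ v) (u \+ v) = bessel_lam l u u + 2 * bessel_lam l u v + bessel_lam l v v.
Proof.
move=> Du Dv; have Duv := D_D Du Dv.
rewrite bessel_lamDl// (bessel_lamC l Du Duv) (bessel_lamC l Dv Duv) !bessel_lamDl//.
by rewrite (bessel_lamC l Dv Du); ring.
Qed.

Lemma D_FTC u a b : D u -> 0 < a -> a <= b -> u b - u a = \int[leb]_(t in `]a, b]) dq u t.
Proof.
move=> Du a0; rewrite le_eqVlt => /predU1P[<-|ab].
  by rewrite subrr set_itvoc0 ?Rintegral_set0.
by have [_ _] := AC_FTC (D_measurable Du) ab (D_AC Du a0 ab); apply => //; exact: ltW.
Qed.
End bessel_space.

(** * Lipschitz images and pointwise bounds *)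

Section lipschitz_images.
Context {R : realType}.
Local Notation leb := (@lebesgue_measure R).
Implicit Types (u v w : R -> R) (a b c e x y l : R).

Lemma lip_continuous (phi : R -> R) (K : R) :
  (forall x y, `|phi x - phi y| <= K * `|x - y|) -> continuous phi.
Proof.
move=> phiK x; apply/cvgrPdist_lt => e e0.
have K1 : 0 < `|K| + 1 by rewrite ltr_wpDl.
near=> y; apply: le_lt_trans (phiK x y) _.
apply: (@le_lt_trans _ _ ((`|K| + 1) * `|x - y|)).
  by rewrite ler_wpM2r// (le_trans (ler_norm K))// lerDl.
rewrite mulrC -ltr_pdivlMr//; near: y.
apply: (@cvgr_dist_lt _ _ _ _ _ id x); [exact: cvg_id|exact: divr_gt0].
Unshelve. all: by end_near. Qed.

(** Difference quotients of [phi \o u] are at most [K] times those of [u]. *)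
Lemma D_comp (phi : R -> R) (K : R) u : 0 <= K -> phi 0 = 0 ->
  (forall x y, `|phi x - phi y| <= K * `|x - y|) -> D u ->
  D (phi \o u) /\ forall l, 0 <= l ->
    bessel_lam l (phi \o u) (phi \o u) <= K ^+ 2 * bessel_lam l u u.
Proof.
move=> K0 phi0 phiK Du; have mu := D_measurable Du.
have mphi : measurable_fun setT (phi \o u).
  by apply: measurableT_comp => //; apply: continuous_measurable_fun; exact: lip_continuous phiK.
have ACphi : loc_abs_cont (phi \o u).
  by move=> a b a0 ab; apply: AC_comp_lip phiK _ => //; exact: D_AC.
have Lu := L2Z K (D_wt Du); have Lg := L2Z K (D_grad Du).
have wle x : `|wt (phi \o u) x| <= `|K * wt u x|.
  rewrite /wt /= mulrCA !normrM ler_wpM2l// (ger0_norm K0).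
  by have := phiK (u x) 0; rewrite phi0 !subr0.
have Lw : L2 leb (wt (phi \o u)) by exact: (@L2_le _ _ R leb _ _ (measurable_wt mphi) Lu wle).
have gle : {ae leb, forall x, `|grad (phi \o u) x| <= `|K * grad u x|}.
  have := loc_AC_derivable mphi ACphi; have := D_derivable Du; apply: filterS2 => x du dphi.
  have [x0|x0] := leP x 0; first by rewrite /grad wI_neg// !mul0r mulr0 normr0.
  rewrite /grad mulrCA !normrM ler_wpM2l// (ger0_norm K0).
  have c1 := derivable_dq_cvg (du x0); have c2 := derivable_dq_cvg (dphi x0).
  rewrite (derivable_dq (du x0)) (derivable_dq (dphi x0)).
  have c2n := cvg_norm c2.
  have c1n : K * `|n.+1%:R * (u (x + n.+1%:R^-1) - u x)| @[n --> \oo] --> K * `|derive1 u x|.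
    by apply: cvgM; [exact: cvg_cst|exact: cvg_norm].
  apply: (ler_cvg_to (c2n _) c1n); apply: nearW => n /=.
  by rewrite !normrM mulrCA ler_wpM2l//; exact: phiK.
have Lgphi : L2 leb (grad (phi \o u)).
  apply/L2P; split; first exact: measurable_grad.
  have /L2P[mKg] := Lg; apply: le_lt_trans; apply: ae_ge0_le_integral => //.
  - by move=> x _; rewrite lee_fin sqr_ge0.
  - by apply/measurable_EFinP/measurable_funX; exact: measurable_grad.
  - by move=> x _; rewrite lee_fin sqr_ge0.
  - by apply/measurable_EFinP/measurable_funX.
  - move: gle; apply: filterS => x gx _; rewrite lee_fin.
    by rewrite -[leLHS]real_normK ?num_real// -[leRHS]real_normK ?num_real// lerXn2r ?nnegrE.
have Dphi : D (phi \o u) by apply/D_char.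
split => // l l0; rewrite !bessel_lamE// mulrDr.
have nmK f : L2 leb f -> L2norm leb (fun x => K * f x) ^+ 2 = K ^+ 2 * L2dot leb f f.
  by move=> Lf; rewrite nmZ// exprMn nm_sqr real_normK ?num_real.
apply: lerD.
- rewrite -nmK; last exact: D_grad.
  by rewrite -nm_sqr lerXn2r ?nnegrE ?nm_ge0//; exact: le_nm_ae.
- rewrite mulrCA ler_wpM2l ?mulr_ge0// -nmK; last exact: D_wt.
  by rewrite -nm_sqr lerXn2r ?nnegrE ?nm_ge0//; exact: le_nm.
Qed.

Lemma L2_indic_itv (i : interval R) : (leb [set` i] < +oo)%E -> L2 leb (\1_[set` i] : R -> R).
Proof.
move=> ioo; apply/L2P; split; first by apply: measurable_indic; exact: measurable_itv.
have E x : (\1_[set` i] x : R) ^+ 2 = \1_[set` i] x.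
  by rewrite indicE; case: (_ \in _); rewrite ?expr0n ?expr1n.
under eq_integral do rewrite E.
by rewrite integral_indic ?setIT.
Qed.

Lemma AC_inv a b : 0 < a -> abs_cont_itv a b (fun x : R => x^-1).
Proof.
move=> a0; apply: (@AC_lip _ a b (a^-1 ^+ 2)); first exact: sqr_ge0.
move=> x y ax xy yb; have x0 := lt_le_trans a0 ax; have y0 := lt_le_trans x0 xy.
have -> : y^-1 - x^-1 = - ((y - x) * (x^-1 * y^-1)) by field; rewrite !gt_eqF.
rewrite normrN ger0_norm; last first.
  by rewrite mulr_ge0 ?subr_ge0// mulr_ge0// invr_ge0 ltW.
rewrite [leLHS]mulrC ler_wpM2r ?subr_ge0// expr2 ler_pM ?invr_ge0 ?(ltW x0) ?(ltW y0)//.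
  by rewrite lef_pV2 ?posrE.
by rewrite lef_pV2 ?posrE// (le_trans ax).
Qed.

(** Only the values to the right of [x] enter [dq], which makes it insensitive
    to a corner at [x]. *)
Lemma dq_right u v x b : x < b -> (forall y, x <= y < b -> u y = v y) ->
  derivable v x 1 -> dq u x = derive1 v x.
Proof.
move=> xb uv dv; apply: dq_cvg; have := derivable_dq_cvg dv; apply: cvg_trans.
apply: near_eq_cvg; near=> n.
have nb : n.+1%:R^-1 < b - x.
  near: n; have := near_infty_natSinv_lt (PosNum (_ : 0 < b - x)); apply.
  by rewrite subr_gt0.
rewrite !uv// ?lexx ?xb//; apply/andP; split; first by rewrite lerDl.
by rewrite -ltrBrDl.
Unshelve. all: by end_near. Qed.

Lemma derivable_invx x : 0 < x -> derivable (fun y : R => y^-1) x 1.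
Proof. by move=> x0; apply: derivableV => //; rewrite gt_eqF. Qed.

Lemma derive1_invx x : 0 < x -> derive1 (fun y : R => y^-1) x = - x ^- 2.
Proof.
move=> x0; rewrite derive1E (@deriveV _ _ (@id R)) ?gt_eqF//.
by rewrite derive_id /GRing.scale/= mulr1.
Qed.

Lemma measurable_maxV c : 0 < c -> measurable_fun setT (fun x : R => (Num.max x c)^-1).
Proof.
move=> c0; apply: continuous_measurable_fun => x.
apply: cvgV; first by rewrite gt_eqF// lt_max c0 orbT.
apply: continuous_max; [exact: cvg_id|exact: cvg_cst].
Qed.

(** The fundamental theorem for [1 / x]. *)
Lemma integral_invsq a b : 0 < a -> a < b ->
  \int[leb]_(t in `]a, b]) (t ^- 2) = a^-1 - b^-1.
Proof.
move=> a0 ab; have b0 := lt_trans a0 ab.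
have AC : abs_cont_itv a b (fun x => (Num.max x a)^-1).
  apply: (AC_eq _ (AC_inv b a0)) => x /andP[ax _]; by rewrite max_l.
have [_ intg H] := AC_FTC (measurable_maxV a0) ab AC.
have := H _ _ (lexx a) (ltW ab) (lexx b).
rewrite maxxx max_l ?(ltW ab)// => E; rewrite -[RHS]opprB E -mulN1r -RintegralZl//.
apply: eq_Rintegral => t; rewrite inE/= in_itv/= => /andP[at_ _].
have t0 := lt_trans a0 at_.
rewrite (@dq_right _ (fun y : R => y^-1) t (t + 1)) ?ltrDl//; first by rewrite derive1_invx// mulN1r opprK.
- by move=> y /andP[ty _]; rewrite max_l// (le_trans (ltW at_)).
- exact: derivable_invx.
Qed.

(** The Cauchy-Schwarz inequality for the product of [1 / t] and [t u'(t)],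
    since the integral of [t^-2] over [[1, y]] is at most 1. *)
Lemma D_increment_le u y : D u -> 1 <= y -> `|u y - u 1| <= L2norm leb (grad u).
Proof.
move=> Du; rewrite le_eqVlt => /predU1P[<-|y1]; first by rewrite subrr normr0 nm_ge0.
have y0 := lt_trans ltr01 y1.
pose h (t : R) := \1_(`]1, y]) t * (Num.max t 1)^-1 : R.
have mh : measurable_fun setT h.
  by apply: measurable_funM; [exact: measurable_indic|exact: measurable_maxV].
have Lh : L2 leb h.
  apply: (@L2_le _ _ R leb _ (\1_(`]1, y]) : R -> R) mh).
    by apply: L2_indic_itv; rewrite lebesgue_measure_itv/= lte_fin y1 ltry.
  move=> x; rewrite /h normrM ler_piMr// ger0_norm ?invr_ge0 ?le_max ?ler01 ?orbT//.
  by rewrite invf_le1 ?lt_max ?ltr01 ?orbT// le_max lexx orbT.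
have -> : u y - u 1 = L2dot leb h (grad u).
  rewrite (D_FTC Du ltr01 (ltW y1)) /L2dot [LHS]Rintegral_mkcond.
  apply: eq_Rintegral => t _; rewrite patchE /h indicE.
  have [|] := boolP (t \in `]1, y]%classic); last by rewrite !mul0r.
  rewrite inE/= in_itv/= => /andP[t1 _]; have t0 := lt_trans ltr01 t1.
  by rewrite mul1r /grad wI_pos// max_l ?(ltW t1)// mulKf// gt_eqF.
apply: le_trans (ip_CS Lh (D_grad Du)) _; rewrite ler_piMl ?nm_ge0//.
rewrite -(@ler_pXn2r _ 2) ?nnegrE ?nm_ge0// nm_sqr expr1n.
have -> : L2dot leb h h = \int[leb]_(t in `]1, y]) (t ^- 2).
  rewrite /L2dot [RHS]Rintegral_mkcond; apply: eq_Rintegral => t _; rewrite patchE /h indicE.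
  have [|] := boolP (t \in `]1, y]%classic); last by rewrite !mul0r.
  rewrite inE/= in_itv/= => /andP[t1 _].
  by rewrite !mul1r max_l ?(ltW t1)// expr2 invfM.
by rewrite integral_invsq// invr1 gerBl invr_ge0 ltW.
Qed.

(** This is the transience of the three-dimensional Bessel process. The
    increments of [u] on the half-line from 1 are at most the energy norm, so
    if [u 1] were larger then [u] would stay away from zero at infinity and
    not be square-integrable. *)
Lemma D_at1_sqr_le u : D u -> u 1 ^+ 2 <= L2dot leb (grad u) (grad u).
Proof.
move=> Du; rewrite -nm_sqr -[leLHS]real_normK ?num_real// lerXn2r ?nnegrE ?nm_ge0//.
rewrite leNgt; apply/negP => N1.
pose c := `|u 1| - L2norm leb (grad u); have c0 : 0 < c by rewrite subr_gt0.
have uc y : 1 <= y -> c <= `|wt u y|.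
  move=> y1; have y0 := lt_le_trans ltr01 y1.
  rewrite /wt wI_pos// normrM gtr0_norm//.
  apply: (@le_trans _ _ `|u y|); last by rewrite ler_peMl.
  rewrite lerBlDr; apply: le_trans (lerD (lexx _) (D_increment_le Du y1)).
  by rewrite addrC -lerBlDr; apply: le_trans (lerB_dist _ _) _; rewrite distrC.
have /L2P[mw woo] := D_wt Du.
have s1 : (\int[leb]_(x in `[1%R, +oo[) (wt u x ^+ 2)%:E <= \int[leb]_x (wt u x ^+ 2)%:E)%E.
  apply: ge0_subset_integral => //.
  - by apply/measurable_EFinP/measurable_funX.
  - by move=> x _; rewrite lee_fin sqr_ge0.
have s2 : (\int[leb]_(x in `[1%R, +oo[) (c ^+ 2)%:E <=
    \int[leb]_(x in `[1%R, +oo[) (wt u x ^+ 2)%:E)%E.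
  apply: ge0_le_integral => //.
  - by move=> x _; rewrite lee_fin sqr_ge0.
  - by apply/measurable_EFinP/measurable_funX/measurable_funTS.
  - move=> x; rewrite /= in_itv/= andbT => /uc cx; rewrite lee_fin.
    by rewrite -[leRHS]real_normK ?num_real// lerXn2r ?nnegrE ?(ltW c0).
have := le_lt_trans (le_trans s2 s1) woo; rewrite integral_cst//= lebesgue_measure_itv/= ltry/=.
by rewrite addye// gt0_muley ?lte_fin ?exprn_gt0// ltxx.
Qed.

End lipschitz_images.

(** * Solutions of (x^2 y')' = c^2 x^2 y *)

Section harmonic.
Context {R : realType}.
Local Notation leb := (@lebesgue_measure R).
Implicit Types (u v w : R -> R) (A B a b c x y : R).

(** [y = hE / x] is the general solution of [(x^2 y')' = c^2 x^2 y],
    and [hG = x^2 y'] its flux. In [hY] the factor [1 / x] is cut off at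
    1, so that [hY] is continuous on R. *)
Definition hE A B c x : R := A * expR (c * x) + B * expR (- (c * x)).
Definition hG A B c x : R := x * (c * hE A (- B) c x) - hE A B c x.
Definition hY A B c x : R := hE A B c x * (Num.max x 1)^-1.

Lemma is_derive_expZ c x : is_derive x 1 (fun y : R => expR (c * y)) (c * expR (c * x)).
Proof.
have h : is_derive x 1 (fun y : R => c * y) c.
  by apply: is_derive_eq; rewrite /GRing.scale/= mulr1.
by apply: is_derive_eq (is_derive1_comp (is_derive_expR (c * x)) h) _; rewrite mulrC.
Qed.

Lemma is_derive_hE A B c x : is_derive x 1 (hE A B c) (c * hE A (- B) c x).
Proof.
have h1 := is_derive_expZ c x; have h2 := is_derive_expZ (- c) x.
have e : (fun y : R => expR (- c * y)) = (fun y => expR (- (c * y))).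
  by apply/funext => y; rewrite mulNr.
rewrite e !mulNr in h2; have h := is_deriveD (is_deriveZ A h1) (is_deriveZ B h2).
by apply: is_derive_eq h _; rewrite /hE /GRing.scale/=; ring.
Qed.

Lemma is_derive_hG A B c x : is_derive x 1 (hG A B c) (c ^+ 2 * x * hE A B c x).
Proof.
have h1 := is_derive_hE A (- B) c x; have h2 := is_derive_hE A B c x.
have h := is_deriveB (is_deriveM (is_derive_id x 1) (is_deriveZ c h1)) h2.
by apply: is_derive_eq h _; rewrite /= opprK /GRing.scale/=; ring.
Qed.

Lemma is_derive_continuous (f : R -> R) x l : is_derive x 1 f l -> {for x, continuous f}.
Proof. by move=> [df _]; apply: differentiable_continuous; apply/derivable1_diffP. Qed.

Lemma continuous_hE A B c : continuous (hE A B c).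
Proof. by move=> x; exact: is_derive_continuous (is_derive_hE A B c x). Qed.

Lemma continuous_hG A B c : continuous (hG A B c).
Proof. by move=> x; exact: is_derive_continuous (is_derive_hG A B c x). Qed.

Lemma hE_bound A B c a b : exists2 K, 0 <= K & forall x, a <= x <= b -> `|hE A B c x| <= K.
Proof.
pose M := `|c| * (`|a| + `|b|).
exists ((`|A| + `|B|) * expR M); first by rewrite mulr_ge0 ?expR_ge0// addr_ge0.
move=> x /andP[ax xb].
have xM : `|c * x| <= M.
  rewrite normrM ler_wpM2l// ler_norml; apply/andP; split.
    rewrite lerNl; apply: (@le_trans _ _ (- a)); first by rewrite lerN2.
    by rewrite (le_trans (ler_norm (- a)))// normrN lerDl.
  by rewrite (le_trans xb)// (le_trans (ler_norm b))// lerDr.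
rewrite mulrDl; apply: le_trans (ler_normD _ _) _; rewrite !normrM lerD// ler_wpM2l//.
  by rewrite ger0_norm ?expR_ge0// ler_expR (le_trans (ler_norm _)).
by rewrite ger0_norm ?expR_ge0// ler_expR (le_trans (ler_norm _))// normrN.
Qed.

Lemma AC_hE A B c a b : abs_cont_itv a b (hE A B c).
Proof.
have [K K0 hK] := hE_bound A (- B) c a b.
apply: (@AC_lip _ _ _ (`|c| * K)); first by rewrite mulr_ge0.
move=> x y ax xy yb.
have cE : {within `[x, y], continuous (hE A B c)}.
  by apply: continuous_subspaceT => t; exact: continuous_hE.
have [t] := MVT_segment xy (fun t _ => is_derive_hE A B c t) cE.
rewrite in_itv/= => /andP[xt ty] ->.
rewrite normrM (ger0_norm (x := y - x)) ?subr_ge0// ler_wpM2r ?subr_ge0//.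
by rewrite normrM ler_wpM2l// hK// (le_trans ax)//= (le_trans ty).
Qed.

Lemma AC_hG A B c a b : abs_cont_itv a b (hG A B c).
Proof.
apply: AC_B; last exact: AC_hE.
by apply: AC_M; [exact: AC_id|apply: AC_Z; exact: AC_hE].
Qed.

Lemma AC_hY A B c a b : 1 <= a -> abs_cont_itv a b (hY A B c).
Proof.
move=> a1; have a0 := lt_le_trans ltr01 a1.
apply: (AC_eq _ (AC_M (AC_hE A B c a b) (AC_inv b a0))) => x /andP[ax _].
by rewrite /hY max_l// (le_trans a1).
Qed.

Lemma dq_hY A B c x w b : 1 <= x -> x < b -> (forall y, x <= y < b -> w y = hY A B c y) ->
  x ^+ 2 * dq w x = hG A B c x.
Proof.
move=> x1 xb wY; have x0 := lt_le_trans ltr01 x1; have xn0 : x != 0 by rewrite gt_eqF.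
have h : is_derive x 1 (fun y : R => hE A B c y * y^-1) (hG A B c x * x ^- 2).
  have hV : is_derive x 1 (fun y : R => y^-1) (- x ^- 2).
    by apply: DeriveDef; [exact: derivable_invx|rewrite -derive1E derive1_invx].
  apply: is_derive_eq (is_deriveM (is_derive_hE A B c x) hV) _.
  by rewrite /hG /GRing.scale/=; field.
rewrite (@dq_right _ _ (fun y : R => hE A B c y * y^-1) _ b)//.
- by rewrite derive1E derive_val; field.
- by move=> y /[dup] /wY -> /andP[xy _]; rewrite /hY max_l// (le_trans x1).
Qed.

(** Integration by parts against the solution, whose flux satisfies
    [hG' = c^2 x hE]. *)
Lemma hG_parts A B c a b v : a < b -> measurable_fun setT v -> abs_cont_itv a b v ->
  leb.-integrable `]a, b] (fun x => (hG A B c x * dq v x + c ^+ 2 * x * hE A B c x * v x)%:E) /\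
  \int[leb]_(x in `]a, b]) (hG A B c x * dq v x + c ^+ 2 * x * hE A B c x * v x) =
    hG A B c b * v b - hG A B c a * v a.
Proof.
move=> ab mv ACv.
have mG : measurable_fun setT (hG A B c).
  by apply: continuous_measurable_fun; exact: continuous_hG.
have mE : measurable_fun setT (hE A B c).
  by apply: continuous_measurable_fun; exact: continuous_hE.
have mGv : measurable_fun setT (fun x => hG A B c x * v x) by exact: measurable_funM.
have [_ intg FTC] := AC_FTC mGv ab (AC_M (AC_hG A B c a b) ACv).
have [dv _ _] := AC_FTC mv ab ACv.
have mT : measurable_fun setT (fun x => hG A B c x * dq v x + c ^+ 2 * x * hE A B c x * v x).
  apply: measurable_funD; apply: measurable_funM => //; first exact: measurable_dq.
  by apply: measurable_funM => //; apply: measurable_funM.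
have ae : ae_eq leb `]a, b]%classic (fun x => (hG A B c x * dq v x + c ^+ 2 * x * hE A B c x * v x)%:E)
   (EFin \o dq (fun x => hG A B c x * v x)).
  move: dv (ae_neq b); apply: filterS2 => x dv xb /=; rewrite in_itv/= => /andP[ax xb'].
  have {}dv : derivable v x 1 by apply: dv; rewrite ax lt_neqAle xb.
  have h := is_deriveM (is_derive_hG A B c x) (derivableP dv).
  have dGv : derivable (fun x => hG A B c x * v x) x 1 by case: h.
  congr EFin; rewrite (derivable_dq dGv) (derivable_dq dv) !derive1E.
  by case: h => _ ->; rewrite /GRing.scale/=; ring.
split.
- by apply: (ae_integrable _ _ ae) => //; apply/measurable_EFinP/measurable_funTS.
- rewrite (FTC _ _ (lexx a) (ltW ab) (lexx b)) /Rintegral; congr fine.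
  apply: ae_eq_integral ae => //; first by apply/measurable_EFinP/measurable_funTS.
  by case/integrableP : intg.
Qed.

(** The determinant of the two equations,
    [expR (c (a - b)) - expR (c (b - a))], is not zero. *)
Lemma hE_interp c a b (p q : R) : 0 < c -> a < b ->
  exists AB : R * R, hE AB.1 AB.2 c a = p /\ hE AB.1 AB.2 c b = q.
Proof.
move=> c0 ab; pose s x := expR (c * x); pose r x := expR (- (c * x)).
pose d := s a * r b - s b * r a.
have d0 : d != 0.
  rewrite lt_eqF// subr_lt0 /s /r -!expRD ltr_expR -!mulrBr ltr_pM2l//.
  by lra.
exists ((p * r b - q * r a) / d, (q * s a - p * s b) / d); rewrite /hE/= -/(s a) -/(r a) -/(s b) -/(r b).
by split; rewrite /d; field.
Qed.
End harmonic.

(** * The orthogonal projection *)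

Section projection.
Context {R : realType} (u : R -> R) (c : R) (AB : nat -> R * R).
Context (Du : D u) (c0 : 0 < c).
Context (ABl : forall k, (0 < k)%N -> hE (AB k).1 (AB k).2 c k%:R = k%:R * u k%:R)
  (ABr : forall k, (0 < k)%N -> hE (AB k).1 (AB k).2 c k.+1%:R = k.+1%:R * u k.+1%:R).
Local Notation leb := (@lebesgue_measure R).
Implicit Types (v z : R -> R) (a b x y l : R) (k n : nat).

Let Y k := hY (AB k).1 (AB k).2 c.
Let G k := hG (AB k).1 (AB k).2 c.

Definition interpolant x := if x < 1 then u x else Y (Num.truncn x) x.
Local Notation w := interpolant.

Let ge1 k : (0 < k)%N -> (1 : R) <= k%:R. Proof. by move=> k0; rewrite ler1n. Qed.

Let w_itv k x : (0 < k)%N -> k%:R <= x < k.+1%:R -> w x = Y k x.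
Proof.
move=> k0 /[dup] H /andP[kx _]; rewrite /interpolant ltNge (le_trans (ge1 k0) kx)/=.
by rewrite (truncn_def H).
Qed.

Let Yl k : (0 < k)%N -> Y k k%:R = u k%:R.
Proof.
move=> k0; rewrite /Y /hY max_l ?ge1// ABl// mulrC mulKf//.
by rewrite pnatr_eq0 -lt0n.
Qed.

Let Yr k : (0 < k)%N -> Y k k.+1%:R = u k.+1%:R.
Proof. by move=> k0; rewrite /Y /hY max_l ?ge1// ABr// mulrC mulKf. Qed.

Let w_nat k : (0 < k)%N -> w k%:R = u k%:R.
Proof. by move=> k0; rewrite (w_itv k0) ?Yl// lexx ltr_nat ltnSn. Qed.

Let w_cl k x : (0 < k)%N -> k%:R <= x <= k.+1%:R -> w x = Y k x.
Proof.
move=> k0 /andP[kx]; rewrite le_eqVlt => /predU1P[->|xk]; first by rewrite w_nat// Yr.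
by apply: w_itv => //; rewrite kx.
Qed.

Let w_le1 x : x <= 1 -> w x = u x.
Proof.
rewrite le_eqVlt => /predU1P[->|x1]; first by rewrite (w_nat (ltn0Sn 0)).
by rewrite /interpolant x1.
Qed.

Let w_AC_nat a n : 0 < a -> a <= 1 -> abs_cont_itv a n.+1%:R w.
Proof.
move=> a0 a1; elim: n => [|n IH].
  have ua1 : abs_cont_itv a 1 u.
    by apply: (AC_sub _ _ (D_AC Du a0 (_ : a < 2))) => //; rewrite ?ler1n// (le_lt_trans a1)// ltr1n.
  by apply: (AC_eq _ ua1) => x /andP[_ x1]; rewrite w_le1.
apply: (AC_glue _ _ IH); first by rewrite (le_trans a1)// ler1n.
  by rewrite ler_nat.
have := @AC_hY R (AB n.+1).1 (AB n.+1).2 c n.+1%:R n.+2%:R (ge1 (ltn0Sn n)).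
by apply: AC_eq => x H; rewrite (w_cl (ltn0Sn n) H).
Qed.

Let w_AC : loc_abs_cont w.
Proof.
move=> a b a0 ab; have m0 : 0 < Num.min a 1 by rewrite lt_min a0 ltr01.
have m1 : Num.min a 1 <= 1 by rewrite ge_min lexx orbT.
apply: (AC_sub _ _ (w_AC_nat (Num.truncn b) m0 m1)); first by rewrite ge_min lexx.
exact/ltW/truncnS_gt.
Qed.

Let w_measurable : measurable_fun setT w.
Proof.
have -> : [set: R] = `]-oo, 1[ `|` `]0, +oo[.
  apply/esym/seteqP; split => // x _; rewrite /= !in_itv/= andbT.
  by case: (ltP x 1) => x1; [left|right; apply: lt_le_trans x1].
apply/measurable_funU => //; split.
  apply: (eq_measurable_fun u); last by apply: measurable_funTS; exact: D_measurable.
  by move=> x; rewrite inE/= in_itv/= => x1; rewrite /interpolant x1.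
apply: open_continuous_measurable_fun; first exact: interval_open.
move=> x; rewrite inE/= in_itv/= andbT => x0.
apply: (AC_continuous_at (w_AC (_ : 0 < x / 2) (_ : x / 2 < x + 1))).
- by rewrite divr_gt0.
- by rewrite ltr_pdivrMr// mulr2n mulrDr mulr1 -addrA ltrDl addr_gt0// ltr_wpDr.
- by rewrite ltr_pdivrMr// ltr_pMr// ltr1n/= ltrDl.
Qed.

(* The density of the energy product of [v] and [z]. *)
Let Phi v z x := grad v x * grad z x + c ^+ 2 * (wt v x * wt z x).

Let F_ k : set R := [set` Interval (if k is 0%N then -oo%O else BRight k%:R) (BRight k.+1%:R)].

Let mF k : measurable (F_ k : set (measurableTypeR R)). Proof. exact: measurable_itv. Qed.

Let tF : trivIset [set: nat] F_.
Proof.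
apply: ltn_trivIset => n2 n1 n12; apply/seteqP; split => // x [].
rewrite /F_ /= !in_itv/= => /andP[_ xn1]; case: n2 n12 => // n2 n12 /andP[nx _].
by have := lt_le_trans nx xn1; rewrite ltr_nat ltnNge n12.
Qed.

Let cF : \bigcup_k F_ k = setT.
Proof.
apply/seteqP; split => // x _.
have ex : exists n, x <= n.+1%:R by exists (Num.truncn x); exact/ltW/truncnS_gt.
case: (ex_minnP ex) => -[|n] xn nmin; first by exists 0%N => //; rewrite /F_ /= in_itv/=.
exists n.+1 => //; rewrite /F_ /= in_itv/= xn andbT ltNge.
by apply/negP => /nmin; rewrite ltnn.
Qed.

Let mPhi v z : measurable_fun setT v -> measurable_fun setT z -> measurable_fun setT (Phi v z).
Proof.
move=> mv mz; apply: measurable_funD; first by apply: measurable_funM; exact: measurable_grad.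
by apply: measurable_funM => //; apply: measurable_funM; exact: measurable_wt.
Qed.

(* Only the values of [v] at [k] and [k + 1] matter. *)
Let Phi_k k v : (0 < k)%N -> measurable_fun setT v -> loc_abs_cont v ->
  leb.-integrable (F_ k) (EFin \o Phi w v) /\
  \int[leb]_(x in F_ k) Phi w v x = G k k.+1%:R * v k.+1%:R - G k k%:R * v k%:R.
Proof.
move=> k0 mv ACv.
have kk : (k%:R : R) < k.+1%:R by rewrite ltr_nat.
have kp : (0 : R) < k%:R by rewrite ltr0n.
have [intg eqi] := @hG_parts R (AB k).1 (AB k).2 c k%:R k.+1%:R v kk mv (ACv _ _ kp kk).
have FE : F_ k = `]k%:R, k.+1%:R]%classic by rewrite /F_; case: k k0 {kk kp intg eqi}.
have ae : ae_eq leb `]k%:R, k.+1%:R]%classic (EFin \o Phi w v)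
    (fun x => (G k x * dq v x + c ^+ 2 * x * hE (AB k).1 (AB k).2 c x * v x)%:E).
  have := ae_neq (k.+1%:R : R); apply: filterS => x xk /=; rewrite in_itv/= => /andP[kx xk'].
  have x1 : 1 <= x by rewrite (le_trans (ge1 k0))// ltW.
  have xk1 : x < k.+1%:R by rewrite lt_neqAle xk.
  have x0 := lt_le_trans ltr01 x1; have xn0 : x != 0 by rewrite gt_eqF.
  have hdq := @dq_hY R (AB k).1 (AB k).2 c x w k.+1%:R x1 xk1.
  congr EFin; rewrite /Phi /grad /wt wI_pos// -/(G k x) /G -hdq; last first.
    by move=> y /andP[xy yk]; rewrite (w_itv k0)// yk (le_trans (ltW kx)).
  rewrite (w_itv k0) ?xk1 ?ltW// /Y /hY max_l//.
  by field.
rewrite FE; split.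
- by apply: (ae_integrable _ _ ae) => //; apply/measurable_EFinP/measurable_funTS; apply: mPhi.
- rewrite -[RHS]eqi /Rintegral; congr fine; apply: ae_eq_integral ae => //.
    by apply/measurable_EFinP/measurable_funTS; apply: mPhi.
  by case/integrableP : intg.
Qed.

Let Phi_D v z : D v -> D z -> leb.-integrable setT (EFin \o Phi v z).
Proof.
move=> Dv Dz; have h1 := ip_integrable (D_grad Dv) (D_grad Dz).
have h2 := integrableZl measurableT (c ^+ 2) (ip_integrable (D_wt Dv) (D_wt Dz)).
by apply: eq_integrable (integrableD measurableT h1 h2) => // x _.
Qed.

Let Phi0 x v : 0 <= Phi v v x.
Proof. rewrite /Phi -!expr2; apply: addr_ge0; first exact: sqr_ge0. by apply: mulr_ge0; exact: sqr_ge0. Qed.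

Let ae_F0 z : loc_abs_cont z -> measurable_fun setT z -> (forall x, 0 < x < 1 -> w x = z x) ->
  {ae leb, forall x, F_ 0 x -> grad w x = grad z x /\ wt w x = wt z x}.
Proof.
move=> ACz mz wz; have := loc_AC_derivable mz ACz; have := ae_neq (1 : R).
apply: filterS2 => x xn dz; rewrite /F_ /= in_itv/= => x1; rewrite /grad /wt.
have [x0|x0] := leP x 0; first by rewrite wI_neg// !mul0r.
have {}x1 : x < 1 by rewrite lt_neqAle xn.
rewrite wz ?x0// (derivable_dq (dz x0)) (@dq_right _ _ z x 1)//; last exact: dz.
by move=> y /andP[xy y1]; rewrite wz// y1 (lt_le_trans x0).
Qed.

(* On [k, k + 1] the functions w and u have the same boundary values, so by
   [Phi_k] the integrals of Phi w w and Phi w u are equal there, and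
   Phi w w + Phi u u - 2 Phi w u is a sum of squares. *)
Let le_Phi k : (\int[leb]_(x in F_ k) (Phi w w x)%:E <= \int[leb]_(x in F_ k) (Phi u u x)%:E)%E.
Proof.
case: k => [|k].
  rewrite le_eqVlt; apply/orP; left; apply/eqP; apply: ae_eq_integral; first exact: (mF 0).
  - by apply/measurable_EFinP/measurable_funTS; apply: mPhi.
  - by apply/measurable_EFinP/measurable_funTS; apply: mPhi; exact: D_measurable.
  - have := ae_F0 (D_AC Du) (D_measurable Du) (fun x H => w_le1 (ltW (proj2 (andP H)))).
    by apply: filterS => x H /H[gE wE]; rewrite /Phi gE wE.
have k0 := ltn0Sn k.
have [iw ew] := Phi_k k0 w_measurable w_AC.
have [iu eu] := Phi_k k0 (D_measurable Du) (D_AC Du).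
have iuu : leb.-integrable (F_ k.+1) (EFin \o Phi u u).
  by apply: (integrableS _ _ _ (Phi_D Du Du)) => //; exact: mF.
have E : \int[leb]_(x in F_ k.+1) Phi w w x = \int[leb]_(x in F_ k.+1) Phi w u x.
  by rewrite ew eu !w_nat.
have : 0 <= \int[leb]_(x in F_ k.+1) (Phi w w x + Phi u u x - 2 * Phi w u x).
  apply: Rintegral_ge0 => x _.
  rewrite (_ : _ + _ - _ = (grad w x - grad u x) ^+ 2 + c ^+ 2 * (wt w x - wt u x) ^+ 2).
    by apply: addr_ge0; [|apply: mulr_ge0]; exact: sqr_ge0.
  by rewrite /Phi; ring.
have i2 : leb.-integrable (F_ k.+1) (EFin \o (fun x => 2 * Phi w u x)).
  apply: (integrableZl _ 2 iu); exact: (mF k.+1).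
have i3 : leb.-integrable (F_ k.+1) (EFin \o (fun x => Phi w w x + Phi u u x)).
  apply: (integrableD _ iw iuu); exact: (mF k.+1).
rewrite (RintegralB (mF k.+1) i3 i2) (RintegralD (mF k.+1) iw iuu) (RintegralZl _ (mF k.+1) iu) -E => H.
have {H} : \int[leb]_(x in F_ k.+1) Phi w w x <= \int[leb]_(x in F_ k.+1) Phi u u x by lra.
by rewrite -lee_fin /Rintegral !fineK// integrable_fin_num.
Qed.

Let int_Phi v : measurable_fun setT v ->
  (\int[leb]_x (Phi v v x)%:E = \sum_(0 <= k <oo) \int[leb]_(x in F_ k) (Phi v v x)%:E)%E.
Proof.
move=> mv; rewrite -cF ge0_integral_bigcup//.
- by apply/measurable_EFinP; rewrite cF; exact: mPhi.
- by move=> x _; rewrite lee_fin.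
Qed.

Lemma D_interpolant : D w.
Proof.
have H : (\int[leb]_x (Phi w w x)%:E < +oo)%E.
  apply: (@le_lt_trans _ _ (\int[leb]_x (Phi u u x)%:E)%E).
    rewrite (int_Phi w_measurable) (int_Phi (D_measurable Du)).
    apply: lee_nneseries; last by move=> k _; exact: le_Phi.
    by move=> k _ _; apply: integral_ge0 => x _; rewrite lee_fin.
  by rewrite ltey_eq (integrable_fin_num measurableT (Phi_D Du Du)).
have mW := measurable_wt w_measurable; have mG := measurable_grad w_measurable.
have mPw := mPhi w_measurable w_measurable.
apply/D_char; split => //; apply/L2P; split => //.
- have : (\int[leb]_x ((c ^+ 2)%:E * (wt w x ^+ 2)%:E) < +oo)%E.
    apply: le_lt_trans H; apply: ge0_le_integral => //.
    + by move=> x _; rewrite -EFinM lee_fin; apply: mulr_ge0; exact: sqr_ge0.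
    + by apply/measurable_EFinP; apply: measurable_funM => //; exact: measurable_funX.
    + exact/measurable_EFinP.
    + by move=> x _; rewrite -EFinM lee_fin /Phi -!expr2 lerDr sqr_ge0.
  rewrite ge0_integralZl//; last 3 first.
  + by apply/measurable_EFinP; exact: measurable_funX.
  + by move=> x _; rewrite lee_fin sqr_ge0.
  + by rewrite lee_fin sqr_ge0.
  have : (0 <= \int[leb]_x (wt w x ^+ 2)%:E)%E.
    by apply: integral_ge0 => x _; rewrite lee_fin sqr_ge0.
  case: (\int[leb]_x (wt w x ^+ 2)%:E)%E => [r _ _| |//]; first by rewrite ltry.
  by rewrite gt0_muley ?lte_fin ?exprn_gt0.
- apply: le_lt_trans H; apply: ge0_le_integral => //.
  + by move=> x _; rewrite lee_fin sqr_ge0.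
  + by apply/measurable_EFinP; exact: measurable_funX.
  + exact/measurable_EFinP.
  + by move=> x _; rewrite lee_fin /Phi -!expr2 lerDl; apply: mulr_ge0; exact: sqr_ge0.
Qed.

Lemma kerJ_interpolant : kerJ (u \- w).
Proof.
split; first exact: D_B Du D_interpolant.
- by move=> x /andP[_ x1] /=; rewrite w_le1 ?subrr// ltW.
- by move=> k k0 /=; rewrite w_nat// subrr.
Qed.

Lemma kerJ_orth_interpolant l : c ^+ 2 = 2 * l -> kerJ_orth l w.
Proof.
move=> cl; have Dw := D_interpolant; split => // z [Dz z0 zk].
have mz := D_measurable Dz.
rewrite bessel_lamE// -cl.
have -> : L2dot leb (grad w) (grad z) + c ^+ 2 * L2dot leb (wt w) (wt z) = \int[leb]_x Phi w z x.
  have i1 := ip_integrable (D_grad Dw) (D_grad Dz).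
  have i2 := ip_integrable (D_wt Dw) (D_wt Dz).
  have i3 : leb.-integrable setT (EFin \o (fun x => c ^+ 2 * (wt w x * wt z x))).
    exact: (integrableZl measurableT (c ^+ 2) i2).
  by rewrite (RintegralD measurableT i1 i3) (RintegralZl _ measurableT i2).
rewrite /Rintegral -[RHS]/(fine 0%:E); congr fine.
have := Phi_D Dw Dz; rewrite -[X in _.-integrable X]cF => iT.
rewrite -cF integral_bigcup// eseries0// => k _ _.
case: k => [|k].
  transitivity (\int[leb]_(x in F_ 0) 0)%E; last exact: integral0.
  apply: ae_eq_integral; [exact: (mF 0)| |exact: measurable_cst|].
    by apply/measurable_EFinP/measurable_funTS; apply: mPhi.
  have ACz := D_AC Dz.
  have := loc_AC_derivable mz ACz; have := ae_neq (1 : R).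
  apply: filterS2 => x xn dz; rewrite /F_ /= in_itv/= => x1; rewrite /Phi /grad /wt.
  have [x0|x0] := leP x 0; first by rewrite wI_neg// !mul0r !mulr0 addr0.
  have {}x1 : x < 1 by rewrite lt_neqAle xn.
  rewrite z0 ?x0// (@dq_right _ z (cst 0) x 1)//.
  - by rewrite derive1_cst !mulr0 addr0.
  - by move=> y /andP[xy y1]; rewrite z0// y1 (lt_le_trans x0).
have [ik ek] := Phi_k (ltn0Sn k) mz (D_AC Dz).
rewrite -[LHS]fineK; last exact: integrable_fin_num ik.
by have := ek; rewrite /Rintegral => ->; rewrite !zk// !mulr0 subrr.
Qed.

End projection.

(** The projection keeps [u] on ]0, 1] and interpolates between consecutive
    integers by the solutions of [(x^2 w')' = 2 l x^2 w]: these have the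
    least energy for their boundary values, so [w] has finite energy, and they
    are orthogonal to the functions vanishing at the integers. *)
Lemma exists_orth_proj {R : realType} (l : R) (u : R -> R) : 0 < l -> D u ->
  exists w, kerJ_orth l w /\ kerJ (u \- w).
Proof.
move=> l0 Du; pose c := Num.sqrt (2 * l).
have c0 : 0 < c by rewrite sqrtr_gt0 mulr_gt0.
have cl : c ^+ 2 = 2 * l by rewrite sqr_sqrtr// ltW// mulr_gt0.
have H k : exists AB : R * R, hE AB.1 AB.2 c k%:R = k%:R * u k%:R /\
    hE AB.1 AB.2 c k.+1%:R = k.+1%:R * u k.+1%:R.
  by apply: hE_interp => //; rewrite ltr_nat.
pose AB k := projT1 (cid (H k)).
have ABl k : (0 < k)%N -> hE (AB k).1 (AB k).2 c k%:R = k%:R * u k%:R.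
  by move=> _; rewrite /AB; case: cid => ? [].
have ABr k : (0 < k)%N -> hE (AB k).1 (AB k).2 c k.+1%:R = k.+1%:R * u k.+1%:R.
  by move=> _; rewrite /AB; case: cid => ? [].
exists (interpolant u c AB); split; first exact: kerJ_orth_interpolant.
exact: kerJ_interpolant.
Qed.

(** * The measure mu and the traces *)

Section mu_facts.
Context {R : realType} (a : nat -> {posnum R}).
Local Notation leb := (@lebesgue_measure R).
Implicit Types (x : R) (A : set R) (k n : nat).

Lemma mu_discE A : mu_disc a A = (\sum_(1 <= k <oo) (a k)%:num%:E * \d_(k%:R : R) A)%E.
Proof. by []. Qed.

Lemma mu_acE A : mu_ac A = (\int[leb]_(x in A `&` `]0%R, 1%R[) (x ^+ 2)%:E)%E.
Proof. by []. Qed.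

Lemma muE A : mu a A = (mu_ac A + mu_disc a A)%E.
Proof. exact: measure_addE. Qed.

Lemma mu_ac_fin A : measurable A -> (mu_ac A < +oo)%E.
Proof.
move=> mA; rewrite mu_acE.
have mI : measurable (A `&` `]0%R, 1%R[) by apply: measurableI => //; exact: measurable_itv.
apply: (@le_lt_trans _ _ (\int[leb]_(x in `]0%R, 1%R[) 1)%E).
  apply: (@le_trans _ _ (\int[leb]_(x in A `&` `]0%R, 1%R[) 1)%E).
    apply: ge0_le_integral => //.
    - by move=> x _; rewrite lee_fin sqr_ge0.
    - by apply/measurable_EFinP/measurable_funTS; exact: exprn_measurable.
    - move=> x [_]; rewrite /= in_itv/= => /andP[x0 x1].
      by rewrite lee_fin expr_le1// ltW.
  apply: ge0_subset_integral => //.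
rewrite integral_cst//= mul1e lebesgue_measure_itv/= lte_fin ltr01.
by rewrite -EFinB ltry.
Qed.

Lemma mu_disc_lt_fin n : (mu_disc a `]-oo, n%:R[%classic < +oo)%E.
Proof.
rewrite mu_discE (@nneseries_split _ _ 1 n) => [|k _]; last first.
  by rewrite mule_ge0// lee_fin.
rewrite eseries0 ?adde0; last first.
  move=> k nk _; rewrite diracE memNset ?mule0//= in_itv/= ltr_nat => kn.
  by move: nk; rewrite leqNgt add1n ltnS (ltnW kn).
apply/lte_sum_pinfty => k _; rewrite diracE -EFinM ltry//.
Qed.

Lemma mu_lt_fin n : (mu a `]-oo, n%:R[%classic < +oo)%E.
Proof. by rewrite muE lte_add_pinfty// ?mu_disc_lt_fin// mu_ac_fin. Qed.

Lemma mu_nat k : (0 < k)%N -> mu a [set k%:R] = (a k)%:num%:E.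
Proof.
move=> k0; rewrite muE mu_acE (_ : _ `&` _ = set0) ?integral_set0 ?add0e; last first.
  apply/seteqP; split => // x [/= ->]; rewrite in_itv/= => /andP[_].
  by rewrite ltNge ler1n k0.
rewrite mu_discE (@nneseries_split _ _ 1 k) => [|j _]; last first.
  by rewrite mule_ge0// lee_fin.
rewrite add1n eseries0 ?adde0; last first.
  move=> j kj _; rewrite diracE memNset ?mule0//= => /eqP.
  by rewrite eqr_nat => /eqP jE; move: kj; rewrite jE ltnn.
rewrite big_nat_recr//= big_nat big1 ?add0e; last first.
  move=> j /andP[_ kj]; rewrite diracE memNset ?mule0//= => /eqP.
  by rewrite eqr_nat => /eqP jE; move: kj; rewrite jE ltnn.
by rewrite diracE mem_set// mule1.
Qed.

(** F without the point 0: the part of the support that [mu] charges and that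
    lies in I. *)
Definition F_pos : set R := `]0, 1[%classic `|` [set k%:R | k in [set k : nat | (0 < k)%N]].

Lemma mu_setC_F_pos : mu a (~` F_pos) = 0%E.
Proof.
rewrite muE mu_acE (_ : _ `&` _ = set0) ?integral_set0 ?add0e; last first.
  by apply/seteqP; split => // x [] Fx x01; apply: Fx; left.
rewrite mu_discE eseries0// => k k1 _.
by rewrite diracE memNset ?mule0//; apply; right; exists k.
Qed.

Lemma measurable_F_pos : measurable F_pos.
Proof.
apply: measurableU; first exact: measurable_itv.
rewrite (_ : [set _ | _ in _] = \bigcup_(k in [set k : nat | (0 < k)%N]) [set k%:R]).
  by apply: bigcup_measurable => k _; exact: measurable_set1.
by apply/seteqP; split => x [k k0 kx]; exists k.
Qed.

Lemma mu_itv_gt0 (x e : R) : 0 < x - e -> x + e < 1 -> 0 < e ->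
  (0 < mu a `](x - e)%R, (x + e)%R[%classic)%E.
Proof.
move=> xe0 xe1 e0; rewrite muE; apply: (@lt_le_trans _ _ (mu_ac `](x - e)%R, (x + e)%R[%classic)); last by rewrite leeDl.
rewrite mu_acE (_ : _ `&` _ = `]x - e, x + e[%classic); last first.
  apply/seteqP; split; first by move=> y [].
  move=> y /= yxe; split => //; move: yxe; rewrite !in_itv/= => /andP[y1 y2].
  by rewrite (lt_trans xe0)//= (lt_trans y2).
apply: (@lt_le_trans _ _ (\int[leb]_(y in `](x - e)%R, (x + e)%R[) ((x - e) ^+ 2)%:E)%E).
  rewrite integral_cst//= lebesgue_measure_itv/= lte_fin ifT; last by lra.
  by rewrite -EFinB -EFinM lte_fin mulr_gt0 ?exprn_gt0//; lra.
apply: ge0_le_integral => //.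
- by move=> y _; rewrite lee_fin sqr_ge0.
- by apply/measurable_EFinP/measurable_funTS; exact: exprn_measurable.
- by move=> y; rewrite /= in_itv/= => /andP[y1 _]; rewrite lee_fin lerXn2r ?nnegrE//; lra.
Qed.
End mu_facts.

Local Opaque D bessel_lam.

Section trace_facts.
Context {R : realType} (a : nat -> {posnum R}).
Local Notation leb := (@lebesgue_measure R).
Implicit Types (u v w f : R -> R) (x l : R) (k n : nat).

(** For elements of the Bessel space this is both equality modulo [ker J] and
    equality [mu]-almost everywhere. *)
Definition agree_F u v := (forall x, 0 < x < 1 -> u x = v x) /\
  forall k, (0 < k)%N -> u k%:R = v k%:R.

Lemma agree_F_kerJ u v : D u -> D v -> agree_F u v <-> kerJ (u \- v).
Proof.
move=> Du Dv; split => [[H1 H2]|[_ H1 H2]].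
  split; first exact: D_B.
    by move=> x x01 /=; rewrite H1// subrr.
  by move=> k k0 /=; rewrite H2// subrr.
by split => [x /H1|k /H2] /eqP; rewrite /= subr_eq0 => /eqP.
Qed.

Lemma agree_F_ae u v : agree_F u v -> u = v %[ae mu a].
Proof.
move=> [H1 H2]; exists (~` F_pos); split.
- by apply: measurableC; exact: measurable_F_pos.
- exact: mu_setC_F_pos.
- move=> x /=; apply: contra_not => Fx _; case: Fx => [|[k k0 <-]]; last exact: H2.
  by rewrite /= in_itv/=; exact: H1.
Qed.

Lemma D_continuous u x : D u -> 0 < x -> {for x, continuous u}.
Proof.
move=> Du x0; apply: (AC_continuous_at (D_AC Du (_ : 0 < x / 2) (_ : x / 2 < x + 1))); lra.
Qed.

Lemma continuous_neq0 u x e0 : 0 < e0 -> {for x, continuous u} -> u x != 0 ->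
  exists2 e, 0 < e < e0 & forall y, x - e < y < x + e -> u y != 0.
Proof.
move=> e00 cu ux; have /nbhs_ballP[e /= e1 H] : \forall y \near x, u y != 0 by exact: (cvgr_neq0 _ cu).
exists (Num.min e (e0 / 2)).
  by rewrite lt_min e1 gt_min divr_gt0//=; apply/orP; right; lra.
move=> y xy; apply: H; rewrite /ball/= ltr_norml.
by move: xy; case: (leP e (e0 / 2)) => ? /andP[? ?]; apply/andP; split; lra.
Qed.

(** The measure [mu] charges every integer and every interval in ]0, 1[, where
    elements of the Bessel space are continuous. *)
Lemma ae_agree_F u v : D u -> D v -> u = v %[ae mu a] -> agree_F u v.
Proof.
move=> Du Dv [N [mN N0 NP]]; have Duv := D_B Du Dv.
split => [x /andP[x0 x1]|k k0]; apply/eqP; rewrite -subr_eq0; apply/negPn/negP => H.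
- have m0 : 0 < Num.min x (1 - x) by rewrite lt_min x0 subr_gt0.
  have [e /andP[e0]] := continuous_neq0 m0 (D_continuous Duv x0) H.
  rewrite lt_min => /andP[ex e1] Hy.
  have ex0 : 0 < x - e by lra.
  have ex1 : x + e < 1 by lra.
  have := @mu_itv_gt0 R a x e ex0 ex1 e0.
  rewrite -N0 ltNge => /negP; apply; apply: le_measure; rewrite ?inE//.
  move=> y /=; rewrite in_itv/= => /Hy /eqP uvy; apply: NP => /= /(_ Logic.I) uv.
  by apply: uvy => /=; rewrite uv subrr.
- have : (0 < mu a [set k%:R])%E by rewrite mu_nat// lte_fin.
  rewrite -N0 ltNge => /negP; apply; apply: le_measure; rewrite ?inE//.
  move=> y /= ->; apply: NP => /= /(_ Logic.I) uv.
  by move: H; rewrite uv subrr eqxx.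
Qed.

Lemma L2_ae u v : measurable_fun setT u -> u = v %[ae mu a] -> L2 (mu a) v -> L2 (mu a) u.
Proof.
move=> mu_ uv /L2P[mv voo]; apply/L2P; split => //; apply: le_lt_trans voo.
rewrite le_eqVlt; apply/orP; left; apply/eqP; apply: ae_eq_integral => //.
- by apply/measurable_EFinP; exact: measurable_funX.
- by apply/measurable_EFinP; exact: measurable_funX.
- by move: uv; apply: filterS => x /= /[apply] ->.
Qed.

(** A continuous function that vanishes almost everywhere vanishes. *)
Lemma bessel_lam_eq0 l u x : 0 < l -> D u -> bessel_lam l u u = 0 -> 0 < x -> u x = 0.
Proof.
move=> l0 Du; rewrite bessel_lamE// => H x0.
have W0 : L2dot leb (wt u) (wt u) = 0.
  have g0 := ip_ge0 leb (grad u); have w0 := ip_ge0 leb (wt u).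
  apply/eqP; rewrite eq_le w0 andbT -(@pmulr_rle0 _ (2 * l)) ?mulr_gt0//.
  by rewrite -[leLHS](addKr (L2dot leb (grad u) (grad u))) H addr0 oppr_le0.
have nm0 : L2norm leb (wt u) = 0 by rewrite /L2norm W0 sqrtr0.
have [N [mN N0 NP]] := nm0_ae (D_wt Du) nm0.
apply/eqP/negPn/negP => ux.
have [e /andP[e0 ex] Hy] := continuous_neq0 x0 (D_continuous Du x0) ux.
have : (0 < leb `](x - e)%R, (x + e)%R[%classic)%E.
  by rewrite lebesgue_measure_itv/= lte_fin ifT ?lte_fin; lra.
rewrite -N0 ltNge => /negP; apply; apply: le_measure; rewrite ?inE//.
move=> y /=; rewrite in_itv/= => /[dup] yxe /Hy uy; apply: NP => /= /eqP.
have y0 : 0 < y by move: yxe => /andP[? _]; lra.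
by rewrite /wt wI_pos// mulf_eq0 (gt_eqF y0)/= (negbTE uy).
Qed.

Lemma is_proj_exists l u : 0 < l -> D u -> exists w, is_proj l u w /\ kerJ (u \- w).
Proof.
move=> l0 Du; have [w [wo wk]] := exists_orth_proj l0 Du; exists w; split => //; split => //.
have [Dk _ _] := wk; move=> v [Dv vo]; rewrite (bessel_lamC l Dk Dv); exact: vo.
Qed.

(** Let [w'] be the projection found in [exists_orth_proj]. The difference
    [w - w'] is orthogonal to [ker J], hence to [u - w'], and also to
    [u - w]; so it is orthogonal to itself. *)
Lemma is_proj_agree_F l u w : 0 < l -> D u -> is_proj l u w -> agree_F u w.
Proof.
move=> l0 Du [[Dw wo] wp]; have [w' [[Dw' wo'] wk']] := exists_orth_proj l0 Du.
have Dd := D_B Dw Dw'; have Duw := D_B Du Dw; have Duw' := D_B Du Dw'.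
have dor : kerJ_orth l (w \- w').
  split; first exact: Dd.
  move=> v kv; have [Dv _ _] := kv.
  by rewrite (bessel_lamBl l Dw Dw' Dv) (wo v kv) (wo' v kv) subrr.
have d0 : bessel_lam l (w \- w') (w \- w') = 0.
  have e : w \- w' = (u \- w') \- (u \- w) by apply/funext => x /=; ring.
  rewrite {1}e (bessel_lamBl l Duw' Duw Dd) (wp _ dor) (bessel_lamC l Duw' Dd).
  by rewrite ((proj2 dor) _ wk') subrr.
have ww' x : 0 < x -> w x = w' x.
  by move=> /(bessel_lam_eq0 l0 Dd d0) /= /eqP; rewrite subr_eq0 => /eqP.
have [H1 H2] := (agree_F_kerJ Du Dw').2 wk'.
split => [x /[dup] x01 /andP[x0 _]|k k0]; first by rewrite ww'// H1.
by rewrite ww' ?ltr0n// H2.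
Qed.

(** The projection that realizes the trace energy has the same trace as the
    function it is the projection of. *)
Lemma trace_attained l f : 0 < l -> (trace_lam a l f < +oo)%E ->
  exists w, [/\ D w, w = f %[ae mu a], L2 (mu a) w & trace_lam a l f = (bessel_lam l w w)%:E].
Proof.
rewrite /trace_lam => l0; case: xgetP => [e eE|]; last by rewrite ltxx.
move=> [u [w [[Du Lu] uf pw ->]]] _; have [[Dw _] _] := pw.
have wu : w = u %[ae mu a].
  by have := agree_F_ae (is_proj_agree_F l0 Du pw); apply: filterS => x /= /[apply] ->.
exists w; split => //.
- by move: wu uf; apply: filterS2 => x /= + + _ => -> // ->.
- exact: L2_ae (D_measurable Dw) wu Lu.
Qed.

Lemma trace_ge0 l f : 0 < l -> (0 <= trace_lam a l f)%E.
Proof.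
move=> l0; case: (ltP (trace_lam a l f) +oo%E) => [/(trace_attained l0)[w [Dw _ _ ->]]|]; last first.
  by apply: le_trans; rewrite leey.
by rewrite lee_fin bessel_lam_ge0// ltW.
Qed.

(** The projection minimizes the energy among the extensions of its trace. *)
Lemma trace_le_bessel l f v : 0 < l -> D v -> L2 (mu a) v -> v = f %[ae mu a] ->
  (trace_lam a l f <= (bessel_lam l v v)%:E)%E.
Proof.
move=> l0 Dv Lv vf; rewrite /trace_lam; case: xgetP => [e eE|]; last first.
  have [w [pw _]] := is_proj_exists l0 Dv.
  by move=> /(_ (bessel_lam l w w)%:E)[]; exists v, w; split.
move=> [u [w [[Du Lu] uf pw ->]]]; have [[Dw wo] _] := pw; rewrite lee_fin.
have uv : agree_F v u.
  by apply: ae_agree_F => //; move: uf vf; apply: filterS2 => x /= + + _ => -> // ->.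
have [uw1 uw2] := is_proj_agree_F l0 Du pw.
have vw : agree_F v w.
  by case: uv => H1 H2; split => [x x01|k k0]; [rewrite H1// uw1|rewrite H2// uw2].
have kvw := (agree_F_kerJ Dv Dw).1 vw; have Dvw := D_B Dv Dw.
have ve : v = w \+ (v \- w) by apply/funext => x /=; ring.
have -> : bessel_lam l v v = bessel_lam l (w \+ (v \- w)) (w \+ (v \- w)) by rewrite -ve.
by rewrite (bessel_lam_sqrD l Dw Dvw) (wo _ kvw) mulr0 addr0 lerDl (bessel_lam_ge0 (ltW l0) Dvw).
Qed.

End trace_facts.

(** * The trace form as a Mosco limit *)

Section mosco.
Context {R : realType} (a : nat -> {posnum R}) (E : (R -> R) -> \bar R).
Context (traceE : is_trace a E).
Local Notation mu := (mu a).
Local Notation L2 := (L2 mu).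
Implicit Types (u v w f h b : R -> R) (x : R) (n : nat).

Let lam n : R := n.+1%:R^-1.
Let lam0 n : 0 < lam n. Proof. by rewrite invr_gt0. Qed.
Let lamcvg : lam n @[n --> \oo] --> 0. Proof. exact: cvg_harmonic. Qed.

Let mosco : mosco_cvg mu (fun n => trace_lam a (lam n)) E.
Proof. exact: traceE. Qed.

Lemma strong_cvg_nm (v : nat -> R -> R) f : (forall n, L2 (v n)) -> L2 f ->
  strong_cvg mu \oo v f <-> L2norm mu (v n \- f) @[n --> \oo] --> 0.
Proof. by move=> Lv Lf; apply: strong_cvgP => //; exact: nearW. Qed.

Lemma trace_form_ge0 f : L2 f -> (0 <= E f)%E.
Proof.
move=> Lf; have [f_ [_ _ H]] := mosco.2 f Lf; apply: le_trans H.
by apply: limn_esup_ge0 => n; exact: trace_ge0.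
Qed.

Lemma form_dom_fineK f : form_dom mu E f -> E f = (fine (E f))%:E.
Proof.
move=> [Lf foo]; rewrite fineK// ge0_fin_numE//; exact: trace_form_ge0.
Qed.

(** Recovery sequences can be taken in the Bessel space, with the Bessel energy
    in place of the trace energy. *)
Lemma trace_recovery h : form_dom mu E h -> exists w : nat -> R -> R,
  [/\ forall n, D (w n), forall n, L2 (w n), strong_cvg mu \oo w h &
   forall e, 0 < e -> \forall n \near \oo,
     bessel_lam n.+1%:R^-1 (w n) (w n) <= fine (E h) + e].
Proof.
move=> hE; have [Lh hoo] := hE; have [f_ [Lf fh Hsup]] := mosco.2 h Lh.
have near_le e : 0 < e -> \forall n \near \oo, (trace_lam a (lam n) (f_ n) < (fine (E h) + e)%:E)%E.
  move=> e0; apply: limn_esup_near Hsup _.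
  by rewrite {1}(form_dom_fineK hE) lte_fin ltrDl.
have [D0 L0] : D (cst (0 : R)) /\ L2 (cst (0 : R)).
  split; last exact: L20.
  have Dh0 : exists u, @D R u.
    have [n _ /(_ n (leqnn n))/= H] := near_le 1 ltr01.
    have [w [Dw _ _ _]] := trace_attained (lam0 n) (lt_trans H (ltry _)).
    by exists w.
  have [u Du] := Dh0; have := D_Z 0 Du; congr D.
  by apply/funext => x; rewrite mul0r.
have H n : exists w, [/\ D w, L2 w & (trace_lam a (lam n) (f_ n) < +oo)%E ->
    w = f_ n %[ae mu] /\ trace_lam a (lam n) (f_ n) = (bessel_lam (lam n) w w)%:E].
  case: (ltP (trace_lam a (lam n) (f_ n)) +oo%E) => foo.
    by have [w [Dw wf Lw We]] := trace_attained (lam0 n) foo; exists w.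
  by exists (cst 0); split.
pose w n := projT1 (cid (H n)).
have wP n : [/\ D (w n), L2 (w n) & (trace_lam a (lam n) (f_ n) < +oo)%E ->
    w n = f_ n %[ae mu] /\ trace_lam a (lam n) (f_ n) = (bessel_lam (lam n) (w n) (w n))%:E].
  by rewrite /w; case: cid.
have Dw n : D (w n) by case: (wP n).
have Lw n : L2 (w n) by case: (wP n).
exists w; split => //.
- apply/(strong_cvg_nm Lw Lh).
  have := (strong_cvg_nm Lf Lh).1 fh; apply: cvg_trans; apply: near_eq_cvg.
  have := near_le 1 ltr01; apply: filterS => n tn.
  have [_ _ /(_ (lt_trans tn (ltry _)))[wf _]] := wP n.
  apply: ae_nm; [exact: L2B|exact: L2B|].
  by move: wf; apply: filterS => x /= /[apply] ->.
- move=> e e0; have := near_le e e0; apply: filterS => n tn.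
  have [_ _ /(_ (lt_trans tn (ltry _)))[_ we]] := wP n.
  by move: tn; rewrite we lte_fin => /ltW.
Qed.

(** Conversely the limit form is at most the asymptotic Bessel energy of any
    strongly convergent sequence, since strong convergence implies weak
    convergence. *)
Lemma trace_upper (v : nat -> R -> R) f (M : R) : (forall n, D (v n)) -> (forall n, L2 (v n)) ->
  L2 f -> strong_cvg mu \oo v f ->
  (forall e, 0 < e -> \forall n \near \oo, bessel_lam n.+1%:R^-1 (v n) (v n) <= M + e) ->
  (E f <= M%:E)%E.
Proof.
move=> Dv Lv Lf vf HM.
have wk : weak_cvg mu v f.
  move=> g Lg; have nm0 := (strong_cvg_nm Lv Lf).1 vf.
  apply/cvgrPdist_le => e e0.
  have g1 : 0 < L2norm mu g + 1 by rewrite ltr_wpDl// nm_ge0.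
  have /cvgrPdist_le/(_ (e / (L2norm mu g + 1))) := nm0; rewrite divr_gt0// => /(_ isT).
  apply: filterS => n; rewrite sub0r normrN ger0_norm ?nm_ge0// => nmle.
  rewrite -/(L2dot mu f g) -/(L2dot mu (v n) g) distrC -ipBl//.
  apply: le_trans (ip_CS (L2B (Lv n) Lf) Lg) _.
  apply: (@le_trans _ _ (L2norm mu (v n \- f) * (L2norm mu g + 1))).
    by rewrite ler_wpM2l ?nm_ge0// lerDl.
  by rewrite -ler_pdivlMr.
apply: le_trans (mosco.1 v f Lv Lf wk) _; apply/lee_addgt0Pr => e e0.
apply: limn_einf_le_near; have := HM e e0; apply: filterS => n bn.
rewrite -EFinD; apply: (@le_trans _ _ (bessel_lam (lam n) (v n) (v n))%:E); last by rewrite lee_fin.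
by apply: (trace_le_bessel (lam0 n) (Dv n) (Lv n)); exact: aeW.
Qed.

(** Composition with a Lipschitz map is Lipschitz in norm. *)
Lemma strong_cvg_comp (phi : R -> R) (K : R) (w : nat -> R -> R) h : 0 <= K ->
  (forall x y, `|phi x - phi y| <= K * `|x - y|) -> (forall n, L2 (w n)) -> L2 h ->
  (forall n, L2 (phi \o w n)) -> L2 (phi \o h) ->
  strong_cvg mu \oo w h -> strong_cvg mu \oo (fun n => phi \o w n) (phi \o h).
Proof.
move=> K0 phiK Lw Lh Lpw Lph /(strong_cvg_nm Lw Lh) H.
apply/(strong_cvg_nm Lpw Lph).
apply: (@squeeze_cvgr _ _ _ _ (cst 0) (fun n => K * L2norm mu (w n \- h))).
- apply: nearW => n; rewrite nm_ge0/= -{1}(ger0_norm K0) -nmZ//; last exact: L2B.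
  apply: le_nm; [exact: L2B|by apply: L2Z; exact: L2B|].
  by move=> x /=; rewrite normrM (ger0_norm K0).
- exact: cvg_cst.
- by rewrite -[0 in X in _ --> X](mulr0 K); apply: cvgM => //; exact: cvg_cst.
Qed.

Lemma L2_comp (phi : R -> R) (K : R) h : 0 <= K -> phi 0 = 0 ->
  (forall x y, `|phi x - phi y| <= K * `|x - y|) -> L2 h -> L2 (phi \o h).
Proof.
move=> K0 phi0 phiK Lh; apply: (L2_le _ (L2Z K Lh)).
  apply: measurableT_comp; last exact: L2_measurable Lh.
  by apply: continuous_measurable_fun; exact: lip_continuous phiK.
by move=> x /=; rewrite normrM (ger0_norm K0); have := phiK (h x) 0; rewrite phi0 !subr0.
Qed.

(** Lipschitz maps operate on the trace form because they operate on the
    Bessel form: they are applied to a recovery sequence. *)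
Lemma trace_comp (phi : R -> R) (K : R) h : 0 <= K -> phi 0 = 0 ->
  (forall x y, `|phi x - phi y| <= K * `|x - y|) -> form_dom mu E h ->
  form_dom mu E (phi \o h) /\ (E (phi \o h) <= (K ^+ 2 * fine (E h))%:E)%E.
Proof.
move=> K0 phi0 phiK hE; have [Lh _] := hE.
have [w [Dw Lw wh HM]] := trace_recovery hE.
have Lc f : L2 f -> L2 (phi \o f) by exact: L2_comp phiK.
have le : (E (phi \o h) <= (K ^+ 2 * fine (E h))%:E)%E.
  apply: (@trace_upper (fun n => phi \o w n)).
  - by move=> n; have [] := D_comp K0 phi0 phiK (Dw n).
  - by move=> n; exact: Lc.
  - exact: Lc.
  - by apply: strong_cvg_comp phiK _ _ _ _ _ => // [n|]; exact: Lc.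
  - move=> e e0; have K1 : 0 < K ^+ 2 + 1 by rewrite ltr_wpDl// sqr_ge0.
    have := HM (e / (K ^+ 2 + 1)); rewrite divr_gt0// => /(_ isT); apply: filterS => n bn.
    have [_ /(_ (lam n) (ltW (lam0 n))) H] := D_comp K0 phi0 phiK (Dw n).
    apply: le_trans H _; apply: le_trans (ler_wpM2l (sqr_ge0 K) bn) _.
    rewrite mulrDr lerD2l mulrCA ler_piMr ?(ltW e0)// ler_pdivrMr// mul1r.
    by rewrite lerDl.
split => //; split; first exact: Lc.
by apply: le_lt_trans le _; rewrite ltry.
Qed.

Let shift_lip x y : `|Num.max (x - 1) 0 - Num.max (y - 1) 0| <= 1 * `|x - y|.
Proof.
rewrite mul1r ler_norml; case: (leP (x - 1) 0) => H1; case: (leP (y - 1) 0) => H2;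
  case: (leP 0 (x - y)) => H3; rewrite ?(ger0_norm H3) ?(ltr0_norm H3); lra.
Qed.

Let addshift_lip x y :
  `|(x + Num.max (x - 1) 0) - (y + Num.max (y - 1) 0)| <= 2 * `|x - y|.
Proof.
rewrite ler_norml; case: (leP (x - 1) 0) => H1; case: (leP (y - 1) 0) => H2;
  case: (leP 0 (x - y)) => H3; rewrite ?(ger0_norm H3) ?(ltr0_norm H3); lra.
Qed.

Let min_lip x y : `|Num.min x 1 - Num.min y 1| <= 1 * `|x - y|.
Proof.
rewrite mul1r ler_norml; case: (leP x 1) => H1; case: (leP y 1) => H2;
  case: (leP 0 (x - y)) => H3; rewrite ?(ger0_norm H3) ?(ltr0_norm H3); lra.
Qed.

(** The Markov property of the trace form, in terms of its operator: with
    [g = (b - 1)^+] the function [b - g] is the truncation of [b + g] at 1, so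
    [E (b - g) <= E (b + g)]. *)
Lemma form_op_excess b f : form_op mu E b f -> 0 <= L2dot mu f (excess b).
Proof.
move=> [bE Lf bf].
have s0 : Num.max (0 - 1) 0 = 0 :> R by rewrite max_r// sub0r oppr_le0.
have [ppE _] := @trace_comp (fun s => Num.max (s - 1) 0) 1 b ler01 s0 shift_lip bE.
rewrite /L2dot -(bf _ ppE) /polar divr_ge0// subr_ge0.
have a0 : 0 + Num.max (0 - 1) 0 = 0 :> R by rewrite s0 addr0.
have [bpE _] := @trace_comp (fun s => s + Num.max (s - 1) 0) 2 b (ler0n R 2) a0 addshift_lip bE.
have m0 : Num.min 0 1 = 0 :> R by rewrite min_l.
have [bmE] := @trace_comp (fun s => Num.min s 1) 1 _ ler01 m0 min_lip bpE.
have e : (fun s => Num.min s 1) \o ((fun s => s + Num.max (s - 1) 0) \o b) = b \- excess b.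
  apply/funext => x; rewrite /excess /=.
  by case: (leP (b x - 1) 0) => H; case: leP => H'; lra.
by move: bmE; rewrite e => bmE; rewrite (form_dom_fineK bmE) lee_fin expr1n mul1r.
Qed.

End mosco.

(** * Harmonic cutoffs *)

Section cutoffs.
Context {R : realType} (k : nat) (k0 : (0 < k)%N).
Local Notation leb := (@lebesgue_measure R).
Implicit Types (x y b : R) (w : R -> R).
Local Notation c := (k%:R * k.+1%:R : R).

(** Equal to 1 up to [k], to 0 from [k + 1] on, and to the harmonic function
    [k (k + 1) / x - k] in between. *)
Definition cutoff x : R := Num.max (c * (Num.max x k%:R)^-1 - k%:R) 0.
Local Notation X := cutoff.

Let k1 : (1 : R) <= k%:R. Proof. by rewrite ler1n. Qed.
Let kp : (0 : R) < k%:R. Proof. by rewrite ltr0n. Qed.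
Let kn0 : (k%:R : R) != 0. Proof. by rewrite gt_eqF. Qed.
Let kk : (k%:R : R) < k.+1%:R. Proof. by rewrite ltr_nat. Qed.
Let kS : (k.+1%:R : R) = k%:R + 1. Proof. by rewrite -natr1. Qed.
Let c0 : 0 < c. Proof. by rewrite mulr_gt0. Qed.

Lemma cutoff_le x : x <= k%:R -> X x = 1.
Proof. by move=> xk; rewrite /X (max_r xk) mulrAC divff// mul1r kS addrC addKr max_l. Qed.

Lemma cutoff_mid x : k%:R <= x <= k.+1%:R -> X x = c * x^-1 - k%:R.
Proof.
move=> /andP[kx xk]; rewrite /X (max_l kx) max_l// subr_ge0.
have x0 := lt_le_trans kp kx.
by rewrite ler_pdivlMr// ler_wpM2l// ltW.
Qed.

Lemma cutoff_ge x : k.+1%:R <= x -> X x = 0.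
Proof.
move=> kx; have kx' := le_trans (ltW kk) kx; have x0 := lt_le_trans kp kx'.
rewrite /X (max_l kx') max_r// subr_le0.
by rewrite ler_pdivrMr// ler_wpM2l// ltW.
Qed.

Lemma cutoff01 x : 0 <= X x <= 1.
Proof.
case: (leP x k%:R) => [/cutoff_le ->|kx]; first by rewrite ler01 lexx.
have x0 := lt_trans kp kx.
rewrite /X le_max lexx orbT/= ge_max ler01 andbT lerBlDr addrC -kS (max_l (ltW kx)).
by rewrite ler_pdivrMr// mulrC ler_wpM2l// ltW.
Qed.

Lemma measurable_cutoff : measurable_fun setT X.
Proof.
apply: measurable_maxr => //; apply: measurable_funB => //.
by apply: measurable_funM => //; exact: measurable_maxV.
Qed.

Lemma AC_cutoff a b : abs_cont_itv a b X.
Proof.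
have lip x y : `|Num.max (c * x - k%:R) 0 - Num.max (c * y - k%:R) 0| <= c * `|x - y|.
  rewrite -{3}(gtr0_norm c0) -normrM mulrBr.
  move: (c * x) (c * y) => s t.
  rewrite ler_norml; case: (leP (s - k%:R) 0) => H1; case: (leP (t - k%:R) 0) => H2;
  case: (leP 0 (s - t)) => H3; rewrite ?(ger0_norm H3) ?(ltr0_norm H3); lra.
have ACV : abs_cont_itv a b (fun x => (Num.max x k%:R)^-1).
  apply: (@AC_lip _ _ _ 1) => // x y _ xy _; rewrite mul1r.
  have s0 : 0 < Num.max x k%:R by rewrite lt_max kp orbT.
  have t0 : 0 < Num.max y k%:R by rewrite lt_max kp orbT.
  have -> : (Num.max y k%:R)^-1 - (Num.max x k%:R)^-1 =
      (Num.max x k%:R - Num.max y k%:R) * ((Num.max x k%:R)^-1 * (Num.max y k%:R)^-1).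
    by field; rewrite !gt_eqF.
  rewrite normrM.
  apply: (@le_trans _ _ (`|Num.max x k%:R - Num.max y k%:R| * 1)).
    rewrite ler_wpM2l// normrM !gtr0_norm ?invr_gt0// mulr_ile1 ?invr_ge0 ?(ltW s0) ?(ltW t0)//.
      by rewrite invf_le1// le_max k1 orbT.
    by rewrite invf_le1// le_max k1 orbT.
  rewrite mulr1 ler_norml; case: (leP x k%:R) => ?; case: (leP y k%:R) => ?; lra.
exact: (AC_comp_lip (ltW c0) lip ACV).
Qed.

Lemma grad_cutoff x : grad X x = - c * (Num.max x k%:R)^-1 * \1_(`[k%:R, k.+1%:R[) x.
Proof.
rewrite /grad indicE; have [xk|kx] := ltP x k%:R.
  rewrite memNset ?mulr0; last by rewrite /= in_itv/= leNgt xk.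
  have [x0|x0] := leP x 0; first by rewrite wI_neg// mul0r.
  rewrite (@dq_right _ X (cst 1) x k%:R)// ?derive1_cst ?mulr0//.
  by move=> y /andP[_ yk]; rewrite cutoff_le// ltW.
have x0 := lt_le_trans kp kx; have xn0 : x != 0 by rewrite gt_eqF.
have [xk|kx'] := ltP x k.+1%:R; last first.
  rewrite memNset ?mulr0; last by rewrite /= in_itv/= kx ltNge kx'.
  rewrite (@dq_right _ X (cst 0) x (x + 1))// ?derive1_cst ?mulr0// ?ltrDl//.
  by move=> y /andP[xy _]; rewrite cutoff_ge// (le_trans kx').
rewrite mem_set ?mulr1; last by rewrite /= in_itv/= kx.
have h : is_derive x 1 (fun y : R => c * y^-1 - k%:R) (c * (- x ^- 2) - 0).
  have hV : is_derive x 1 (fun y : R => y^-1) (- x ^- 2).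
    by apply: DeriveDef; [exact: derivable_invx|rewrite -derive1E derive1_invx].
  have h0 : is_derive x 1 (cst (k%:R : R)) 0 by exact: is_derive_cst.
  exact: (is_deriveB (is_deriveZ c hV) h0).
rewrite (@dq_right _ X (fun y => c * y^-1 - k%:R) x k.+1%:R)//.
- rewrite derive1E; case: h => _ ->; rewrite wI_pos//.
  by rewrite subr0; field.
- by move=> y /andP[xy yk]; rewrite cutoff_mid// (le_trans kx xy) ltW.
Qed.

Lemma D_cutoff : D X.
Proof.
apply/D_char; split.
- by move=> a b _ _; exact: AC_cutoff.
- exact: measurable_cutoff.
- have L := L2Z k.+1%:R (@L2_indic_itv R `[0, k.+1%:R] ltac:(by rewrite lebesgue_measure_itv/= lte_fin ltr0n/= ltry)).
  apply: (@L2_le _ _ R leb _ _ (measurable_wt measurable_cutoff) L) => x.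
  rewrite /wt; have [x0|x0] := leP x 0; first by rewrite wI_neg// mul0r normr0.
  have [kx|xk] := leP k.+1%:R x; first by rewrite cutoff_ge// mulr0 normr0.
  rewrite indicE mem_set ?mulr1; last by rewrite /= in_itv/= !ltW.
  have /andP[X0 X1] := cutoff01 x.
  rewrite wI_pos// normrM (gtr0_norm x0) (ger0_norm X0) ger0_norm//.
  by rewrite -[leRHS]mulr1 ler_pM// ltW.
- have L := L2Z c (@L2_indic_itv R `[k%:R, k.+1%:R[ ltac:(by rewrite lebesgue_measure_itv/= lte_fin kk ltry)).
  apply: (@L2_le _ _ R leb _ _ (measurable_grad measurable_cutoff) L) => x.
  rewrite grad_cutoff -mulrA mulNr normrN [leLHS](normrM c) [leRHS](normrM c) ler_wpM2l// normrM ler_piMl//.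
  have M0 : 0 < Num.max x k%:R by rewrite lt_max kp orbT.
  by rewrite gtr0_norm ?invr_gt0// invf_le1// le_max k1 orbT.
Qed.

(** The flux [x^2 cutoff'] is the constant [- k (k + 1)] on
    [[k, k + 1]] and 0 elsewhere, so the Bessel form tests a function
    against the cutoff by a difference of two values. *)
Lemma ip_grad_cutoff w : D w -> L2dot leb (grad w) (grad X) = c * (w k%:R - w k.+1%:R).
Proof.
move=> Dw; have mw := D_measurable Dw.
have [_ intg FTC] := AC_FTC mw kk (D_AC Dw kp kk).
transitivity (\int[leb]_x (- c * dq w x * \1_(`]k%:R, k.+1%:R]) x)).
  rewrite /L2dot /Rintegral; congr fine; apply: ae_eq_integral => //.
  - apply/measurable_EFinP/measurable_funM; apply: measurable_grad => //.
    exact: measurable_cutoff.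
  - apply/measurable_EFinP; apply: measurable_funM; last exact: measurable_indic.
    by apply: measurable_funM => //; exact: measurable_dq.
  - have n1 := @ae_neq R k%:R; have n2 := @ae_neq R k.+1%:R.
    move: n1 n2; apply: filterS2 => x xk xk' _; congr EFin.
      rewrite grad_cutoff !indicE /grad.
      case: (boolP (x < k%:R)) => [xlt|]; last rewrite -leNgt => kx.
        rewrite !memNset ?mulr0//= in_itv/= ?(ltNge k%:R x) ?(ltW xlt)//=.
        by rewrite leNgt xlt.
      case: (boolP (x < k.+1%:R)) => [xlt|]; last first.
        rewrite -leNgt => kx'.
        have o1 : ~ `[k%:R, k.+1%:R[%classic x by rewrite /= in_itv/= ltNge kx' andbF.
        have o2 : ~ `]k%:R, k.+1%:R]%classic x.
          by rewrite /= in_itv/= => /andP[_ H]; move: xk'; rewrite eq_le H kx'.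
        by rewrite (memNset o1) (memNset o2) !mulr0.
      rewrite !mem_set /= ?in_itv/= ?kx ?xlt ?(ltW xlt) ?andbT//; last by rewrite lt_neqAle eq_sym xk.
      have x0 := lt_le_trans kp kx; have xn0 : x != 0 by rewrite gt_eqF.
      by rewrite wI_pos// (max_l kx); field.
transitivity (- c * (w k.+1%:R - w k%:R)); last by ring.
rewrite (FTC _ _ (lexx _) (ltW kk) (lexx _)) -RintegralZl// [RHS]Rintegral_mkcond.
apply: eq_Rintegral => x _; rewrite patchE indicE; case: ifP => _; first by rewrite mulr1.
by rewrite mulr0.
Qed.

Lemma L2_cutoff (a : nat -> {posnum R}) : L2 (mu a) X.
Proof.
apply/L2P; split; first exact: measurable_cutoff.
apply: (@le_lt_trans _ _ (\int[mu a]_x (\1_(`]-oo, k.+1%:R[%classic) x)%:E)%E); last first.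
  by rewrite integral_indic// setIT mu_lt_fin.
apply: ge0_le_integral => //.
- by move=> x _; rewrite lee_fin sqr_ge0.
- by apply/measurable_EFinP/measurable_funX; exact: measurable_cutoff.
- by apply/measurable_EFinP; exact: measurable_indic.
- move=> x _; rewrite lee_fin indicE; have [kx|xk] := leP k.+1%:R x.
    by rewrite cutoff_ge// expr0n.
  rewrite mem_set; last by rewrite /= in_itv.
  by have /andP[X0 X1] := cutoff01 x; rewrite expr_le1.
Qed.

End cutoffs.

(** * The operator of the trace form on cutoffs *)

Section cutoff_form.
Context {R : realType} (a : nat -> {posnum R}) (E : (R -> R) -> \bar R).
Context (traceE : is_trace a E).
Local Notation mu := (mu a).
Local Notation L2 := (L2 mu).
Local Notation leb := (@lebesgue_measure R).
Implicit Types (u v w f h b : R -> R) (x s e K : R) (n j k : nat).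

Local Notation pt j := (\1_[set j%:R] : R -> R).

Let pt_sqr j x : pt j x * pt j x = pt j x.
Proof. by rewrite indicE; case: (_ \in _); rewrite ?mul0r ?mul1r. Qed.

Let integral_pt j : (0 < j)%N -> (\int[mu]_x (pt j x)%:E = (a j)%:num%:E)%E.
Proof.
by move=> j0; rewrite integral_indic ?setIT ?mu_nat//; exact: measurable_set1.
Qed.

Lemma L2_pt j : (0 < j)%N -> L2 (pt j).
Proof.
move=> j0; apply/L2P; split; first by apply: measurable_indic; exact: measurable_set1.
by under eq_integral do rewrite expr2 pt_sqr; rewrite integral_pt// ltry.
Qed.

Lemma ip_pt j h : (0 < j)%N -> L2dot mu (pt j) h = (a j)%:num * h j%:R.
Proof.
move=> j0; have Lj := L2_pt j0.
transitivity (L2dot mu (fun x => h j%:R * pt j x) (pt j)).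
  apply: eq_Rintegral => x _; rewrite -mulrA pt_sqr indicE.
  case: (boolP (x \in [set j%:R])); last by rewrite mul0r mulr0.
  by rewrite inE => ->; rewrite mulrC.
rewrite (ipZl _ Lj Lj) mulrC; congr (_ * _).
rewrite /L2dot /Rintegral; under eq_integral do rewrite pt_sqr.
by rewrite integral_pt.
Qed.

Lemma near_harmonic K e : 0 < e -> \forall n \near \oo, K * n.+1%:R^-1 <= e.
Proof.
move=> e0; have c : K * n.+1%:R^-1 @[n --> \oo] --> 0.
  by rewrite -[0 in X in _ --> X](mulr0 K); apply: cvgM; [exact: cvg_cst|exact: cvg_harmonic].
exact: (cvgr_le _ c _ e0).
Qed.

Section one_cutoff.
Context (k : nat) (k0 : (0 < k)%N).
Local Notation c := (k%:R * k.+1%:R : R).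
Local Notation X := (@cutoff R k).

(** The value of the operator of the trace form at the cutoff, by
    [cutoff_form_op]. *)
Definition cutoff_op x := c * (pt k x / (a k)%:num - pt k.+1 x / (a k.+1)%:num).
Local Notation g := cutoff_op.

Lemma cutoff_opE : g = fun x => c / (a k)%:num * pt k x - c / (a k.+1)%:num * pt k.+1 x.
Proof. by apply/funext => x; rewrite /g; ring. Qed.

Lemma L2_cutoff_op : L2 g.
Proof.
rewrite cutoff_opE; apply: L2B; apply: L2Z; exact: L2_pt.
Qed.

Lemma ip_cutoff_op h : L2 h -> L2dot mu g h = c * (h k%:R - h k.+1%:R).
Proof.
move=> Lh; have L1 := L2_pt k0; have L2' := L2_pt (ltn0Sn k).
rewrite cutoff_opE (ipBl (L2Z _ L1) (L2Z _ L2') Lh) (ipZl _ L1 Lh) (ipZl _ L2' Lh) !ip_pt//.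
by field; rewrite !gt_eqF.
Qed.

Let X_k : X k%:R = 1. Proof. exact: cutoff_le. Qed.
Let X_kS : X k.+1%:R = 0. Proof. exact: cutoff_ge. Qed.
Let DX : D X := D_cutoff k0.
Let LX : L2 X := L2_cutoff k0 a.

Let energy_expand l w s : D w -> bessel_lam l (w \+ (fun x => s * X x)) (w \+ (fun x => s * X x)) =
  bessel_lam l w w + 2 * s * (c * (w k%:R - w k.+1%:R)) + s ^+ 2 * c +
  2 * l * (2 * s * L2dot leb (wt w) (wt X) + s ^+ 2 * L2dot leb (wt X) (wt X)).
Proof.
move=> Dw; have DsX := D_Z s DX.
rewrite (bessel_lam_sqrD l Dw DsX) (bessel_lamC l Dw DsX) (bessel_lamZl l s DX Dw).
rewrite (bessel_lamZl l s DX DsX) (bessel_lamC l DX DsX) (bessel_lamZl l s DX DX).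
rewrite (bessel_lamC l DX Dw) (bessel_lamE l Dw DX) (bessel_lamE l DX DX).
rewrite (ip_grad_cutoff k0 Dw) (ip_grad_cutoff k0 DX) X_k X_kS.
move: (bessel_lam l w w) (L2dot leb (wt w) (wt X)) (L2dot leb (wt X) (wt X)) (w k%:R) (w k.+1%:R) => A B C p q.
by ring.
Qed.

(* Young's inequality, with which the cross term of the mass is absorbed into a
   small multiple of the mass of [w]. *)
Let cross_bound (del p nw nX s : R) : 0 < del -> 0 <= nw -> 0 <= nX -> `|p| <= nw * nX ->
  2 * s * p <= del * nw ^+ 2 + s ^+ 2 * nX ^+ 2 / del.
Proof.
move=> d0 w0 X0 ple.
apply: (@le_trans _ _ (2 * (`|s| * nw * nX))).
  apply: le_trans (ler_norm _) _; rewrite -mulrA normrM ger0_norm// ler_wpM2l//.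
  by rewrite normrM -mulrA ler_wpM2l.
rewrite -subr_ge0 -[s ^+ 2]real_normK ?num_real//.
have -> : del * nw ^+ 2 + `|s| ^+ 2 * nX ^+ 2 / del - 2 * (`|s| * nw * nX) =
   (del * nw - `|s| * nX) ^+ 2 / del by field; rewrite gt_eqF.
by rewrite divr_ge0 ?sqr_ge0// ltW.
Qed.

(** If [w n] is a recovery sequence of [h] then [w n + s cutoff] is a
    test sequence for [h + s cutoff]. In its Bessel energy, a quadratic
    polynomial in [s], the constant term is asymptotically at most the energy
    of [h], and the other coefficients converge because the mass terms vanish
    in the limit. *)
Lemma trace_add_cutoff_le h s : form_dom mu E h ->
  form_dom mu E (h \+ (fun x => s * X x)) /\
  fine (E (h \+ (fun x => s * X x))) <=
    fine (E h) + 2 * s * (c * (h k%:R - h k.+1%:R)) + s ^+ 2 * c.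
Proof.
move=> hE; have [Lh _] := hE; have [w [Dw Lw wh HM]] := trace_recovery traceE hE.
set M := fine (E h).
have M0 : 0 <= M by rewrite fine_ge0// (trace_form_ge0 traceE).
have LsX := L2Z s LX; have DsX := D_Z s DX.
have Lhs : L2 (h \+ (fun x => s * X x)) by exact: (L2D Lh LsX).
have wh0 := (strong_cvg_nm Lw Lh).1 wh.
pose B := M + 2 * s * (c * (h k%:R - h k.+1%:R)) + s ^+ 2 * c.
pose hs x := h x + s * X x.
have H : (E hs <= B%:E)%E.
  apply: (trace_upper traceE (v := fun n => w n \+ (fun x => s * X x))).
  - by move=> n; exact: (D_D (Dw n) DsX).
  - by move=> n; exact: (L2D (Lw n) LsX).
  - exact: Lhs.
  - have Lws n : L2 (w n \+ (fun x => s * X x)) by exact: (L2D (Lw n) LsX).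
    apply/(strong_cvg_nm Lws Lhs); apply: cvg_trans wh0; apply: near_eq_cvg.
    apply: nearW => n; congr L2norm; apply/funext => x /=; ring.
  - move=> e e0; have e4 : 0 < e / 4 by rewrite divr_gt0.
    pose G := L2norm mu g; have G0 : 0 <= G by exact: nm_ge0.
    (* With this [del] the share of the mass of [w n], which is at most [M + 1],
       is [e / 4]. *)
    pose N := L2norm leb (wt X); pose del := e / 4 / (M + 1).
    have M1 : 0 < M + 1 by rewrite ltr_wpDl.
    have d0 : 0 < del by rewrite divr_gt0.
    have s1 : 0 < 2 * `|s| * (G + 1) + 1.
      by rewrite ltr_wpDl// mulr_ge0// ?mulr_ge0// ltW// ltr_wpDl.
    have A := HM _ e4; have A1 := HM _ ltr01.
    have C : \forall n \near \oo, L2norm mu (w n \- h) <= e / 4 / (2 * `|s| * (G + 1) + 1).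
      by apply: (cvgr_le _ wh0 _); rewrite divr_gt0.
    have F := near_harmonic (2 * (s ^+ 2 * N ^+ 2 / del + s ^+ 2 * N ^+ 2)) e4.
    near=> n.
    have An : bessel_lam n.+1%:R^-1 (w n) (w n) <= M + e / 4 by near: n; exact: A.
    have Bn : bessel_lam n.+1%:R^-1 (w n) (w n) <= M + 1 by near: n; exact: A1.
    have Cn : L2norm mu (w n \- h) <= e / 4 / (2 * `|s| * (G + 1) + 1) by near: n; exact: C.
    have Fn : 2 * (s ^+ 2 * N ^+ 2 / del + s ^+ 2 * N ^+ 2) * n.+1%:R^-1 <= e / 4.
      by near: n; exact: F.
    rewrite (energy_expand n.+1%:R^-1 s (Dw n)).
    have l0 : 0 < n.+1%:R^-1 :> R by rewrite invr_gt0.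
    rewrite /B; move: An Bn Fn l0; move: (n.+1%:R^-1 : R) => l An Bn Fn l0.
    have val : 2 * s * (c * (w n k%:R - w n k.+1%:R)) <=
        2 * s * (c * (h k%:R - h k.+1%:R)) + e / 4.
      rewrite -lerBlDl -mulrBr -!ip_cutoff_op// -ipBr//; last exact: L2_cutoff_op.
      apply: le_trans (ler_norm _) _; rewrite normrM normrM ger0_norm//.
      apply: (@le_trans _ _ (2 * `|s| * (G * L2norm mu (w n \- h)))).
        by rewrite ler_wpM2l ?mulr_ge0// ip_CS//; [exact: L2_cutoff_op|exact: L2B].
      have nm0 := nm_ge0 mu (w n \- h).
      apply: (@le_trans _ _ ((2 * `|s| * (G + 1) + 1) * L2norm mu (w n \- h))).
        rewrite mulrA ler_wpM2r//.
        by have := normr_ge0 s; nra.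
      by rewrite mulrC -ler_pdivlMr.
    have wle : 2 * l * L2norm leb (wt (w n)) ^+ 2 <= M + 1.
      rewrite (nm_sqr leb (wt (w n))); apply: le_trans Bn.
      by rewrite (bessel_lamE l (Dw n) (Dw n)) lerDr ip_ge0.
    have cr : 2 * s * L2dot leb (wt (w n)) (wt X) <=
        del * L2norm leb (wt (w n)) ^+ 2 + s ^+ 2 * N ^+ 2 / del.
      apply: cross_bound; [exact: d0|exact: nm_ge0|exact: nm_ge0|].
      exact: (ip_CS (D_wt (Dw n)) (D_wt DX)).
    rewrite -(nm_sqr leb (wt X)) -/N.
    have l2 : 0 <= 2 * l by rewrite mulr_ge0// ltW.
    have := ler_wpM2l l2 cr.
    have dw : del * (2 * l * L2norm leb (wt (w n)) ^+ 2) <= e / 4.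
      by apply: le_trans (ler_wpM2l (ltW d0) wle) _; rewrite /del divfK// gt_eqF.
    move: dw An val Fn.
    move: (L2norm leb (wt (w n)) ^+ 2) (s ^+ 2 * N ^+ 2 / del) (s ^+ 2 * N ^+ 2).
    move: (2 * s * L2dot leb (wt (w n)) (wt X)) (bessel_lam l (w n) (w n)).
    move: (2 * s * (c * (w n k%:R - w n k.+1%:R))) (2 * s * (c * (h k%:R - h k.+1%:R))).
    move: (s ^+ 2 * c) => t1 t2 t3 t4 t5 t6 t7 t8 h1 h2 h3 h4 h5.
    have e6 : del * (2 * l * t6) = 2 * l * (del * t6) by ring.
    have e7 : 2 * l * (t4 + t8) = 2 * l * t4 + 2 * l * t8 by ring.
    have e8 : 2 * l * (del * t6 + t7) = 2 * l * (del * t6) + 2 * l * t7 by ring.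
    have e9 : 2 * (t7 + t8) * l = 2 * l * t7 + 2 * l * t8 by ring.
    lra.
have sE : form_dom mu E (h \+ (fun x => s * X x)).
  by split => //; apply: le_lt_trans H _; rewrite ltry.
by split => //; rewrite -lee_fin -(form_dom_fineK traceE sE).
Unshelve. all: by end_near. Qed.

(** The reverse inequality is [trace_add_cutoff_le] for [h + s cutoff] and
    [- s]. *)
Lemma trace_add_cutoff h s : form_dom mu E h ->
  fine (E (h \+ (fun x => s * X x))) =
    fine (E h) + 2 * s * (c * (h k%:R - h k.+1%:R)) + s ^+ 2 * c.
Proof.
move=> hE; have [sE le1] := trace_add_cutoff_le s hE.
apply/eqP; rewrite eq_le le1/=.
have [_] := trace_add_cutoff_le (- s) sE.
have -> : (h \+ (fun x => s * X x)) \+ (fun x => - s * X x) = h.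
  by apply/funext => x /=; rewrite mulNr addrK.
rewrite /= X_k X_kS mulr1 mulr0 addr0 sqrrN.
move: (fine (E h)) (fine (E _)) (h k%:R) (h k.+1%:R) => p q r t H.
have e1 : 2 * - s * (c * (r + s - t)) = - (2 * s * (c * (r - t))) - 2 * (s ^+ 2 * c) by ring.
lra.
Qed.

(** Polarization of [trace_add_cutoff]. *)
Lemma cutoff_form_op : form_op mu E X g.
Proof.
have cst0 : form_dom mu E (cst 0).
  split; first exact: L20.
  apply: (@le_lt_trans _ _ 0%:E); last by rewrite ltry.
  have D0 : D (cst (0 : R)) by have := D_Z 0 DX; congr D; apply/funext => x; rewrite mul0r.
  have L0 : L2 (cst 0) by exact: L20.
  apply: (trace_upper traceE (v := fun=> cst 0)) => //.
    apply/(strong_cvg_nm (fun=> L0) L0).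
    rewrite (ae_nmB0 L0 L0); first exact: cvg_cst.
    exact: aeW.
  move=> e e0; apply: nearW => n; rewrite add0r bessel_lamE//.
  have -> : wt (cst (0 : R)) = cst 0 by apply/funext => x; rewrite /wt/= mulr0.
  have -> : grad (cst (0 : R)) = cst 0.
    apply/funext => x; rewrite /grad (derivable_dq (derivable_cst _ _ _)).
    by rewrite derive1_cst mulr0.
  have -> : L2dot leb (cst 0) (cst 0) = 0.
    by rewrite /L2dot; under eq_Rintegral do rewrite /= mul0r; rewrite /Rintegral integral0.
  by rewrite mulr0 addr0 ltW.
have XE : form_dom mu E X.
  have [+ _] := trace_add_cutoff_le 1 cst0; congr form_dom.
  by apply/funext => x /=; rewrite add0r mul1r.
split => //; first exact: L2_cutoff_op.
move=> h hE; have [Lh _] := hE; rewrite -[RHS]/(L2dot mu g h) ip_cutoff_op// /polar.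
have -> : X \+ h = h \+ (fun x => 1 * X x) by apply/funext => x /=; rewrite mul1r addrC.
have -> : fine (E (X \- h)) = fine (E (h \+ (fun x => - 1 * X x))).
  have [mE _] := trace_add_cutoff_le (-1) hE.
  have opp_lip x y : `|- x - (- y)| <= 1 * `|x - y| :> R.
    by rewrite mul1r -opprD normrN.
  have o0 : - 0 = 0 :> R by rewrite oppr0.
  have [pE le1] := trace_comp traceE ler01 o0 opp_lip mE.
  have [_ le2] := trace_comp traceE ler01 o0 opp_lip pE.
  move: pE le1 le2.
  have -> : -%R \o (h \+ (fun x => - 1 * X x)) = X \- h.
    by apply/funext => x /=; rewrite mulN1r opprD opprK addrC.
  have -> : -%R \o (X \- h) = h \+ (fun x => - 1 * X x).
    by apply/funext => x /=; rewrite mulN1r opprB addrC.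
  move=> pE; rewrite (form_dom_fineK traceE pE) (form_dom_fineK traceE mE) !lee_fin/= expr1n !mul1r.
  by move=> le1 le2; apply/eqP; rewrite eq_le le1.
rewrite !trace_add_cutoff//.
by field.
Qed.

End one_cutoff.
End cutoff_form.

(** * Conservativeness of the trace form *)

Section conclusion.
Context {R : realType} (a : nat -> {posnum R}) (E : (R -> R) -> \bar R).
Context (P : R -> (R -> R) -> R -> R).
Context (traceE : is_trace a E) (sgP : semigroup_of (mu a) E P).
Local Notation mu := (mu a).
Local Notation L2 := (L2 mu).
Implicit Types (u v w f h b : R -> R) (x s e K : R) (n j k m : nat).

Let form_gen f g : L2 f -> L2 g -> form_op mu E f g <-> gen mu P f g.
Proof. exact: sgP.2. Qed.

Lemma L2_cst1 : (mu_disc a F < +oo)%E -> L2 (cst 1).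
Proof.
move=> Foo; apply/L2P; split; first exact: measurable_cst.
under eq_integral do rewrite /= expr1n.
rewrite integral_cst// mul1e muE lte_add_pinfty// ?mu_ac_fin//.
rewrite (_ : mu_disc a setT = mu_disc a F)//.
rewrite !mu_discE; apply: eq_eseriesr => k _; rewrite !diracE !mem_set//.
by case: k => [|k]; [left; rewrite /= in_itv/= lexx ler01|right; exists k.+1].
Qed.

(** If the semigroup fixes 1 then 1 has energy zero, so it is the limit of
    functions of Bessel energy tending to 0; by [D_at1_sqr_le] their values at
    1 tend to 0, although the atom of [mu] at 1 forces them to tend to 1. *)
Lemma not_conservative : (mu_disc a F < +oo)%E -> ~ conservative mu P.
Proof.
move=> /L2_cst1 L1 cons.
have /(form_gen L1 (L20 mu))[oneE _ pol] := conservative_gen1 sgP.1 L1 cons.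
have two_lip (c : R) (x y : R) : 0 <= c -> `|c * x - c * y| <= c * `|x - y|.
  by move=> c0; rewrite -mulrBr normrM ger0_norm.
have [twoE _] := trace_comp traceE (ler0n R 2) (mulr0 2) (fun x y => two_lip 2 x y (ler0n R 2)) oneE.
have h0 : (0 : R) <= 2^-1 by rewrite invr_ge0.
have [_ le_half] := trace_comp traceE h0 (mulr0 _) (fun x y => two_lip _ x y h0) twoE.
have [_ le0] := trace_comp traceE (lexx 0) (mulr0 0) (fun x y => two_lip 0 x y (lexx 0)) oneE.
have E1 : fine (E (cst 1)) <= 0.
  have := pol _ oneE.
  rewrite (_ : \int[mu]_x _ = 0); last first.
    by under eq_Rintegral do rewrite /= mul0r; rewrite /Rintegral integral0.
  rewrite /polar (_ : cst 1 \+ cst 1 = *%R 2 \o cst 1); last first.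
    by apply/funext => x /=; ring.
  rewrite (_ : cst 1 \- cst 1 = *%R 0 \o cst 1); last first.
    by apply/funext => x /=; rewrite mul0r subrr.
  rewrite expr0n mul0r in le0.
  have zE : form_dom mu E ( *%R 0 \o cst 1).
    have -> : *%R 0 \o cst 1 = (cst 0 : R -> R) by apply/funext => x /=; rewrite mul0r.
    split; first exact: L20.
    have <- : *%R 0 \o cst 1 = (cst 0 : R -> R) by apply/funext => x /=; rewrite mul0r.
    by apply: le_lt_trans le0 _; rewrite ltry.
  rewrite (form_dom_fineK traceE zE) lee_fin in le0.
  have e : *%R 2^-1 \o ( *%R 2 \o cst 1) = (cst 1 : R -> R).
    by apply/funext => x /=; rewrite mulr1 mulVf.
  rewrite e (form_dom_fineK traceE oneE) lee_fin in le_half.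
  move: le_half le0; move: (fine _) (fine _) (fine _) => p q r H1 H2 H3.
  have e4 : 2^-1 ^+ 2 = 4^-1 :> R by field.
  rewrite e4 in H1.
  lra.
have [w [Dw Lw wh HM]] := trace_recovery traceE oneE.
have wh0 := (strong_cvg_nm Lw L1).1 wh.
pose p1 : R -> R := \1_[set 1%:R].
have Lp : L2 p1 := L2_pt a (ltn0Sn 0).
have N0 := nm_ge0 mu p1.
have N1 : 0 < L2norm mu p1 + 1 by rewrite ltr_wpDl.
have e16 : (0 : R) < 16^-1 by rewrite invr_gt0.
have d0 : 0 < (a 1)%:num / 2 / (L2norm mu p1 + 1) by rewrite !divr_gt0.
have A := HM _ e16.
have B : \forall n \near \oo, L2norm mu (w n \- cst 1) <= (a 1)%:num / 2 / (L2norm mu p1 + 1).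
  exact: (cvgr_le _ wh0 _ d0).
have [n [An Bn]] : exists n, bessel_lam n.+1%:R^-1 (w n) (w n) <= fine (E (cst 1)) + 16^-1 /\
    L2norm mu (w n \- cst 1) <= (a 1)%:num / 2 / (L2norm mu p1 + 1).
  by near \oo => n; exists n; split; near: n.
have l0 : (0 : R) <= 2 * n.+1%:R^-1 by rewrite mulr_ge0// invr_ge0.
have small : w n 1 ^+ 2 <= 16^-1.
  apply: le_trans (D_at1_sqr_le (Dw n)) _.
  apply: (@le_trans _ _ (bessel_lam n.+1%:R^-1 (w n) (w n))).
    by rewrite (bessel_lamE n.+1%:R^-1 (Dw n) (Dw n)) lerDl mulr_ge0// ip_ge0.
  by apply: le_trans An _; rewrite gerDr.
have big : `|w n 1 - 1| <= 2^-1.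
  have : `|L2dot mu p1 (w n \- cst 1)| <= (a 1)%:num / 2.
    apply: le_trans (ip_CS Lp (L2B (Lw n) L1)) _.
    apply: (@le_trans _ _ ((L2norm mu p1 + 1) * L2norm mu (w n \- cst 1))).
      by rewrite ler_wpM2r ?nm_ge0// lerDl.
    by rewrite mulrC -ler_pdivlMr.
  rewrite ip_pt// normrM gtr0_norm// ler_pM2l//.
move: small big; move: (w n 1) => t; rewrite ler_norml => H1 /andP[H2 _].
by nra.
Unshelve. all: by end_near. Qed.

Let chi m x := m.+1%:R^-1 * \sum_(k < m.+1) @cutoff R k.+1 x.
Let g_ m x := m.+1%:R^-1 * \sum_(k < m.+1) cutoff_op a k.+1 x.

Let sums n : [/\ L2 (fun x => \sum_(k < n) @cutoff R k.+1 x),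
  L2 (fun x => \sum_(k < n) cutoff_op a k.+1 x) &
  gen mu P (fun x => \sum_(k < n) @cutoff R k.+1 x) (fun x => \sum_(k < n) cutoff_op a k.+1 x)].
Proof.
have LX k : L2 (@cutoff R k.+1) by exact: L2_cutoff.
have Lg k : L2 (cutoff_op a k.+1) by exact: L2_cutoff_op.
have gX k : gen mu P (@cutoff R k.+1) (cutoff_op a k.+1).
  by apply/form_gen => //; exact: cutoff_form_op.
elim: n => [|n [IH1 IH2 IH3]].
  have := genZ sgP.1 0 (LX 0) (Lg 0) (gX 0).
  have E0 (f : nat -> R -> R) : (fun x => \sum_(k < 0) f k.+1 x) = (fun x => 0 * f 1%N x).
    by apply/funext => x; rewrite big_ord0 mul0r.
  by rewrite (E0 (@cutoff R)) (E0 (cutoff_op a)) => ?; split => //; apply: L2Z.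
have ES (f : nat -> R -> R) : (fun x => \sum_(k < n.+1) f k.+1 x) =
    (fun x => \sum_(k < n) f k.+1 x) \+ f n.+1.
  by apply/funext => x; rewrite big_ord_recr.
rewrite (ES (@cutoff R)) (ES (cutoff_op a)); split; [exact: L2D|exact: L2D|].
exact: (genD sgP.1 IH1 IH2 (LX n) (Lg n) IH3 (gX n)).
Qed.

Let sum_pt_le n x : \sum_(k < n) \1_[set k.+1%:R] x <= (x <= n%:R)%R%:R :> R.
Proof.
elim: n => [|n IH]; first by rewrite big_ord0 ler0n.
rewrite big_ord_recr/= indicE; case: (boolP (x \in _)) => [|_].
  rewrite inE => xn; move: IH; rewrite xn ler_nat ltnn lexx => IH.
  by rewrite -[leRHS]add0r lerD.
rewrite addr0; apply: le_trans IH _; rewrite ler_nat.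
case: (leP x n%:R) => //= xn; first by rewrite (le_trans xn) ?ler_nat.
Qed.

(** For the average [chi m] of the first cutoffs, [L (chi m)] is at most
    [2 C / m.+1]: at an integer [k] only one of the averaged functions
    [cutoff_op] is positive, with value at most
    [k (k + 1) / a k <= 2 C]. *)
Lemma conservative_of_bound :
  (ereal_sup [set (k%:R ^+ 2 / (a k)%:num)%:E | k in [set k : nat | (0 < k)%N]] < +oo)%E ->
  conservative mu P.
Proof.
move=> supoo.
have [C [C0 HC]] : exists C, 0 < C /\ forall k, (0 < k)%N -> k%:R ^+ 2 / (a k)%:num <= C.
  set s := ereal_sup _ in supoo.
  have H k : (0 < k)%N -> ((k%:R ^+ 2 / (a k)%:num)%:E <= s)%E.
    by move=> k0; apply: ereal_sup_ubound; exists k.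
  exists (`|fine s| + 1); split; first by rewrite ltr_wpDl.
  move=> k k0; have s0 : (0 <= s)%E.
    by apply: le_trans (H 1%N isT); rewrite lee_fin divr_ge0// sqr_ge0.
  have := H k k0; rewrite -(fineK (_ : s \is a fin_num)) ?ge0_fin_numE// lee_fin => /le_trans; apply.
  by rewrite (le_trans (ler_norm _))// lerDl.
have m0 m : (0 : R) < m.+1%:R^-1 by rewrite invr_gt0.
apply: (conservative_cutoff sgP.1 _ (chi_ := chi) (g_ := g_) (C := 2 * C)).
- by move=> b g Lb Lg /(form_gen Lb Lg); exact: form_op_excess.
- by rewrite mulr_gt0.
- by move=> m; have [L _ _] := sums m.+1; exact: L2Z.
- by move=> m; have [_ L _] := sums m.+1; exact: L2Z.
- by move=> m; have [L1 L2 G] := sums m.+1; exact: (genZ sgP.1 _ L1 L2 G).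
- move=> m x; rewrite /chi mulr_ge0 ?(ltW (m0 m))//=; last first.
    by apply: sumr_ge0 => k _; have /andP[] := @cutoff01 R k.+1 (ltn0Sn k) x.
  rewrite mulrC ler_pdivrMr// mul1r -[leRHS]/(m.+1%:R).
  rewrite -[m.+1 in leRHS]card_ord -sumr_const; apply: ler_sum => k _.
  by have /andP[] := @cutoff01 R k.+1 (ltn0Sn k) x.
- apply: aeW => x.
  have c1 : @cutoff R k.+1 x @[k --> \oo] --> (1 : R).
    apply: cvg_near_cst; near=> k; apply: cutoff_le => //.
    apply: (@le_trans _ _ (Num.truncn x).+1%:R); first exact/ltW/truncnS_gt.
    by rewrite ler_nat ltnS; near: k; exact: nbhs_infty_ge.
  have := cesaro c1; apply: cvg_trans; apply: near_eq_cvg; apply: nearW => m.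
  by rewrite /arithmetic_mean /chi seriesEord.
- move=> m; apply: aeW => x; rewrite /g_ mulrC ler_wpM2r ?(ltW (m0 m))//.
  apply: (@le_trans _ _ (2 * C * \sum_(k < m.+1) \1_[set k.+1%:R] x)); last first.
    rewrite -[leRHS]mulr1 ler_wpM2l ?mulr_ge0 ?(ltW C0)//.
    by apply: le_trans (sum_pt_le _ _) _; rewrite lern1 leq_b1.
  rewrite mulr_sumr; apply: ler_sum => k _; rewrite /cutoff_op.
  have i0 j : 0 <= (\1_[set j%:R] x : R) by rewrite indicE ler0n.
  apply: (@le_trans _ _ (k.+1%:R * k.+2%:R * (\1_[set k.+1%:R] x / (a k.+1)%:num))).
    by rewrite ler_wpM2l ?mulr_ge0// gerBl divr_ge0.
  rewrite mulrCA mulrC ler_wpM2r//.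
  apply: (@le_trans _ _ (2 * (k.+1%:R ^+ 2 / (a k.+1)%:num))); last by rewrite ler_wpM2l// HC.
  rewrite mulrA ler_wpM2r ?invr_ge0//.
  by rewrite expr2 mulrCA ler_wpM2l// -natrM ler_nat mul2n -addnn addSn ltnS leq_addl.
Unshelve. all: by end_near. Qed.

End conclusion.

Theorem theorem4p5 (R : realType) (a : nat -> {posnum R})
    (E : (R -> R) -> \bar R) (P : R -> (R -> R) -> R -> R)
    (traceE : is_trace a E) (sgP : semigroup_of (mu a) E P) :
  ((mu_disc a F < +oo)%E -> ~ conservative (mu a) P) /\
  (mu_disc a F = +oo%E ->
   (ereal_sup [set (k%:R ^+ 2 / (a k)%:num)%:E | k in [set k : nat | (0 < k)%N]]
      < +oo)%E ->
   (limn_einf (fun k : nat =>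
      (ln (\sum_(1 <= j < k.+1) (a j)%:num) / (k%:R * ln k%:R))%:E) < +oo)%E ->
   conservative (mu a) P).
Proof.
split; first exact: not_conservative traceE sgP.
by move=> _ supoo _; exact: conservative_of_bound traceE sgP supoo.
Qed.
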